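(* Let $\widehat\omega_M$ be a sequence of random point processes on $\mathbb{R}$ such that: (i) $\widehat\omega_M$ converges in distribution, as $M\to\infty$, to the standard Poisson process; (ii) for all $\varepsilon>0$ $$\lim_{W\to\infty}\limsup_{M\to\infty}\mathbb{P}\Big(\Big|\sum_{v\in\widehat\omega_M}\frac{\mathbf{1}[|v|>W]}{v}\Big|\ge\varepsilon\Big)=0,\qquad \lim_{W\to\infty}\limsup_{M\to\infty}\mathbb{P}\Big(\sum_{v\in\widehat\omega_M}\frac{\mathbf{1}[|v|>W]}{v^2}\ge\varepsilon\Big)=0 .$$ Let $\widehat S_{M,\widehat\omega}(u)=\sum_{v\in\widehat\omega_M}\frac1{v-u}$, and let $K_M(u)$ be a sequence of random Herglotz-Pick functions with generalized linear limiting behavior; no assumption is made on the joint law of $\widehat\omega_M$ and $K_M$ beyond their being defined on a common probability space. Then the intertwined point process consisting of the support of $\widehat\omega_M$ and of the solution set (in $u\in\mathbb{R}$) of the equation $$\widehat S_{M,\widehat\omega}(u)+K_M(u)=0$$ has the following limit as $M\to\infty$: (1) If $K_M$ has a regular linear limit given by a constant function, of value $b\in\mathbb{R}$, then the intertwined point process converges in distribution to the Šeba process at level $\alpha=b$. (2) If $K_M$ has a singular $(+\infty)$ or singular $(-\infty)$ limit, then the solution set coincides asymptotically with $\widehat\omega_M$ (the pair consisting of $\widehat\omega_M$ and the solution set converges in distribution to $(\omega,\omega)$, with $\omega$ the standard Poisson process). (3) If $K_M$ has a singular limit with transition, at transition point $\tau$, then the solution set converges to the limit of $\widehat\omega_M\cup\{\tau\}$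 (the pair consisting of $\widehat\omega_M$ and the solution set converges in distribution to $(\omega,\omega\cup\{\tau\})$).
   Context: Herglotz-Pick functions are analytic functions from the upper half plane $\mathbb{C}^+$ to $\mathbb{C}^+$. The functions $K_M$ are considered on the real line: for each fixed window $[-W,W]$, $K_M$ is (with probability tending to $1$ as $M\to\infty$) continuous, real valued and monotone increasing on $[-W,W]$, as is the case for functions whose Herglotz spectral measure does not charge $(-L_M,L_M)$ with $L_M\to\infty$. Generalized linear limits. $K_M$ is said to have a generalized linear limit if one of the following holds (for all $0<W<\infty$ and $\varepsilon>0$): - regular linear limit: for some $a\ge0$, $b\in\mathbb{R}$, $\lim_{M\to\infty}\mathbb{P}(\max_{u\in[-W,W]}|K_M(u)-(au+b)|\le\varepsilon)=1$; it is given by a constant function of value $b$ if $a=0$; - singular $(\sigma\infty)$ limit, $\sigma\in\{+1,-1\}$: for every $b\in\mathbb{R}$, $\lim_{M\to\infty}\mathbb{P}(\min_{u\in[-W,W]}\sigma K_M(u)>b)=1$; - singular limit with transition: there is $\tau\in\mathbb{R}$ (the transition point) such that for every $b\in\mathbb{R}$ and $\varepsilon>0$, $\lim_{M\to\infty}\mathbb{P}(K_M(\tau+\varepsilon)>b)=1$ and $\lim_{M\to\infty}\mathbb{P}(-K_M(\tau-\varepsilon)>b)=1$. Šeba process. The standard Poisson process is the Poisson point process on $\mathbb{R}$ of unit intensity. Let $\omega$ be its configuration, with points labeled $\dots<\omega_{-1}<\omega_0\le0<\omega_1<\dots$, and let $S_\omega(\zeta)=\lim_{n\to\infty}\sum_{v\in\omega\cap[-n,n]}\frac1{v-\zeta}$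 (the limit exists almost surely for all $\zeta\in\mathbb{C}^+$ and for all $\zeta\in\mathbb{R}\setminus\omega$; between consecutive points of $\omega$ it increases from $-\infty$ to $+\infty$). For $\alpha\in\mathbb{R}$ let $(u_n)$ be the set of real solutions of $S_\omega(u)=-\alpha$, labeled so that $\omega_{n-1}<u_n\le\omega_n$. The Šeba process at level $\alpha$ is the intertwined point process $(\{\omega_n,u_n\})_{n\in\mathbb{Z}}$. Convergence in distribution of (pairs of) point processes is with respect to the vague topology, i.e. convergence within bounded windows. The sums over $\widehat\omega_M$ are assumed well defined (automatic for finite configurations; for infinite ones, sums of $1/v$ and $1/(v-u)$ are limits of sums over $\widehat\omega_M\cap[-n,n]$). *)

(* Defs.v *)
From HB Require Import structures.
From mathcomp Require Import all_boot all_order all_algebra.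
From mathcomp Require Import all_classical all_reals all_analysis.
From mathcomp Require Import complex.

Set Implicit Arguments.
Unset Strict Implicit.
Unset Printing Implicit Defensive.

Import Order.TTheory GRing.Theory Num.Theory.
Import numFieldNormedType.Exports.

Local Open Scope classical_set_scope.
Local Open Scope ring_scope.

(* A locally finite configuration is an integer-valued Radon measure on R,
   encoded by the multiplicity of each of its atoms. *)
Record conf (R : realType) := Conf {
  mult :> R -> nat ;
  conf_finite : forall W : R, finite_set [set v | `|v| <= W /\ mult v <> 0%N] }.

HB.instance Definition _ (R : realType) := gen_eqMixin (conf R).
HB.instance Definition _ (R : realType) := gen_choiceMixin (conf R).

Definition supp (R : realType) (m : conf R) : set R := [set v | m v <> 0%N].

(* The integral of f against the measure m. The finitely supported sum is the
   intended one as soon as f vanishes outside a bounded set, which is the case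
   in each of the uses below. *)
Definition conf_int (R : realType) (m : conf R) (f : R -> R) : R :=
  \sum_(v \in [set: R]) (m v)%:R * f v.

Definition count (R : realType) (m : conf R) (B : set R) : R :=
  conf_int m (\1_B).

Definition test_fun (R : realType) : Type :=
  {f : R -> R | continuous f /\ exists W, forall v, W < `|v| -> f v = 0}.

Definition vague_eval (R : realType) (m : conf R) : {ptws test_fun R -> R} :=
  fun f => conf_int m (sval f).

(* The vague topology is the coarsest one for which integration against each
   continuous function of compact support is continuous. *)
HB.instance Definition _ (R : realType) :=
  Topological.copy (conf R) (initial_topology (@vague_eval R)).

Section conf_of_set.
Variables (R : realType) (Z : set R).

Let near_finite (v : R) := finite_set (Z `&` `[- (`|v| + 1), `|v| + 1]).

Let conf_of_set_mult (v : R) : nat := `[< Z v /\ near_finite v >].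

Let conf_of_set_finite (W : R) :
  finite_set [set v | `|v| <= W /\ conf_of_set_mult v <> 0%N].
Proof.
set A := [set v | `|v| <= W /\ conf_of_set_mult v <> 0%N].
have [[z Az]|nA] := pselect (exists z, A z); last first.
  suff -> : A = set0 by exact: finite_set0.
  by rewrite -subset0 => z Az; apply: nA; exists z.
have AP v : A v -> Z v /\ near_finite v.
  by move=> [_]; rewrite /conf_of_set_mult; case: asboolP.
set N := [set `|v| | v in A].
have hN : has_sup N.
  split; first by exists `|z|, z.
  by exists W => _ [v [? _] <-].
have [_ [v Av <-] vlt] := sup_adherent (@ltr01 R) hN.
have [_ fv] := AP _ Av.
apply: sub_finite_set fv => w Aw; split; first by have [] := AP _ Aw.
have ws : `|w| <= sup N.
  by apply: ub_le_sup; [case: hN|exists w].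
rewrite /= in_itv /= -ler_norml (le_trans ws)//.
by rewrite -lerBlDr ltW.
Qed.

(* The simple configuration with support Z. When Z is not locally finite, only
   the points v of Z for which Z is finite on [-|v|-1, |v|+1] are retained, so
   that Z is not altered on [-W, W] when it is finite on [-W-1, W+1]. *)
Definition conf_of_set : conf R := Conf conf_of_set_finite.

End conf_of_set.

Definition bounded_borel (R : realType) (B : set R) : Prop :=
  measurable B /\ exists W : R, B `<=` `[- W, W].

(* The evaluations at bounded Borel sets generate the Borel sigma-algebra of
   the vague topology. *)
Definition point_process (R : realType) d (T : measurableType d)
    (X : T -> conf R) : Prop :=
  forall B : set R, bounded_borel B ->
    measurable_fun setT (fun t => count (X t) B).

Definition standard_poisson (R : realType) d (T : measurableType d)
    (P : probability T R) (X : T -> conf R) : Prop :=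
  [/\ point_process X,
      forall (B : set R) (k : nat), bounded_borel B ->
        P [set t | count (X t) B = k%:R] =
        (let r := fine (lebesgue_measure B) in
         expR (- r) * r ^+ k / k`!%:R)%:E
    & forall (n : nat) (B : 'I_n -> set R) (k : 'I_n -> nat),
        (forall i, bounded_borel (B i)) -> trivIset setT B ->
        P [set t | forall i, count (X t) (B i) = (k i)%:R] =
        (\prod_(i < n) P [set t | count (X t) (B i) = (k i)%:R])%E].

(* For each M the random element X M lives on its own probability space. The
   expectation of a function F >= 0 is the supremum of the integrals of the
   nonnegative simple functions below F, that is an inner expectation when F is
   not measurable. As Phi and C - Phi are both tested, no measurability
   assumption on X M is needed for this notion, which is the usual one when
   X M is measurable. *)
Definition cvg_in_distribution (R : realType) (E : topologicalType)
    d (T : nat -> measurableType d) (P : forall M, probability (T M) R)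
    (X : forall M, T M -> E)
    d' (T' : measurableType d') (P' : probability T' R) (Y : T' -> E) : Prop :=
  forall Phi : E -> R, continuous Phi ->
    (exists C, forall e, `|Phi e| <= C) ->
    (\int[P M]_t (Phi (X M t))%:E @[M --> \oo] --> \int[P']_t (Phi (Y t))%:E)%E.

(* The events A M have probability tending to 1. For events that are not
   measurable this means that their inner probability does. *)
Definition whp (R : realType) d (T : nat -> measurableType d)
    (P : forall M, probability (T M) R) (A : forall M, set (T M)) : Prop :=
  exists G : forall M, set (T M),
    [/\ forall M, measurable (G M), forall M, G M `<=` A M
      & (P M (G M) @[M --> \oo] --> 1)%E].

(* Sums are limits of sums over the points in [-n, n]. *)
Definition partial_sum (R : realType) (m : conf R) (g : R -> R) (n : nat) : R :=
  conf_int m (fun v => if `|v| <= n%:R then g v else 0).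

Definition conf_sum (R : realType) (m : conf R) (g : R -> R) : R :=
  limn (partial_sum m g).

Definition stieltjes (R : realType) (m : conf R) (u : R) : R :=
  conf_sum m (fun v => (v - u)^-1).

Definition tail1 (R : realType) (W : R) (m : conf R) : R :=
  conf_sum m (fun v => if W < `|v| then v^-1 else 0).

Definition tail2 (R : realType) (W : R) (m : conf R) : \bar R :=
  \esum_(v in [set v | W < `|v|]) ((m v)%:R / v ^+ 2)%:E.

Definition sums_defined (R : realType) (m : conf R) : Prop :=
  (forall W : R, 0 < W ->
     cvgn (partial_sum m (fun v => if W < `|v| then v^-1 else 0))) /\
  (forall u : R, ~ supp m u -> cvgn (partial_sum m (fun v => (v - u)^-1))).

Definition tails_vanish (R : realType) d (T : nat -> measurableType d)
    (P : forall M, probability (T M) R) (X : forall M, T M -> conf R) : Prop :=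
  forall e : R, 0 < e ->
    (limn_esup (fun M => P M [set t | e <= `|tail1 W (X M t)|%R]%R)
       @[W --> +oo%R] --> 0)%E /\
    (limn_esup (fun M => P M [set t | (e%:E <= tail2 W (X M t))%E])
       @[W --> +oo%R] --> 0)%E.

Definition herglotz (R : realType) (F : R[i] -> R[i]) : Prop :=
  forall z : R[i], 0 < complex.Im z ->
    0 < complex.Im (F z) /\ derivable (F : R[i]^o -> R[i]^o) z 1.

Definition has_boundary_value (R : realType) (F : R[i] -> R[i]) (u : R)
    (l : R[i]^o) : Prop :=
  (F (u +i* y)%C : R[i]^o) @[y --> (0:R)^'+] --> l.

(* The value on the real line of a Herglotz-Pick function F, meaningful only at
   the points u at which F (u + i0) exists and is real. *)
Definition boundary_re (R : realType) (F : R[i] -> R[i]) (u : R) : R :=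
  complex.Re (lim ((F (u +i* y)%C : R[i]^o) @[y --> (0:R)^'+])).

Definition regular_on (R : realType) (W : R) (F : R[i] -> R[i]) : Prop :=
  [/\ {in `[- W, W], forall u,
        has_boundary_value F u (boundary_re F u)%:C%C},
      {within `[- W, W], continuous (boundary_re F)}
    & {in `[- W, W] &, {homo boundary_re F : u v / u <= v}}].

Definition random_herglotz (R : realType) d (T : nat -> measurableType d)
    (P : forall M, probability (T M) R)
    (K : forall M, T M -> R[i] -> R[i]) : Prop :=
  [/\ forall M t, herglotz (K M t),
      forall M (z : R[i]), 0 < complex.Im z ->
        measurable_fun setT (fun t => complex.Re (K M t z)) /\
        measurable_fun setT (fun t => complex.Im (K M t z))
    & forall W : R, 0 < W -> whp P (fun M => [set t | regular_on W (K M t)])].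

Section generalized_linear_limits.
Variables (R : realType) (d : measure_display) (T : nat -> measurableType d).
Variables (P : forall M, probability (T M) R).
Variable K : forall M, T M -> R[i] -> R[i].

Definition regular_linear_limit (a b : R) : Prop :=
  forall W e : R, 0 < W -> 0 < e ->
    whp P (fun M => [set t | {in `[- W, W], forall u,
      `|boundary_re (K t) u - (a * u + b)| <= e}]).

Definition singular_limit (sigma : R) : Prop :=
  forall W b : R, 0 < W ->
    whp P (fun M => [set t | {in `[- W, W], forall u,
      b < sigma * boundary_re (K t) u}]).

Definition singular_transition_limit (tau : R) : Prop :=
  forall b e : R, 0 < e ->
    whp P (fun M => [set t | b < boundary_re (K t) (tau + e)]) /\
    whp P (fun M => [set t | b < - boundary_re (K t) (tau - e)]).

Definition generalized_linear_limit : Prop :=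
  [\/ exists a b, 0 <= a /\ regular_linear_limit a b,
      singular_limit 1 \/ singular_limit (-1)
    | exists tau, singular_transition_limit tau].

End generalized_linear_limits.

(* The solutions of S_m(u) + F(u) = 0; the points of m are poles of S_m, and F
   must have a real boundary value at u. *)
Definition solution_set (R : realType) (m : conf R) (F : R[i] -> R[i]) :
    set R :=
  [set u | ~ supp m u /\ has_boundary_value F u (- stieltjes m u)%:C%C].

Definition seba_process (R : realType) d (T : measurableType d)
    (omega : T -> conf R) (alpha : R) (t : T) : conf R * conf R :=
  (omega t,
   conf_of_set [set u | ~ supp (omega t) u /\
                        stieltjes (omega t) u = - alpha]).

(* Main.v *)
Require Import Defs.
From HB Require Import structures.
From mathcomp Require Import all_boot all_order all_algebra.
From mathcomp Require Import all_classical all_reals all_analysis.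
From mathcomp Require Import complex.
From mathcomp Require Import lra ring zify measurable_realfun.

Set Implicit Arguments.
Unset Strict Implicit.
Unset Printing Implicit Defensive.

Import Order.TTheory GRing.Theory Num.Theory.
Import numFieldNormedType.Exports.

Local Open Scope classical_set_scope.
Local Open Scope ring_scope.

(** Almost surely, the Poisson configuration is simple, charges no given point,
    and its number of points in the shells ]k^5, (k+1)^5] and [-(k+1)^5, -k^5[
    differs from their length by at most k^3 for k large (Chernoff bounds and
    the Borel-Cantelli lemma); hence the principal value sums converge. Only the
    one-dimensional laws of the process are needed for this.

    For such a configuration omega the solutions are stable. Let m be vaguely
    close to omega, let N be large, and let h be nondecreasing and close to the
    limit of K_M. Between two atoms of m, the function
    u |-> sum_(|v| <= N) 1/(v - u) + h u increases; thus its signs at both ends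
    of a small window around an atom of omega, or around a limiting zero, tell
    whether it has exactly one zero or none in this window. By (ii), with high
    probability, the sum over the atoms of modulus greater than N, added to K_M,
    is such a function h.

    This gives liminf P (X_M in U) >= P (Y in U) for U open and P an inner
    probability, from which convergence in distribution follows. The same
    inequality for omega_M comes from the hypothesis, because a vaguely open set
    is on simple configurations a countable union of sets {Phi > 0} with Phi
    continuous, bounded and measurable. *)

(** * Integrals against configurations *)

(** The solution set is not shown to be a measurable function of the sample point, and no joint law
    of omega_M and K_M is available. Both obstacles are met by a stability statement that is
    deterministic and uniform in the perturbation: [stable U k N] consists of the configurations for
    which every admissible h in a class indexed by k yields a pair in U. Randomness then enters
    through two separate events, one on omega_M and one on the perturbation, and a union bound
    intersects them.

    The nesting of the limits is imposed by (ii), an iterated limit: k fixes the window and the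
    accuracy, N the truncation, and both are chosen before M.

    The truncation also makes vague convergence usable. The kernel 1/(v - u) has unbounded support;
    cut at |v| = N it is bounded in support, at the price of jumps at -N and N. These, like the pole
    u, are harmless as long as they are not atoms of the limit, which explains why continuity is
    only asked at atoms and why integers must not be charged. *)

#[global] Instance conf_nbhs_filter (R : realType) (m : conf R) :
  Filter (nbhs (m : conf R)) := @nbhs_filter (conf R) m.

Section atoms.
Context {R : realType}.
Implicit Types (m z : conf R) (f g : R -> R) (W : R).

Definition vanish (W : R) (f : R -> R) := forall v, W < `|v| -> f v = 0.

Lemma vanish_le W W' f : W <= W' -> vanish W f -> vanish W' f.
Proof. by move=> WW' h v Wv; apply: h; exact: le_lt_trans Wv. Qed.

Definition atoms m W : seq R :=
  finmap.enum_fset (fset_set [set v | `|v| <= W /\ m v <> 0%N]).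

Lemma atoms_uniq m W : uniq (atoms m W).
Proof. exact: finmap.fset_uniq. Qed.

Lemma mem_atoms m W v : v \in atoms m W <-> `|v| <= W /\ m v <> 0%N.
Proof.
rewrite /atoms in_fset_set ?inE//; exact: (conf_finite m W).
Qed.

Lemma conf_int_seq m f (s : seq R) : uniq s ->
  (forall v, m v <> 0%N -> f v != 0 -> v \in s) ->
  conf_int m f = \sum_(v <- s) (m v)%:R * f v.
Proof.
move=> us hs; rewrite /conf_int [RHS]fsbig_seq//; apply/esym/fsbig_widen => //.
move=> v [_ /= vs]; apply/eqP; apply: contrapT => /negP.
rewrite mulf_eq0 negb_or pnatr_eq0 => /andP[/eqP mv fv].
by apply: vs; exact: hs.
Qed.

Lemma conf_int_atoms m W f : vanish W f ->
  conf_int m f = \sum_(v <- atoms m W) (m v)%:R * f v.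
Proof.
move=> Wf; apply: conf_int_seq; first exact: atoms_uniq.
move=> v mv fv; apply/mem_atoms; split => //.
by rewrite leNgt; apply: contra fv => Wv; rewrite Wf.
Qed.

Lemma eq_conf_int m f g : (forall v, m v <> 0%N -> f v = g v) ->
  conf_int m f = conf_int m g.
Proof.
move=> fg; rewrite /conf_int; apply: eq_fsbigr => v _.
by have [->|/eqP/fg ->//] := eqVneq (m v) 0%N; rewrite !mul0r.
Qed.

Lemma conf_intD m W f g : vanish W f -> vanish W g ->
  conf_int m (fun v => f v + g v) = conf_int m f + conf_int m g.
Proof.
move=> Wf Wg; rewrite !(@conf_int_atoms _ W)//.
  by rewrite -big_split/=; apply: eq_bigr => v _; rewrite mulrDr.
by move=> v Wv; rewrite Wf// Wg// addr0.
Qed.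

Lemma conf_intZ m W c f : vanish W f ->
  conf_int m (fun v => c * f v) = c * conf_int m f.
Proof.
move=> Wf; rewrite !(@conf_int_atoms _ W)//.
  by rewrite big_distrr/=; apply: eq_bigr => v _; rewrite mulrCA.
by move=> v Wv; rewrite Wf// mulr0.
Qed.

Lemma conf_intB m W f g : vanish W f -> vanish W g ->
  conf_int m (fun v => f v - g v) = conf_int m f - conf_int m g.
Proof.
move=> Wf Wg; rewrite !(@conf_int_atoms _ W)//.
  by rewrite -sumrB/=; apply: eq_bigr => v _; rewrite mulrBr.
by move=> v Wv; rewrite Wf// Wg// subr0.
Qed.

Lemma conf_int_sum m W (I : Type) (r : seq I) (F : I -> R -> R) :
  (forall i, vanish W (F i)) ->
  conf_int m (fun v => \sum_(i <- r) F i v) = \sum_(i <- r) conf_int m (F i).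
Proof.
move=> WF; rewrite (@conf_int_atoms _ W); last first.
  by move=> v Wv; rewrite big1// => i _; exact: WF.
under eq_bigr do rewrite mulr_sumr.
rewrite exchange_big/=; apply: eq_bigr => i _.
by rewrite (@conf_int_atoms _ W).
Qed.

Lemma ler_conf_int m W f g : vanish W f -> vanish W g ->
  (forall v, m v <> 0%N -> f v <= g v) -> conf_int m f <= conf_int m g.
Proof.
move=> Wf Wg fg; rewrite !(@conf_int_atoms _ W)//.
rewrite big_seq [leRHS]big_seq; apply: ler_sum => v /mem_atoms[_ mv].
by apply: ler_wpM2l => //; exact: fg.
Qed.

Lemma conf_int_ge0 m f : (forall v, m v <> 0%N -> 0 <= f v) -> 0 <= conf_int m f.
Proof.
move=> f0; rewrite /conf_int; apply: fsumr_ge0 => v _.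
have [->|/eqP/f0 ?] := eqVneq (m v) 0%N; first by rewrite mul0r.
exact: mulr_ge0.
Qed.

Lemma ler_norm_conf_int m W f g : vanish W f -> vanish W g ->
  (forall v, m v <> 0%N -> `|f v| <= g v) -> `|conf_int m f| <= conf_int m g.
Proof.
move=> Wf Wg fg; rewrite !(@conf_int_atoms _ W)//.
apply: le_trans (ler_norm_sum _ _ _) _.
rewrite big_seq [leRHS]big_seq; apply: ler_sum => v /mem_atoms[_ mv].
by rewrite normrM ger0_norm//; apply: ler_wpM2l => //; exact: fg.
Qed.

Lemma conf_int_ge1 m W f v : vanish W f -> (forall x, m x <> 0%N -> 0 <= f x) ->
  m v <> 0%N -> (m v)%:R * f v <= conf_int m f.
Proof.
move=> Wf f0 mv.
have [vW|Wv] := leP `|v| W; last by rewrite Wf// mulr0 conf_int_ge0.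
rewrite (@conf_int_atoms _ W)// (bigD1_seq v)/= ?atoms_uniq//; last exact/mem_atoms.
rewrite lerDl big_seq_cond; apply: sumr_ge0 => x /andP[/mem_atoms[_ mx] _].
by apply: mulr_ge0 => //; exact: f0.
Qed.

(** Applied to a bump function, this excludes two distinct atoms on its plateau. *)
Lemma conf_int_ge2 m W f v w : vanish W f -> (forall x, m x <> 0%N -> 0 <= f x) ->
  m v <> 0%N -> m w <> 0%N -> v != w -> f v + f w <= conf_int m f.
Proof.
move=> Wf f0 mv mw vw.
have g1 x : m x <> 0%N -> f x <= (m x)%:R * f x.
  move=> mx; rewrite ler_peMl//; first exact: f0.
  by rewrite ler1n lt0n; exact/eqP.
have [vW|Wv] := leP `|v| W; last first.
  by rewrite (Wf v)// add0r (le_trans (g1 _ mw))//; exact: (@conf_int_ge1 _ W).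
have [wW|Ww] := leP `|w| W; last first.
  by rewrite (Wf w)// addr0 (le_trans (g1 _ mv))//; exact: (@conf_int_ge1 _ W).
rewrite (@conf_int_atoms _ W)// (bigD1_seq v)/= ?atoms_uniq//; last exact/mem_atoms.
apply: lerD; first exact: g1.
rewrite -big_filter (bigD1_seq w)/=; last 2 first.
- by rewrite mem_filter eq_sym vw; apply/mem_atoms.
- by rewrite filter_uniq// atoms_uniq.
rewrite (le_trans (g1 _ mw))// lerDl big_seq_cond.
apply: sumr_ge0 => x; rewrite mem_filter => /andP[/andP[_ /mem_atoms[_ mx]] _].
by apply: mulr_ge0 => //; exact: f0.
Qed.

(* The last window is smaller, as an atom of m' near the boundary of [-W, W] may
   correspond to an atom of m outside of it. *)
Definition close (W e : R) m m' := exists phi : R -> R,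
  [/\ forall p, m p <> 0%N -> `|p| <= W -> `|phi p - p| < e /\ m' (phi p) = 1%N,
      forall p q, m p <> 0%N -> `|p| <= W -> m q <> 0%N -> `|q| <= W ->
        phi p = phi q -> p = q
    & forall v, m' v <> 0%N -> `|v| <= W - 1 ->
        exists p, [/\ m p <> 0%N, `|p| <= W & phi p = v]].

(** The bound e <= 1 pays for the smaller last window: an atom of m' in [-(W - 1), W - 1] is matched
    with an atom of m at distance less than 1, hence in [-W, W]. *)
Lemma close_le W W' e e' m m' : W <= W' -> e' <= e -> e <= 1 ->
  close W' e' m m' -> close W e m m'.
Proof.
move=> WW' ee e1 [phi [h1 h2 h3]]; exists phi; split.
- move=> p mp pW; have [] := h1 p mp (le_trans pW WW').
  by move=> h ->; split => //; exact: lt_le_trans ee.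
- by move=> p q mp pW mq qW; apply: h2 => //; exact: le_trans WW'.
- move=> v mv vW; have [|p [mp pW' pv]] := h3 v mv; first lra.
  exists p; split => //.
  have [+ _] := h1 p mp pW'; rewrite pv => vp.
  have := ler_normD v (p - v); rewrite addrC subrK distrC.
  lra.
Qed.

Definition simple m := forall v, (m v <= 1)%N.

Lemma simple1 m v : simple m -> m v <> 0%N -> m v = 1%N.
Proof. by move=> /(_ v); case: (m v) => [|[]]. Qed.

Lemma near_seq (T : Type) (s : seq R) (F : set_system T) (FF : Filter F)
    (Q : R -> T -> Prop) :
  (forall p, p \in s -> \forall e \near F, Q p e) ->
  \forall e \near F, forall p, p \in s -> Q p e.
Proof.
elim: s => [|a s ih] h; first by apply: nearW.
have ha := h a (mem_head _ _).
have hs := ih (fun p ps => h p (mem_behead (s := a :: s) ps)).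
near=> e => p; rewrite inE => /orP[/eqP ->|]; first by near: e.
by move: p; near: e.
Unshelve. all: by end_near. Qed.

(** The matching turns both integrals into sums over the same finite list of atoms, with
    multiplicity one on each side. Continuity is asked at the atoms of m only, as g will be a
    resolvent kernel with jumps. *)
Lemma conf_int_close m W g : simple m -> vanish (W - 1) g ->
  (forall p, m p <> 0%N -> `|p| <= W -> {for p, continuous g}) ->
  forall e, 0 < e -> \forall d \near 0^'+, forall m', close W d m m' ->
    `|conf_int m' g - conf_int m g| < e.
Proof.
move=> sm Wg cg e e0.
have WW : W - 1 <= W by lra.
set s := atoms m W.
(* The error is shared between the atoms; the successor makes the total strictly less than e and
   allows an empty list. *)
pose e' := e / (size s).+1%:R.
have e'0 : 0 < e' by rewrite divr_gt0.
have : \forall d \near (0:R)^'+, forall p, p \in s -> forall v, `|v - p| < d -> `|g v - g p| < e'.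
  apply: near_seq => p /mem_atoms[pW mp].
  have := cg p mp pW => /cvgrPdist_lt/(_ _ e'0) [d /= d0 hd].
  near=> d' => v vd; rewrite distrC; apply: hd => /=.
  rewrite distrC; apply: lt_trans vd _; near: d'; exact: nbhs_right_lt.
apply: filterS => d hd m' [phi [h1 h2 h3]].
have -> : conf_int m' g = \sum_(p <- s) g (phi p).
  rewrite (@conf_int_seq _ _ (map phi s)).
  - rewrite big_map big_seq [RHS]big_seq; apply: eq_bigr => p /mem_atoms[pW mp].
    by have [_ ->] := h1 p mp pW; rewrite mul1r.
  - rewrite map_inj_in_uniq ?atoms_uniq// => p q /mem_atoms[pW mp] /mem_atoms[qW mq].
    exact: h2.
  - move=> v mv gv; have [|p [mp pW <-]] := h3 v mv.
      by rewrite leNgt; apply: contra gv => Wv; rewrite Wg.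
    by apply: map_f; apply/mem_atoms.
rewrite (@conf_int_atoms _ W) -/s; last exact: vanish_le Wg.
have -> : \sum_(v <- s) (m v)%:R * g v = \sum_(v <- s) g v.
  rewrite big_seq [RHS]big_seq; apply: eq_bigr => p /mem_atoms[pW mp].
  by rewrite (simple1 sm mp) mul1r.
rewrite -sumrB; apply: le_lt_trans (ler_norm_sum _ _ _) _.
apply: (@le_lt_trans _ _ (\sum_(p <- s) e')).
  rewrite big_seq [leRHS]big_seq; apply: ler_sum => p ps.
  move/mem_atoms : (ps) => [pW mp]; apply/ltW/hd => //.
  by have [] := h1 p mp pW.
rewrite big_const_seq count_predT iter_addr addr0 -[_ *+ size s]mulr_natr /e' mulrAC ltr_pdivrMr//.
by rewrite ltr_pM2l// ltr_nat.
Unshelve. all: by end_near. Qed.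

Definition close_filter m : set_system (conf R) :=
  [set U | exists W, \forall d \near 0^'+, forall m', close W d m m' -> U m'].

Lemma close_filter_filter m : Filter (close_filter m).
Proof.
split.
- by exists 0; apply: nearW.
- move=> A B [WA hA] [WB hB]; exists (Num.max WA WB); near=> d => m' hm'.
  have d1 : d <= 1 by near: d; exact: nbhs_right_le.
  split.
  + have : forall m', close WA d m m' -> A m' by near: d.
    by apply; apply: close_le hm'; rewrite // le_max lexx.
  + have : forall m', close WB d m m' -> B m' by near: d.
    by apply; apply: close_le hm'; rewrite // le_max lexx orbT.
- move=> A B AB [W hW]; exists W; apply: filterS hW => d hd m' /hd; exact: AB.
Unshelve. all: by end_near. Qed.

(** The topology is initial for [vague_eval] into a product space, so it suffices that the integral
    of each test function converges along [close_filter m]. *)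
Lemma nbhs_close m U : simple m -> nbhs m U ->
  exists W, \forall d \near 0^'+, forall m', close W d m m' -> U m'.
Proof.
move=> sm [/= _ [[V oV <-] Vm VU]].
have FF := close_filter_filter m.
suff : (@vague_eval R @ close_filter m) --> (vague_eval m).
  move=> /(_ V (open_nbhs_nbhs (conj oV Vm))) [W hW].
   exists W; apply: filterS hW => d hd m' /hd; exact: VU.
apply/cvg_sup => f; apply/cvg_image.
  by rewrite -subTset => x _; exists (fun=> x).
apply: (@cvg_trans _ ((fun m' => conf_int m' (sval f)) @ close_filter m)).
  move=> /= B hB; exists ((fun x => x f) @^-1` B) => //.
  by apply/seteqP; split => [y [x Bx <-]//|y By]; exists (fun=> y).
case: f => /= f [cf [W Wf]].
apply/cvgrPdist_lt => e e0; exists (W + 1); near=> d => m' hm' /=.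
rewrite distrC; move: m' hm'; near: d; apply: conf_int_close => //.
- by rewrite addrK.
- by move=> p _ _; exact: cf.
Unshelve. all: by end_near. Qed.
End atoms.

(** * A countable family of continuous functions *)

Section countable_family.
Context {R : realType}.
Implicit Types (m z : conf R) (f g : R -> R) (W : R).

Lemma conf_int_continuous (f : test_fun R) :
  continuous (fun m : conf R => conf_int m (sval f)).
Proof.
move=> m.
have /cvg_sup/(_ f)/cvg_image h : @vague_eval R m' @[m' --> m] --> vague_eval m.
  exact: (@initial_continuous _ _ (@vague_eval R)).
have hs : range (fun x : test_fun R -> R => x f) = setT.
  by apply/seteqP; split => y // _; exists (fun=> y).
apply: cvg_trans (h hs).
move=> B /= [A hA <-].
have hA' : nbhs m (@vague_eval R @^-1` A) by [].
apply: (filterS _ hA') => m' Am' /=; by exists (vague_eval m').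
Qed.

Definition clip (x : R) : R := Num.max 0 (Num.min 1 x).

Lemma clip_continuous : continuous clip.
Proof.
move=> x; apply: continuous_max; first exact: cst_continuous.
apply: continuous_min; [exact: cst_continuous|exact: cvg_id].
Qed.

Lemma clip_ge0 x : 0 <= clip x.
Proof. by rewrite /clip le_max lexx. Qed.

Lemma clip_le1 x : clip x <= 1.
Proof. by rewrite /clip ge_max ler01 ge_min lexx. Qed.

Lemma clip1 x : 1 <= x -> clip x = 1.
Proof. by move=> x1; rewrite /clip min_l// max_r. Qed.

Lemma clip0 x : x <= 0 -> clip x = 0.
Proof. by move=> x0; rewrite /clip max_l// ge_min x0 orbT. Qed.

Lemma clip_gt0 x : 0 < clip x -> 0 < x.
Proof. by apply: contraPT; rewrite -leNgt => /clip0 ->; rewrite ltxx. Qed.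

(** With r = 1/(k+1), this is 1 within 2r of q and 0 from 3r on. The plateau contains the zone where
    [rest] drops below 1 because of q, so an atom overlooked by [rest] is seen by a bump with full
    weight. *)
Definition bump (q : R) (k : nat) (v : R) : R := clip (3 - `|v - q| * k.+1%:R).

Definition rest (n k : nat) (Q : seq R) (v : R) : R :=
  clip (n%:R - `|v|) * \prod_(q <- Q) clip (`|v - q| * k.+1%:R - 1).

Lemma cvg_clip T (F : set_system T) (FF : Filter F) (f : T -> R) (a : R) :
  f x @[x --> F] --> a -> clip (f x) @[x --> F] --> clip a.
Proof. by move=> fa; apply: (cvg_comp _ _ fa); exact: clip_continuous. Qed.

Lemma cvg_bigprod (I : Type) T (F : set_system T) (FF : Filter F) (s : seq I)
    (f : I -> T -> R) (a : I -> R) :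
  (forall i, f i x @[x --> F] --> a i) ->
  \prod_(i <- s) f i x @[x --> F] --> \prod_(i <- s) a i.
Proof.
move=> fa; elim: s => [|i s ih].
  by under eq_fun do rewrite big_nil; rewrite big_nil; exact: cvg_cst.
by under eq_fun do rewrite big_cons; rewrite big_cons; exact: cvgM.
Qed.

Lemma cvg_pos_part T (F : set_system T) (FF : Filter F) (f : T -> R) (a : R) :
  f x @[x --> F] --> a -> Num.max 0 (f x) @[x --> F] --> Num.max 0 a.
Proof.
have cm : continuous (fun x : R => Num.max 0 x).
  by move=> x; apply: continuous_max; [exact: cst_continuous|exact: cvg_id].
by move=> fa; apply: (cvg_comp _ _ fa); exact: cm.
Qed.

Lemma bump_continuous q k : continuous (bump q k).
Proof.
move=> v; apply: cvg_clip; apply: cvgB; first exact: cvg_cst.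
apply: cvgM; last exact: cvg_cst.
by apply: cvg_norm; apply: cvgB; [exact: cvg_id|exact: cvg_cst].
Qed.

Lemma rest_continuous n k Q : continuous (rest n k Q).
Proof.
move=> v; apply: cvgM.
  by apply: cvg_clip; apply: cvgB; [exact: cvg_cst|exact: cvg_norm cvg_id].
apply: cvg_bigprod => q; apply: cvg_clip.
apply: cvgB; last exact: cvg_cst.
apply: cvgM; last exact: cvg_cst.
by apply: cvg_norm; apply: cvgB; [exact: cvg_id|exact: cvg_cst].
Qed.

Lemma bump_vanish q k : vanish (`|q| + 3) (bump q k).
Proof.
move=> v hv; apply: clip0; rewrite subr_le0.
have h : 3 < `|v - q| by have := lerB_dist v q; lra.
by apply: le_trans (ltW h) _; rewrite ler_peMr// ler1n.
Qed.

Lemma rest_vanish n k Q : vanish n%:R (rest n k Q).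
Proof. by move=> v hv; rewrite /rest clip0 ?mul0r// subr_le0 ltW. Qed.

Lemma bump_ge0 q k v : 0 <= bump q k v.
Proof. exact: clip_ge0. Qed.

Lemma bump_le1 q k v : bump q k v <= 1.
Proof. exact: clip_le1. Qed.

Lemma rest_ge0 n k Q v : 0 <= rest n k Q v.
Proof. by rewrite mulr_ge0 ?clip_ge0// prodr_ge0// => q _; exact: clip_ge0. Qed.

Lemma rest_le1 n k Q v : rest n k Q v <= 1.
Proof.
rewrite mulr_ile1 ?clip_ge0 ?clip_le1//.
  by rewrite prodr_ge0// => q _; exact: clip_ge0.
by rewrite prodr_ile1// => q _; rewrite clip_ge0 clip_le1.
Qed.

(* Roughly, Phi (n, k, Q) m > 0 means that m has exactly one atom within 1/k of
   each point of Q, and no other atom in [-n, n]. *)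
Definition Phi (L : nat * nat * seq rat) (m : conf R) : R :=
  let: (n, k, Q) := L in
  Num.max 0 (1 - conf_int m (rest n k (map ratr Q))) *
  \prod_(q <- Q) Num.max 0 (2^-1 - `|conf_int m (bump (ratr q) k) - 1|).

Lemma Phi_continuous L : continuous (Phi L).
Proof.
case: L => [[n k] Q]; rewrite /Phi => m.
have cr : continuous (fun m => conf_int m (rest n k (map ratr Q))).
  have p : continuous (rest n k (map ratr Q)) /\
    exists W, forall v, W < `|v| -> rest n k (map ratr Q) v = 0.
    split; first exact: rest_continuous.
    by exists n%:R; exact: rest_vanish.
  exact: (@conf_int_continuous (exist _ _ p)).
have cb q : continuous (fun m => conf_int m (bump q k)).
  have p : continuous (bump q k) /\ exists W, forall v, W < `|v| -> bump q k v = 0.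
    split; first exact: bump_continuous.
    by exists (`|q| + 3); exact: bump_vanish.
  exact: (@conf_int_continuous (exist _ _ p)).
apply: cvgM.
  by apply: cvg_pos_part; apply: cvgB; [exact: cvg_cst|exact: cr].
apply: cvg_bigprod => q; apply: cvg_pos_part.
apply: cvgB; first exact: cvg_cst.
by apply: cvg_norm; apply: cvgB; [exact: cb|exact: cvg_cst].
Qed.

Lemma Phi_ge0 L m : 0 <= Phi L m.
Proof.
case: L => [[n k] Q]; rewrite mulr_ge0 ?le_max ?lexx//.
by rewrite prodr_ge0// => q _; rewrite le_max lexx.
Qed.

Lemma Phi_gt0 n k Q m : 0 < Phi (n, k, Q) m ->
  conf_int m (rest n k (map ratr Q)) < 1 /\
  forall q, q \in Q -> `|conf_int m (bump (ratr q) k) - 1| < 2^-1.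
Proof.
rewrite lt_neqAle eq_sym => /andP[+ _].
rewrite mulf_eq0 negb_or => /andP[h1 h2]; split.
  apply: contraNT h1; rewrite -leNgt => h; rewrite max_l//; lra.
move=> q qQ; apply: contraNT h2; rewrite -leNgt => h.
rewrite prodf_seq_eq0; apply/hasP; exists q => //=; rewrite max_l//; lra.
Qed.

Lemma separated (s : seq R) : \forall e \near (0:R)^'+, forall p q,
  p \in s -> q \in s -> p != q -> e < `|p - q|.
Proof.
have : \forall e \near (0:R)^'+, forall p, p \in s -> forall q, q \in s -> p != q -> e < `|p - q|.
  apply: near_seq => p ps; apply: near_seq => q qs.
  have [->|pq] := eqVneq p q; first by apply: nearW => x /eqP.
  have h : 0 < `|p - q| by rewrite normr_gt0 subr_eq0.
  by near=> e => _; near: e; exact: nbhs_right_lt.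
by apply: filterS => e h p q ps qs; exact: h.
Unshelve. all: by end_near. Qed.

(** Each atom of m in [-n, n] is approximated by a rational q within r = 1/(k+1). If [Phi] is
    positive at m', the integral of [rest] is below 1, so every atom of m' in [-(n-1), n-1] is
    within 2r of some q; each bump integral lies in ]1/2, 3/2[, so it needs an atom and allows only
    one, of multiplicity one, on the plateau. Atoms of m and m' near the same q are matched. *)
Lemma Phi_close m W e : simple m -> 0 < e ->
  exists L, 0 < Phi L m /\ forall m', 0 < Phi L m' -> close W e m m'.
Proof.
move=> sm e0.
have [n nW] := filter_ex (nbhs_infty_ger (W + 6)).
(* Atoms slightly beyond n are included, as they may meet the bump of an atom in [-n, n]. *)
pose s := atoms m (n%:R + 4).
have e'0 : 0 < Num.min e 1 by rewrite lt_min e0 ltr01.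
(* The factor 8 exceeds the largest sum of distances met below, 4r + 2r + r with r = 1/(k+1). *)
have [k [k1 k2]] : exists k, 8 * k.+1%:R^-1 < Num.min e 1 /\
    forall p q, p \in s -> q \in s -> p != q -> 8 * k.+1%:R^-1 < `|p - q|.
  near (0:R)^'+ => d.
  have d0 : 0 < d / 8 by rewrite divr_gt0.
  have [k _ /(_ k (leqnn _)) /= hk] := near_infty_natSinv_lt (PosNum d0).
  rewrite ltr_pdivlMr// mulrC in hk.
  have sep : forall p q, p \in s -> q \in s -> p != q -> d < `|p - q|.
    by near: d; exact: separated.
  exists k; split; first by apply: lt_trans hk _; near: d; exact: nbhs_right_lt.
  by move=> p q ps qs pq; apply: lt_trans hk _; exact: sep.
set r : R := k.+1%:R^-1 in k1 k2.
move: k1; rewrite lt_min => /andP[k1 k1'].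
have r0 : 0 < r by rewrite invr_gt0.
have r1 : r <= 1 by rewrite invf_le1// ler1n.
have kr : k.+1%:R * r = 1 by rewrite mulfV.
have kM x a : (a <= x * k.+1%:R) = (a * r <= x).
  by rewrite -(@ler_pM2r _ r)// -mulrA kr mulr1.
have Mk x a : (x * k.+1%:R <= a) = (x <= a * r).
  by rewrite -(@ler_pM2r _ r)// -mulrA kr mulr1.
have Mkl x a : (x * k.+1%:R < a) = (x < a * r).
  by rewrite -(@ltr_pM2r _ r)// -mulrA kr mulr1.
have [qf hqf] : {qf : R -> rat & forall p, `|p - ratr (qf p)| < r}.
  apply: (@choice _ _ (fun p q => `|p - ratr q| < r)) => p.
  have [q] : exists q, ratr q \in `]p - r, p + r[.
    by apply: rat_in_itvoo; lra.
  rewrite in_itv/= => /andP[h1 h2]; exists q; rewrite ltr_norml; apply/andP; split; lra.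
pose S := atoms m n%:R.
have Ss p : p \in S -> p \in s.
  by move=> /mem_atoms[h1 h2]; apply/mem_atoms; split => //; lra.
exists (n, k, map qf S); split.
  apply: mulr_gt0.
    have -> : conf_int m (rest n k (map ratr (map qf S))) = 0.
      rewrite (@conf_int_atoms _ _ n%:R) -/S; last exact: rest_vanish.
      rewrite big_seq big1// => p pS; rewrite /rest.
      suff -> : \prod_(q <- map ratr (map qf S)) clip (`|p - q| * k.+1%:R - 1) = 0.
        by rewrite !mulr0.
      apply/eqP; rewrite prodf_seq_eq0; apply/hasP; exists (ratr (qf p)).
        by rewrite map_f// map_f.
      rewrite /= clip0// subr_le0 Mk mul1r ltW//.
    by rewrite subr0 lt_max ltr01 orbT.
  rewrite big_map big_seq; apply: prodr_gt0 => p pS.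
  suff -> : conf_int m (bump (ratr (qf p)) k) = 1.
    by rewrite subrr normr0 subr0 lt_max invr_gt0 ltr0n orbT.
  move/mem_atoms : (pS) => [pW mp].
  have hp := hqf p.
  rewrite (@conf_int_seq _ _ _ [:: p])//.
    rewrite big_seq1 (simple1 sm mp) mul1r /bump clip1//.
    suff : `|p - ratr (qf p)| * k.+1%:R <= 1 by lra.
    by rewrite Mk mul1r ltW.
  move=> v mv; rewrite /bump inE => bv.
  have vq : `|v - ratr (qf p)| < 3 * r.
    rewrite -Mkl; suff: 0 < 3 - `|v - ratr (qf p)| * k.+1%:R by lra.
    by apply: clip_gt0; rewrite lt_neqAle eq_sym bv clip_ge0.
  apply: contraT => vp.
  have vp2 : `|v - p| < 4 * r.
    have := ler_distD (ratr (qf p)) v p; rewrite (distrC (ratr _) p); lra.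
  suff : 8 * r < `|v - p| by lra.
  apply: k2 => //; last exact: Ss.
  apply/mem_atoms; split => //; have := lerB_dist v p; lra.
move=> m' /Phi_gt0[hrest hbump].
have near_q v : m' v <> 0%N -> `|v| <= n%:R - 1 ->
    exists2 p, p \in S & `|v - ratr (qf p)| < 2 * r.
  move=> mv vn; apply: contrapT => h.
  suff : 1 <= conf_int m' (rest n k (map ratr (map qf S))) by lra.
  have h1 := @conf_int_ge1 _ m' _ _ v (@rest_vanish n k (map ratr (map qf S)))
    (fun x _ => rest_ge0 _ _ _ _) mv.
  apply: le_trans h1.
  have -> : rest n k (map ratr (map qf S)) v = 1.
    rewrite /rest clip1 ?mul1r; last lra.
    rewrite !big_map big_seq big1// => p pS; rewrite clip1//.
    suff : 2 <= `|v - ratr (qf p)| * k.+1%:R by lra.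
    rewrite kM leNgt; apply/negP => h'; apply: h; by exists p.
  by rewrite mulr1 ler1n lt0n; exact/eqP.
have bump1 v p : `|v - ratr (qf p)| < 2 * r -> bump (ratr (qf p)) k v = 1.
  move=> h; rewrite /bump clip1//.
  suff : `|v - ratr (qf p)| * k.+1%:R < 2 by lra.
  by rewrite Mkl.
have uniq_q p v w : p \in S -> m' v <> 0%N -> m' w <> 0%N ->
    `|v - ratr (qf p)| < 2 * r -> `|w - ratr (qf p)| < 2 * r -> v = w.
  move=> pS mv mw hv hw; apply: contrapT => /eqP vw.
  have := hbump (qf p) (map_f _ pS).
  have := @conf_int_ge2 _ m' _ _ v w (@bump_vanish (ratr (qf p)) k) _ mv mw vw.
  rewrite !bump1// => /(_ (fun x _ => bump_ge0 _ _ _)) h1 /ltr_normlP[]; lra.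
have mass1 p v : p \in S -> m' v <> 0%N -> `|v - ratr (qf p)| < 2 * r -> m' v = 1%N.
  move=> pS mv hv.
  have := hbump (qf p) (map_f _ pS).
  have := @conf_int_ge1 _ m' _ _ v (@bump_vanish (ratr (qf p)) k) _ mv.
  rewrite !bump1// mulr1 => /(_ (fun x _ => bump_ge0 _ _ _)) h1 /ltr_normlP[h2 h3].
  have : (m' v)%:R < 2%:R :> R by lra.
  by rewrite ltr_nat; case: (m' v) mv {h1} => [|[|]].
have ex_q p : p \in S -> `|p| <= W -> exists v, m' v <> 0%N /\ `|v - ratr (qf p)| < 2 * r.
  move=> pS pW; have hp := hqf p.
  have [v [mv bv]] : exists v, m' v <> 0%N /\ bump (ratr (qf p)) k v != 0.
    apply: contrapT => h; have := hbump (qf p) (map_f _ pS).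
    rewrite (@conf_int_seq _ _ _ [::])//; last first.
      by move=> v mv bv; exfalso; apply: h; exists v.
    rewrite big_nil => /ltr_normlP[]; lra.
  have vq : `|v - ratr (qf p)| < 3 * r.
    rewrite -Mkl; suff: 0 < 3 - `|v - ratr (qf p)| * k.+1%:R by lra.
    by apply: clip_gt0; rewrite lt_neqAle eq_sym bv clip_ge0.
  have vp : `|v - p| < 4 * r.
    have := ler_distD (ratr (qf p)) v p; rewrite (distrC (ratr _) p); lra.
  (* The bump locates v only within 3r of its centre. The integral of [rest] improves this to 2r
     around some centre, which separation identifies with the first one. *)
  have [||p' p'S vp'] := near_q v => //.
    have := lerB_dist v p; lra.
  suff pp' : p = p' by exists v; split => //; rewrite pp'.
  apply: contrapT => /eqP pp'.
  suff : 8 * r < `|p - p'| by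
    have := ler_distD v p p'; have := ler_distD (ratr (qf p')) v p';
    have := hqf p'; rewrite (distrC p v) (distrC (ratr _) p'); lra.
  by apply: k2 => //; exact: Ss.
have [phi hphi] : {phi : R -> R & forall p, p \in S -> `|p| <= W ->
    m' (phi p) <> 0%N /\ `|phi p - ratr (qf p)| < 2 * r}.
  apply: (@choice _ _ (fun p v => p \in S -> `|p| <= W ->
    m' v <> 0%N /\ `|v - ratr (qf p)| < 2 * r)) => p.
  have [pS|] := boolP (p \in S); last by exists 0.
  have [pW|] := boolP (`|p| <= W); last by exists 0.
  by have [v hv] := ex_q p pS pW; exists v.
have inS p : m p <> 0%N -> `|p| <= W -> p \in S.
  by move=> mp pW; apply/mem_atoms; split => //; lra.
exists phi; split.
- move=> p mp pW; have pS := inS p mp pW.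
  have [h1 h2] := hphi p pS pW; split; last exact: mass1 h2.
  have := ler_distD (ratr (qf p)) (phi p) p; have := hqf p; rewrite (distrC (ratr _) p); lra.
- move=> p p' mp pW mp' p'W pp'; apply: contrapT => /eqP npp'.
  have [_ h2] := hphi p (inS p mp pW) pW.
  have [_ h2'] := hphi p' (inS p' mp' p'W) p'W.
  rewrite pp' distrC in h2; rewrite distrC in h2'.
  have k3 : 8 * r < `|p - p'| by apply: k2 => //; apply: Ss; exact: inS.
  have h3 := ler_distD (phi p') p p'.
  have h4 := ler_distD (ratr (qf p')) (phi p') p'.
  have h5 := ler_distD (ratr (qf p)) p (phi p').
  have h6 := hqf p; have h7 := hqf p'.
  rewrite (distrC (phi p') (ratr _)) (distrC (ratr _) p') in h4; lra.
- move=> v mv vW.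
  have [|p pS vp] := near_q v mv; first lra.
  have pW : `|p| <= W.
    have := ler_distD (ratr (qf p)) p v; have := hqf p; have := lerB_dist p v.
    rewrite (distrC (ratr _) v); lra.
  move/mem_atoms : (pS) => [_ mp]; exists p; split => //.
  have [h1 h2] := hphi p pS pW.
  exact: (uniq_q p).
Unshelve. all: by end_near. Qed.

Lemma near_close m W e : simple m -> 0 < e -> nbhs m (close W e m).
Proof.
move=> sm e0; have [L [L0 hL]] := @Phi_close m W e sm e0.
apply: filterS hL _; have := @Phi_continuous L m.
by move=> /cvgr_gt; apply.
Qed.

Lemma nbhs_Phi m U : simple m -> nbhs m U ->
  exists L, 0 < Phi L m /\ forall m', 0 < Phi L m' -> U m'.
Proof.
move=> sm /(nbhs_close sm)[W hW].
near (0:R)^'+ => d.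
have d0 : 0 < d by [].
have [L [L0 hL]] := @Phi_close m W d sm d0.
exists L; split => // m' /hL; have := near hW d; apply => //.
Unshelve. all: by end_near. Qed.

End countable_family.

(** * Discrete layer-cake bounds *)

Section levels.
Context {R : realType}.

Lemma sum_bool_le n (b : 'I_n -> bool) : \sum_(i < n) (b i)%:R <= n%:R :> R.
Proof.
rewrite -[leRHS]mulr1 mulr_natl -[X in _ *+ X](card_ord n) -sumr_const.
by apply: ler_sum => i _; case: (b i).
Qed.

(** The number of levels (i+1)e not exceeding x is the integer part of x/e, capped at n. Weak
    inequalities in the lower bound and strict ones in the upper bound give the sharper form of
    each. *)
Lemma level_lower n (e x : R) : 0 <= e -> 0 <= x ->
  e * \sum_(i < n) ((i.+1)%:R * e <= x)%R%:R <= x.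
Proof.
move=> e0 x0; elim: n => [|n ih]; first by rewrite big_ord0 mulr0.
rewrite big_ord_recr/=; case: (leP (n.+1%:R * e) x) => h; last by rewrite addr0.
apply: le_trans h; rewrite mulrC ler_wpM2r// -natr1 lerD2r.
exact: sum_bool_le.
Qed.

Lemma level_upper n (e x : R) : 0 <= e -> x <= n.+1%:R * e ->
  x <= e + e * \sum_(i < n) ((i.+1)%:R * e < x)%R%:R.
Proof.
move=> e0; elim: n => [|n ih] h; first by rewrite big_ord0 mulr0 addr0; lra.
rewrite big_ord_recr/=.
case: (ltP (n.+1%:R * e) x) => h1; last by rewrite addr0; apply: ih.
suff -> : \sum_(i < n) ((i.+1)%:R * e < x)%R%:R = n%:R :> R.
  by apply: le_trans h _; rewrite natr1 -[X in X + _]mulr1 -mulrDr mulrC -nat1r.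
rewrite -[RHS]mulr1 mulr_natl -[X in _ *+ X](card_ord n) -sumr_const.
apply: eq_bigr => i _; rewrite (le_lt_trans _ h1)// ler_wpM2r// ler_nat.
by rewrite ltnS ltnW.
Qed.

End levels.

(** * Measurability of integrals against a point process *)

Section measurability.
Context {R : realType} {d : measure_display} {T : measurableType d}.
Variable X : T -> conf R.
Hypothesis hX : point_process X.

(** Rounding f down to multiples of 1/(n+1) replaces the integral by a combination of counts of
    bounded Borel sets. The error is at most 1/(n+1) times the mass of [-W, W], whence a pointwise
    limit of measurable functions. *)
Lemma measurable_conf_int01 W (f : R -> R) : measurable_fun setT f ->
  (forall v, 0 <= f v <= 1) -> vanish W f ->
  measurable_fun setT (fun t => conf_int (X t) f).
Proof.
move=> mf f01 Wf.
pose B n j := [set v : R | `|v| <= W] `&` [set v | (j.+1)%:R * n.+1%:R^-1 <= f v].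
have bB n j : bounded_borel (B n j).
  split.
    apply: measurableI.
      have -> : [set v : R | `|v| <= W] = `[- W, W]%classic.
        by apply/seteqP; split => v /=; rewrite in_itv/= ler_norml.
      exact: measurable_itv.
    by rewrite -[X in measurable X]setTI -preimage_itvcy; exact: mf.
  by exists W => v [/= vW _]; rewrite in_itv/= -ler_norml.
have VB n j : vanish W (\1_(B n j) : R -> R).
  move=> v Wv; rewrite indicE memNset// => -[/= +  _].
  by rewrite leNgt Wv.
pose g n t := n.+1%:R^-1 * \sum_(j < n.+1) Defs.count (X t) (B n j).
apply: (@measurable_fun_cvg _ _ _ _ g).
  move=> n; apply: measurable_funM; first exact: measurable_cst.
  apply: measurable_sum => j; exact: hX.
move=> t _; apply/cvgrPdist_le => e e0.
set c := conf_int (X t) \1_[set v : R | `|v| <= W].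
have V1 : vanish W (\1_[set v : R | `|v| <= W] : R -> R).
  by move=> v Wv; rewrite indicE memNset//= leNgt Wv.
have c0 : 0 <= c by apply: conf_int_ge0 => v _; rewrite indicE.
have gE n : g n t = conf_int (X t) (fun v => n.+1%:R^-1 *
      \sum_(j < n.+1) (\1_(B n j) v : R)).
  rewrite (@conf_intZ _ _ W) ?(@conf_int_sum _ _ W)//.
  by move=> v Wv; rewrite big1// => j _; exact: VB.
have h n : `|conf_int (X t) f - g n t| <= n.+1%:R^-1 * c.
  have Vg : vanish W (fun v => n.+1%:R^-1 * \sum_(j < n.+1) (\1_(B n j) v : R)).
    by move=> v Wv; rewrite big1 ?mulr0// => j _; exact: VB.
  rewrite gE -(@conf_intB _ _ W)// /c -(@conf_intZ _ _ W)//.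
  apply: (@ler_norm_conf_int _ _ W).
  - by move=> v Wv; rewrite Wf// Vg// subr0.
  - by move=> v Wv; rewrite V1// mulr0.
  move=> v _; have [vW|Wv] := leP `|v| W; last first.
    by rewrite Wf// Vg// subr0 normr0 V1// mulr0.
  rewrite (_ : \1_[set v : R | `|v| <= W] v = 1); last by rewrite indicE mem_set.
  rewrite mulr1.
  under eq_bigr => j _.
    rewrite (_ : \1_(B n j) v = ((j.+1)%:R * n.+1%:R^-1 <= f v)%R%:R :> R); last first.
      rewrite indicE; congr (nat_of_bool _)%:R; apply/idP/idP.
        by rewrite inE => -[].
      by move=> h; rewrite inE.
    over.
  have n0 : 0 <= n.+1%:R^-1 :> R by rewrite invr_ge0.
  have /andP[f0 f1] := f01 v.
  have l1 := level_lower n.+1 n0 f0.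
  have fn : f v <= n.+2%:R * n.+1%:R^-1.
    by apply: le_trans f1 _; rewrite ler_pdivlMr ?mul1r ?ler_nat.
  have l2 := level_upper n0 fn.
  have l3 : \sum_(i < n.+1) ((i.+1)%:R * n.+1%:R^-1 < f v)%R%:R <=
    \sum_(i < n.+1) ((i.+1)%:R * n.+1%:R^-1 <= f v)%R%:R :> R.
    by apply: ler_sum => i _; case: ltP => [/ltW -> //|_]; exact: ler0n.
  have l4 := le_trans l2 (lerD (lexx _) (ler_wpM2l n0 l3)).
  rewrite ler_norml; apply/andP; split; last by rewrite lerBlDr.
  by apply: (@le_trans _ _ 0); [rewrite oppr_le0|rewrite subr_ge0].
have ec : 0 < e / (c + 1) by apply: divr_gt0 => //; lra.
near=> n; apply: le_trans (h n) _.
apply: (@le_trans _ _ (n.+1%:R^-1 * (c + 1))).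
  by rewrite ler_wpM2l ?invr_ge0//; lra.
rewrite -ler_pdivlMr; last lra.
near: n.
by apply: filterS (near_infty_natSinv_lt (PosNum ec)) => n /ltW.
Unshelve. all: by end_near. Qed.

Lemma measurable_conf_int W C (f : R -> R) : measurable_fun setT f ->
  (forall v, `|f v| <= C) -> vanish W f ->
  measurable_fun setT (fun t => conf_int (X t) f).
Proof.
move=> mf fC Wf.
have C0 : 0 <= C by apply: le_trans (fC 0).
have D0 : 0 < C + 1 by lra.
pose I : R -> R := \1_`[- W, W].
(* An affine change brings the values into [0, 1]; the indicator keeps the support bounded. *)
pose g v := 2^-1 * (f v / (C + 1) + 1) * I v.
have IW : vanish W I.
  by move=> v; rewrite /I indicE mem_setE in_itv/= -ler_norml => /lt_geF ->.
have mI : measurable_fun setT I by apply: measurable_indic; exact: measurable_itv.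
have gW : vanish W g by move=> v Wv; rewrite /g IW// mulr0.
have -> : (fun t => conf_int (X t) f) =
    fun t => (2 * (C + 1)) * conf_int (X t) g - (C + 1) * conf_int (X t) I.
  apply/funext => t; rewrite -!(@conf_intZ _ _ W)// -(@conf_intB _ _ W); last 2 first.
  - by move=> v Wv; rewrite gW// mulr0.
  - by move=> v Wv; rewrite IW// mulr0.
  apply: eq_conf_int => v _; rewrite /g.
  have [vW|Wv] := leP `|v| W; last by rewrite Wf// IW// !mulr0 subrr.
  have -> : I v = 1 by rewrite /I indicE mem_setE in_itv/= -ler_norml vW.
  field; lra.
apply: measurable_funB; apply: measurable_funM => //; apply: (@measurable_conf_int01 W) => //.
- apply: measurable_funM => //; apply: measurable_funM => //.
  by apply: measurable_funD => //; apply: measurable_funM.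
- move=> v; have /ler_normlP[f1 f2] := fC v.
  have h1 : - 1 <= f v / (C + 1) by rewrite ler_pdivlMr//; lra.
  have h2 : f v / (C + 1) <= 1 by rewrite ler_pdivrMr//; lra.
  rewrite /g /I indicE; case: (v \in _) => /=; rewrite ?mulr1 ?mulr0; lra.
- by move=> v; rewrite /I indicE; case: (v \in _); rewrite ?lexx ler01.
Qed.

Lemma measurable_Phi L : measurable_fun setT (fun t => Phi L (X t)).
Proof.
case: L => [[n k] Q] /=.
apply: measurable_funM.
  apply: measurable_maxr => //; apply: measurable_funB => //.
  apply: (@measurable_conf_int01 n%:R).
  - apply: continuous_measurable_fun; exact: rest_continuous.
  - by move=> v; rewrite rest_ge0 rest_le1.
  - exact: rest_vanish.
elim: Q => [|q Q ih].
  by under eq_fun do rewrite big_nil; exact: measurable_cst.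
under eq_fun do rewrite big_cons.
apply: measurable_funM ih.
apply: measurable_maxr => //; apply: measurable_funB => //.
apply: measurableT_comp => //; apply: measurable_funB => //.
apply: (@measurable_conf_int01 (`|ratr q| + 3)).
- apply: continuous_measurable_fun; exact: bump_continuous.
- by move=> v; rewrite bump_ge0 bump_le1.
- exact: bump_vanish.
Qed.

End measurability.

(** * Portmanteau theorem with inner probabilities *)

Section inner_integral.
Context {R : realType} {d : measure_display} {T : measurableType d}.
Variable P : probability T R.

Definition pr (A : set T) : R := fine (P A).

Lemma prE A : measurable A -> P A = (pr A)%:E.
Proof. by move=> mA; rewrite /pr fineK//; exact: fin_num_measure. Qed.

Lemma pr_le A B : measurable A -> measurable B -> A `<=` B -> pr A <= pr B.
Proof.
by move=> mA mB AB; rewrite -lee_fin -!prE//; apply: le_measure; rewrite ?inE.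
Qed.

Lemma prT : pr setT = 1.
Proof. by rewrite /pr probability_setT. Qed.

Lemma pr_le1 A : measurable A -> pr A <= 1.
Proof. by move=> mA; rewrite -prT; apply: pr_le. Qed.

Lemma prC A : measurable A -> pr (~` A) = 1 - pr A.
Proof.
move=> mA; apply: EFin_inj; rewrite -prE; last exact: measurableC.
by rewrite probability_setC// prE.
Qed.

Lemma prU A B : measurable A -> measurable B -> pr (A `|` B) <= pr A + pr B.
Proof.
move=> mA mB; rewrite -lee_fin EFinD -!prE//; last exact: measurableU.
exact: measureU2.
Qed.

Lemma pr_full A B : measurable A -> measurable B -> pr A = 1 -> pr (A `&` B) = pr B.
Proof.
move=> mA mB A1; apply/eqP; rewrite eq_le pr_le//=; last exact: measurableI.
have h : B `<=` (A `&` B) `|` ~` A.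
  by move=> x Bx; have [Ax|nAx] := pselect (A x); [left|right].
apply: le_trans (pr_le mB _ h) _.
  by apply: measurableU; [exact: measurableI|exact: measurableC].
apply: le_trans (prU _ _) _; [exact: measurableI|exact: measurableC|].
by rewrite prC// A1 subrr addr0.
Qed.

Lemma pr_bigcup (F : (set T)^nat) : (forall n, measurable (F n)) ->
  nondecreasing_seq F -> forall e, 0 < e ->
  \forall n \near \oo, pr (\bigcup_n F n) <= pr (F n) + e.
Proof.
move=> mF nF e e0; have mU : measurable (\bigcup_n F n) by exact: bigcupT_measurable.
have : P (F n) @[n --> \oo] --> P (\bigcup_n F n) by exact: nondecreasing_cvg_mu.
rewrite prE// => /fine_cvg/cvgrPdist_le/(_ e e0).
apply: filterS => n /=; rewrite -/(pr _) => /ler_normlP[_]; lra.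
Qed.

(** The integral of a nonnegative function is a supremum over the simple functions below it, so it
    is monotone even on nonmeasurable functions. *)
Lemma ge0_le_int (f g : T -> \bar R) : (forall x, (0 <= f x)%E) ->
  (forall x, (f x <= g x)%E) -> (\int[P]_x f x <= \int[P]_x g x)%E.
Proof.
move=> f0 fg; rewrite !ge0_integralTE//; last first.
  by move=> x; apply: le_trans (fg x).
apply: ereal_sup_le => _ [h /= hf <-]; exists h => //= x.
exact: le_trans (fg x).
Qed.

Definition mean (f : T -> R) : R := fine (\int[P]_x (f x)%:E)%E.

Lemma int_cst (c : R) : (\int[P]_x c%:E)%E = c%:E.
Proof. by rewrite integral_cst//= probability_setT mule1. Qed.

Lemma meanE C f : (forall x, 0 <= f x <= C) -> (\int[P]_x (f x)%:E)%E = (mean f)%:E.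
Proof.
move=> f0C; rewrite /mean fineK// ge0_fin_numE.
  apply: (@le_lt_trans _ _ C%:E); last exact: ltry.
  rewrite -(int_cst C); apply: ge0_le_int => x; rewrite lee_fin;
  by case/andP: (f0C x).
by apply: integral_ge0 => x _; rewrite lee_fin; case/andP: (f0C x).
Qed.

Lemma le_mean C f g : (forall x, 0 <= f x) -> (forall x, f x <= g x) ->
  (forall x, g x <= C) -> mean f <= mean g.
Proof.
move=> f0 fg gC.
have hf x : 0 <= f x <= C by rewrite f0 (le_trans (fg x)).
have hg x : 0 <= g x <= C by rewrite gC (le_trans (f0 x)).
rewrite -lee_fin -(meanE hf) -(meanE hg).
by apply: ge0_le_int => x; rewrite lee_fin.
Qed.

(** These are the step functions to which a possibly nonmeasurable function is compared; the last
    term absorbs an exceptional set. *)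
Lemma mean_step n (c e a : R) (A : 'I_n -> set T) (B : set T) :
  0 <= c -> 0 <= e -> 0 <= a ->
  (forall i, measurable (A i)) -> measurable B ->
  mean (fun x => c + e * \sum_(i < n) \1_(A i) x + a * \1_B x) =
  c + e * \sum_(i < n) pr (A i) + a * pr B.
Proof.
move=> c0 e0 a0 mA mB; apply: EFin_inj.
have m1 : forall i, measurable_fun setT (fun x => (\1_(A i) x)%:E : \bar R).
  by move=> i; apply/measurable_EFinP; exact: measurable_indic.
have mS : measurable_fun setT (fun x => \sum_(i < n) (\1_(A i) x)%:E : \bar R)%E.
  exact: emeasurable_sum.
have S0 x : (0 <= \sum_(i < n) (\1_(A i) x)%:E :> \bar R)%E.
  by apply: sume_ge0 => i _; rewrite lee_fin indicE.
have mB1 : measurable_fun setT (fun x => (\1_B x)%:E : \bar R).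
  by apply/measurable_EFinP; exact: measurable_indic.
rewrite -(@meanE (c + e * n%:R + a)); last first.
  move=> x; have h0 : 0 <= \sum_(i < n) (\1_(A i) x : R).
    by apply: sumr_ge0 => i _; rewrite indicE.
  have h1 : \sum_(i < n) (\1_(A i) x : R) <= n%:R by exact: sum_bool_le.
  have h2 : \1_B x <= 1 :> R by rewrite indicE; case: (_ \in _).
  have h3 : 0 <= \1_B x :> R by rewrite indicE.
  apply/andP; split; first by rewrite !addr_ge0// mulr_ge0.
  by apply: lerD; [apply: lerD => //; exact: ler_wpM2l|rewrite ler_piMr].
transitivity (\int[P]_x (c%:E + e%:E * (\sum_(i < n) (\1_(A i) x)%:E) + a%:E * (\1_B x)%:E))%E.
  by apply: eq_integral => x _; rewrite sumEFin -!EFinM -!EFinD.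
rewrite ge0_integralD//; last 4 first.
- by move=> x _; rewrite adde_ge0// mule_ge0.
- by apply: emeasurable_funD => //; apply: emeasurable_funM.
- by move=> x _; rewrite mule_ge0// lee_fin indicE.
- by apply: emeasurable_funM.
rewrite ge0_integralD//; last 2 first.
- by move=> x _; rewrite mule_ge0.
- by apply: emeasurable_funM.
rewrite int_cst ge0_integralZl_EFin//.
rewrite ge0_integralZl_EFin//.
rewrite ge0_integral_sum//.
have int1 D : measurable D -> (\int[P]_x (\1_D x)%:E)%E = (pr D)%:E.
  by move=> mD; rewrite integral_indic// setIT; exact: prE.
rewrite int1// !EFinD !EFinM -sumEFin.
by congr (_ + _ * _ + _)%E; apply: eq_bigr => i _; exact: int1.
Qed.

(** The step function dominating f is measurable even when f is not. Off [Om] the crude bound C is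
    used, at no cost because this set has probability zero. *)
Lemma mean_levels_upper n (a C : R) (Om : set T) (A : 'I_n -> set T) (f : T -> R) :
  0 <= a -> measurable Om -> pr Om = 1 -> (forall i, measurable (A i)) ->
  (forall x, 0 <= f x <= C) -> C <= n.+1%:R * a ->
  (forall (i : 'I_n) x, Om x -> i.+1%:R * a < f x -> A i x) ->
  mean f <= a + a * \sum_(i < n) pr (A i).
Proof.
move=> a0 mOm Om1 mA fC Ca hA.
have C0 : 0 <= C by case/andP: (fC point) => /le_trans; apply.
have -> : a + a * \sum_(i < n) pr (A i) = a + a * \sum_(i < n) pr (A i) + C * pr (~` Om).
  by rewrite prC// Om1 subrr mulr0 addr0.
rewrite -mean_step//; last exact: measurableC.
apply: (@le_mean (a + a * n%:R + C)) => x; first by case/andP: (fC x).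
  have /andP[p0 pC] := fC x; have [Ox|nOx] := pselect (Om x).
    rewrite [\1_(~` Om) x]indicE memNset//= mulr0 addr0.
    apply: le_trans (level_upper a0 (le_trans pC Ca)) _.
    rewrite lerD2l ler_wpM2l//; apply: ler_sum => i _; rewrite indicE.
    by case: ltP => // h; rewrite mem_set//; exact: hA h.
  rewrite [\1_(~` Om) x]indicE mem_set//= mulr1 (le_trans pC)// lerDr.
  by rewrite addr_ge0// mulr_ge0// sumr_ge0// => i _; rewrite indicE.
apply: lerD; last by rewrite ler_piMr// indicE; case: (_ \in _).
by rewrite lerD2l ler_wpM2l// (eq_bigr (fun i => (x \in A i)%:R)) ?sum_bool_le//.
Qed.

Lemma mean_levels_lower n (a C : R) (A : 'I_n -> set T) (f : T -> R) :
  0 <= a -> (forall i, measurable (A i)) -> (forall x, 0 <= f x <= C) ->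
  (forall (i : 'I_n) x, A i x -> i.+1%:R * a <= f x) ->
  a * \sum_(i < n) pr (A i) <= mean f.
Proof.
move=> a0 mA fC hA.
have -> : a * \sum_(i < n) pr (A i) = 0 + a * \sum_(i < n) pr (A i) + 0 * pr set0.
  by rewrite add0r mul0r addr0.
rewrite -mean_step//.
apply: (@le_mean C) => x; last by case/andP: (fC x).
  by rewrite add0r mul0r addr0 mulr_ge0// sumr_ge0// => i _; rewrite indicE.
have /andP[p0 pC] := fC x; rewrite add0r mul0r addr0; apply: le_trans (level_lower n a0 p0).
rewrite ler_wpM2l//; apply: ler_sum => i _; rewrite indicE.
by case: (boolP (x \in A i)) => //= /set_mem /hA ->.
Qed.

End inner_integral.

Lemma cvg_bigsum (R : realType) (I : Type) T (F : set_system T) (FF : Filter F)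
    (s : seq I) (f : I -> T -> R) (a : I -> R) :
  (forall i, f i x @[x --> F] --> a i) ->
  \sum_(i <- s) f i x @[x --> F] --> \sum_(i <- s) a i.
Proof.
move=> fa; elim: s => [|i s ih].
  by under eq_fun do rewrite big_nil; rewrite big_nil; exact: cvg_cst.
by under eq_fun do rewrite big_cons; rewrite big_cons; exact: cvgD.
Qed.

Section portmanteau.
Context {R : realType} {d : measure_display} {T : nat -> measurableType d}.
Variable P : forall M, probability (T M) R.
Context {d' : measure_display} {T' : measurableType d'}.
Variable P' : probability T' R.

(* In terms of inner probabilities, liminf P (X M in U) >= P' (Om and Y in U). *)
Definition liminf_inner (E : Type) (X : forall M, T M -> E) (Y : T' -> E)
    (Om : set T') (U : set E) := forall e : R, 0 < e ->
  \forall M \near \oo, exists G : set (T M),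
    [/\ measurable G, G `<=` X M @^-1` U
      & pr P' (Om `&` Y @^-1` U) <= pr (P M) G + e].

Section levels.
Variables (E : topologicalType) (X : forall M, T M -> E) (Y : T' -> E).
Variables (Om : set T') (C : R) (Psi : E -> R).
Hypotheses (mOm : measurable Om) (Om1 : pr P' Om = 1).
Hypothesis PsiC : forall x, 0 <= Psi x <= C.

(** An error 1/(n+1) for each of the n levels makes a total of at most 1, which becomes at most the
    mesh once multiplied by it. *)
Lemma liminf_inner_ord n (U : nat -> set E) :
  (forall i, liminf_inner X Y Om (U i)) -> \forall M \near \oo,
  exists G : 'I_n -> set (T M), [/\ forall i, measurable (G i),
    forall i x, G i x -> U i (X x)
    & \sum_(i < n) pr P' (Om `&` Y @^-1` U i) <= \sum_(i < n) pr (P M) (G i) + 1].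
Proof.
move=> hU; have eta0 : 0 < n.+1%:R^-1 :> R by rewrite invr_gt0.
have : \forall M \near \oo, forall i : 'I_n, exists G : set (T M),
    [/\ measurable G, G `<=` @X M @^-1` U i
      & pr P' (Om `&` Y @^-1` U i) <= pr (P M) G + n.+1%:R^-1].
  by apply: filter_forall => i; exact: hU.
apply: filterS => M /choice[G hG]; exists G; split => [i|i x Gx|].
- by case: (hG i).
- by have [_ + _] := hG i; apply.
apply: (@le_trans _ _ (\sum_(i < n) (pr (P M) (G i) + n.+1%:R^-1))).
  by apply: ler_sum => i _; case: (hG i).
rewrite big_split/= lerD2l sumr_const card_ord -[_ *+ n]mulr_natl.
by rewrite ler_pdivrMr// mul1r ler_nat.
Qed.

Lemma liminf_innerS :
  (forall c, measurable (Om `&` Y @^-1` [set x | c < Psi x])) ->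
  (forall c, liminf_inner X Y Om [set x | c < Psi x]) ->
  forall e, 0 < e -> \forall M \near \oo,
    mean P' (Psi \o Y) <= mean (P M) (Psi \o @X M) + e.
Proof.
move=> mPsi hU e e0.
(* One half of e is the mesh of the levels, the other the accumulated error of
   [liminf_inner_ord]. *)
pose a := e / 2; have a0 : 0 < a by rewrite /a; lra.
have [n Cn] := filter_ex (nbhs_infty_ger (C / a)).
have nC : C <= n.+1%:R * a by rewrite -ler_pdivrMr// (le_trans Cn)// ler_nat.
apply: filterS (liminf_inner_ord n (fun i => hU (i.+1%:R * a))) => M [G [mG GU hs]].
have hY := mean_levels_upper (f := Psi \o Y) (ltW a0) mOm Om1
  (fun i : 'I_n => mPsi (i.+1%:R * a)) (fun x => PsiC (Y x)) nC.
have hX : a * \sum_(i < n) pr (P M) (G i) <= mean (P M) (Psi \o @X M).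
  apply: (mean_levels_lower (f := Psi \o @X M) _ (ltW a0) mG (fun x => PsiC (X x))).
  by move=> i x /GU/ltW.
have := ler_wpM2l (ltW a0) hs; rewrite mulrDr mulr1.
have : e = a + a by rewrite /a; lra.
by move: hX (hY (fun i x Ox h => conj Ox h)); lra.
Qed.

(** Inner approximations only bound probabilities from below. Here they approximate the open sets
    where Psi < c, and their complements contain the sets where Psi >= c. *)
Lemma limsup_innerS :
  (forall c, measurable (Om `&` Y @^-1` [set x | Psi x < c])) ->
  (forall c, liminf_inner X Y Om [set x | Psi x < c]) ->
  forall e, 0 < e -> \forall M \near \oo,
    mean (P M) (Psi \o @X M) <= mean P' (Psi \o Y) + e.
Proof.
move=> mPsi hU e e0.
pose a := e / 2; have a0 : 0 < a by rewrite /a; lra.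
have [n Cn] := filter_ex (nbhs_infty_ger (C / a)).
have nC : C <= n.+1%:R * a by rewrite -ler_pdivrMr// (le_trans Cn)// ler_nat.
apply: filterS (liminf_inner_ord n (fun i => hU (i.+1%:R * a))) => M [G [mG GU hs]].
pose A (i : 'I_n) := Om `&` Y @^-1` [set x | Psi x < (i.+1)%:R * a].
have mA i : measurable (A i) by exact: mPsi.
have hX : mean (P M) (Psi \o @X M) <= a + a * \sum_(i < n) pr (P M) (~` G i).
  apply: (mean_levels_upper (f := Psi \o @X M) (ltW a0) measurableT (prT _) _
    (fun x => PsiC (X x)) nC) => [i|i x _ h /GU /=]; first exact: measurableC.
  by rewrite ltNge (ltW h).
have hY : a * \sum_(i < n) pr P' (Om `&` ~` A i) <= mean P' (Psi \o Y).
  apply: (mean_levels_lower (f := Psi \o Y) _ (ltW a0) _ (fun x => PsiC (Y x))) => [i|i x [Ox nA]].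
    by apply: measurableI => //; exact: measurableC.
  by rewrite leNgt; apply/negP => h; case: nA.
have {}hs : \sum_(i < n) pr (P M) (~` G i) <= \sum_(i < n) pr P' (Om `&` ~` A i) + 1.
  rewrite (eq_bigr (fun i => 1 - pr (P M) (G i))) => [|i _]; last exact: prC.
  rewrite [X in _ <= X + 1](eq_bigr (fun i => 1 - pr P' (A i))) => [|i _].
    by rewrite !sumrB; move: hs; rewrite -/A; lra.
  by rewrite pr_full ?prC//; exact: measurableC.
have := ler_wpM2l (ltW a0) hs; rewrite mulrDr mulr1.
have : e = a + a by rewrite /a; lra.
lra.
Qed.

End levels.

(** The integral of a signed function is by definition a difference, so the positive and negative
    parts of the test function are treated separately, as bounded nonnegative functions. *)
Lemma portmanteau_cvg (E : topologicalType) (X : forall M, T M -> E) (Y : T' -> E)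
    (Om : set T') :
  measurable Om -> pr P' Om = 1 ->
  (forall U, open U -> measurable (Om `&` Y @^-1` U)) ->
  (forall U, open U -> liminf_inner X Y Om U) ->
  cvg_in_distribution P X P' Y.
Proof.
move=> mOm Om1 mY hU.
have key (Psi : E -> R) C : continuous Psi -> (forall x, 0 <= Psi x <= C) ->
  (\int[P M]_t (Psi (X M t))%:E @[M --> \oo] --> \int[P']_t (Psi (Y t))%:E)%E.
  move=> cPsi PsiC.
  have o1 c : open [set x | c < Psi x].
    have -> : [set x | c < Psi x] = Psi @^-1` [set y | c < y] by [].
    by apply: open_comp; [move=> x _; exact: cPsi|exact: open_gt].
  have o2 c : open [set x | Psi x < c].
    have -> : [set x | Psi x < c] = Psi @^-1` [set y | y < c] by [].
    by apply: open_comp; [move=> x _; exact: cPsi|exact: open_lt].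
  have PY M := @meanE _ _ _ (P M) C (Psi \o X M) (fun t => PsiC _).
  under eq_fun do rewrite PY.
  rewrite (@meanE _ _ _ P' C (Psi \o Y) (fun t => PsiC _)).
  apply: cvg_EFin; first by apply: nearW.
  apply/cvgrPdist_le => e e0.
  have h1 := @liminf_innerS E X Y Om C Psi mOm Om1 PsiC
    (fun c => mY _ (o1 c)) (fun c => hU _ (o1 c)) e e0.
  have h2 := @limsup_innerS E X Y Om C Psi mOm Om1 PsiC
    (fun c => mY _ (o2 c)) (fun c => hU _ (o2 c)) e e0.
  near=> M; rewrite /=.
  have : mean P' (Psi \o Y) <= mean (P M) (Psi \o X M) + e by near: M.
  have : mean (P M) (Psi \o X M) <= mean P' (Psi \o Y) + e by near: M.
  move=> ? ?; rewrite ler_norml; apply/andP; split; lra.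
move=> Psi cPsi [C hC].
pose D := Num.max C 1.
have D0 : 0 < D by rewrite lt_max ltr01 orbT.
have hD x : `|Psi x| <= D by rewrite le_max hC.
have h1 := key (fun x => Num.max (Psi x) 0) D _ _.
have h2 := key (fun x => Num.max (- Psi x) 0) D _ _.
have I dd (S : measurableType dd) (Q : probability S R) (Z : S -> E) :
  (\int[Q]_t (Psi (Z t))%:E = \int[Q]_t (Num.max (Psi (Z t)) 0)%:E
     - \int[Q]_t (Num.max (- Psi (Z t)) 0)%:E)%E.
  rewrite integralE; congr (_ - _)%E; apply: eq_integral => t _.
    by rewrite funeposE EFin_max.
  by rewrite funenegE EFin_max.
rewrite I; under eq_fun do rewrite I.
have cm (f : E -> R) : continuous f -> continuous (fun x => Num.max (f x) 0).
  by move=> cf x; apply: continuous_max; [exact: cf|exact: cst_continuous].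
apply: cvgeB.
- rewrite (@meanE _ _ _ P' D); last first.
    move=> t; rewrite le_max lexx orbT ge_max (ltW D0) andbT.
    exact: le_trans (ler_norm _) _.
  exact: fin_num_adde_defr.
- apply: h1; first exact: cm.
  move=> t; rewrite le_max lexx orbT ge_max (ltW D0) andbT/=.
  exact: le_trans (ler_norm _) _.
- apply: h2; first by apply: cm => x; apply: cvgN; exact: cPsi.
  move=> t; rewrite le_max lexx orbT ge_max (ltW D0) andbT/=.
  by apply: le_trans (ler_norm _) _; rewrite normrN.
Unshelve. all: by end_near. Qed.

(** [Psi N] sums the first [Phi L] whose positivity set lies in U. The continuous function
    [clip (N%:R * Psi N m)] is 1 on the event [A N] and 0 where [Psi N] vanishes, so the convergence
    of its mean compares the two probabilities, while [A N] increases to the event of interest. *)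
Lemma portmanteau_open (X : forall M, T M -> conf R) (Y : T' -> conf R)
    (Om : set T') (U : set (conf R)) :
  (forall M, point_process (X M)) -> point_process Y ->
  cvg_in_distribution P X P' Y ->
  measurable Om -> (forall t, Om t -> simple (Y t)) -> open U ->
  measurable (Om `&` Y @^-1` U) /\ liminf_inner X Y Om U.
Proof.
move=> hX hY hXY mOm sOm oU.
pose good L := `[< forall m', 0 < Phi L m' -> U m' >].
pose psi n (m : conf R) : R := if unpickle n is Some L then
  (if good L then Phi L m else 0) else 0.
have psi0 n m : 0 <= psi n m.
  by rewrite /psi; case: (unpickle n) => // L; case: (good L) => //; exact: Phi_ge0.
have psiU n m : 0 < psi n m -> U m.
  rewrite /psi; case: (unpickle n) => [L|]; last by rewrite ltxx.
  by case: (boolP (good L)) => [/asboolP hL /hL//|_]; rewrite ltxx.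
have cpsi n : continuous (psi n).
  rewrite /psi; case: (unpickle n) => [L|]; last exact: cst_continuous.
  by case: (good L); [exact: Phi_continuous|exact: cst_continuous].
have mpsi dd (S : measurableType dd) (Z : S -> conf R) n : point_process Z ->
    measurable_fun setT (fun t => psi n (Z t)).
  move=> hZ; rewrite /psi; case: (unpickle n) => [L|]; last exact: measurable_cst.
  by case: (good L); [exact: measurable_Phi|exact: measurable_cst].
pose Psi N m := \sum_(n < N) psi n m.
have Psi0 N m : 0 <= Psi N m by apply: sumr_ge0.
have PsiU N m : 0 < Psi N m -> U m.
  move=> h; apply: contrapT => nU.
  suff : Psi N m = 0 by move=> h'; rewrite h' ltxx in h.
  rewrite /Psi big1// => i _; apply/eqP; rewrite eq_le psi0 andbT leNgt.
  by apply/negP => /psiU.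
have mPsi dd (S : measurableType dd) (Z : S -> conf R) N : point_process Z ->
    measurable_fun setT (fun t => Psi N (Z t)).
  by move=> hZ; apply: measurable_sum => i; exact: mpsi.
have Psi_le N N' m : (N <= N')%N -> Psi N m <= Psi N' m.
  move=> NN'; rewrite /Psi (big_ord_widen _ (fun n => psi n m) NN').
  rewrite big_mkcond/=; apply: ler_sum => i _; case: ifP => // _; exact: psi0.
pose A N := Om `&` [set t | 1 <= N%:R * Psi N (Y t)].
have mA N : measurable (A N).
  apply: measurableI => //.
  rewrite -[X in measurable X]setTI -preimage_itvcy.
  by apply: (measurable_funM (measurable_cst _) (mPsi _ _ _ _ hY)).
have AU : Om `&` Y @^-1` U = \bigcup_N A N.
  apply/seteqP; split => t.
    move=> [Ot Ut]; have [L [L0 hL]] := nbhs_Phi (sOm _ Ot) (open_nbhs_nbhs (conj oU Ut)).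
    have p0 : psi (pickle L) (Y t) = Phi L (Y t).
      by rewrite /psi pickleK; case: (boolP (good L)) => // /asboolPn.
    have [i Li] := filter_ex (nbhs_infty_ger (Phi L (Y t))^-1).
    pose N := maxn (pickle L).+1 i.
    exists N => //; split => //=.
    apply: (@le_trans _ _ (N%:R * Phi L (Y t))).
      by rewrite -ler_pdivrMr// mul1r (le_trans Li)// ler_nat leq_maxr.
    rewrite ler_wpM2l// -p0 /Psi.
    have hN : (pickle L < N)%N by rewrite leq_maxl.
    rewrite (bigD1 (Ordinal hN))//= lerDl; exact: sumr_ge0.
  move=> [N _ [Ot /= h]]; split => //=; apply: (PsiU N).
  rewrite lt_neqAle Psi0 andbT eq_sym; apply/negP => /eqP h'.
  by move: h; rewrite h' mulr0 ler10.
have mU : measurable (\bigcup_N A N) by exact: bigcupT_measurable.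
split; first by rewrite AU.
move=> e e0; rewrite AU.
have ndA : nondecreasing_seq A.
  move=> N N' NN'; apply/subsetPset => t [Ot /= h]; split => //=.
  apply: le_trans h _; apply: ler_pM => //; first by rewrite ler_nat.
  exact: Psi_le.
have e2 : 0 < e / 2 by lra.
have [N _ /(_ N)/= hN] := pr_bigcup P' mA ndA e2.
have {}hN := hN (leqnn N).
pose F m := clip (N%:R * Psi N m).
have F01 m : 0 <= F m <= 1.
  by rewrite clip_ge0 clip_le1.
have cF : continuous F.
  move=> m.
  apply: cvg_clip; apply: cvgM; first exact: cvg_cst.
  by apply: cvg_bigsum => i; exact: cpsi.
have hC : exists C, forall m, `|F m| <= C.
  by exists 1 => m; have /andP[? ?] := F01 m; rewrite ger0_norm.
have := hXY F cF hC.
rewrite (@meanE _ _ _ P' 1 (F \o Y) (fun t => F01 _)).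
have PX M := @meanE _ _ _ (P M) 1 (F \o X M) (fun t => F01 _).
under eq_fun do rewrite PX.
move=> /fine_cvg/cvgrPdist_le/(_ _ e2); apply: filterS => M /= hM.
pose G := [set t | 0 < Psi N (X M t)].
have mG : measurable G.
  by rewrite /G -[X in measurable X]setTI -preimage_itvoy; exact: mPsi.
exists G; split => //; first by move=> t; exact: PsiU.
have h1 : pr P' (A N) <= mean P' (F \o Y).
  have := @mean_levels_lower _ _ _ P' 1 1 1 (fun=> A N) (F \o Y) ler01 (fun=> mA N)
    (fun t => F01 (Y t)).
  rewrite big_ord1 mul1r; apply => i t [_ /= h].
  by rewrite ord1 mulr1 /F clip1.
have h2 : mean (P M) (F \o X M) <= pr (P M) G.
  have -> : pr (P M) G = 0 + 0 * \sum_(i < 0) pr (P M) set0 + 1 * pr (P M) G.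
    by rewrite mul0r !add0r mul1r.
  rewrite -mean_step//; apply: (@le_mean _ _ _ _ 1) => t.
  - by rewrite /=; case/andP: (F01 (X M t)).
  - rewrite mul0r !add0r mul1r indicE /=.
    case: (boolP (t \in G)) => [_|]; first by case/andP: (F01 (X M t)).
    rewrite notin_setE /G/= => /negP; rewrite -leNgt => h.
    by rewrite /F clip0// mulr_ge0_le0.
  - by rewrite mul0r !add0r mul1r indicE; case: (_ \in _).
move/ler_normlP : hM => [_]; lra.
Qed.

End portmanteau.

(** * Continuous mapping along nested limits *)

Section continuous_mapping.
Context {R : realType} {d : measure_display} {T : nat -> measurableType d}.
Variable P : forall M, probability (T M) R.
Context {d' : measure_display} {T' : measurableType d'}.
Variable P' : probability T' R.
Variables (omegaM : forall M, T M -> conf R) (omega : T' -> conf R) (Om : set T').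
Hypothesis hM : forall M, point_process (@omegaM M).
Hypothesis hY : point_process omega.
Hypothesis hi : cvg_in_distribution P (@omegaM) P' omega.
Hypothesis mOm : measurable Om.
Hypothesis Om1 : pr P' Om = 1.
Hypothesis sOm : forall t, Om t -> simple (omega t).

(** [A U k N] gathers the configurations for which X M falls in U once an event G of probability
    close to 1 is granted. The thresholds in k and in N depend on the sample point; continuity from
    below makes them uniform, first in k and then in N, before M is taken large. The four errors e/4
    come from these two choices, from the lower bound for omega_M, and from G. *)
Lemma continuous_mapping (E : topologicalType) (X : forall M, T M -> E) (Y : T' -> E)
    (A : set E -> nat -> nat -> set (conf R)) :
  (forall U, open U -> measurable (Om `&` Y @^-1` U)) ->
  (forall U, open U -> forall t, Om t -> U (Y t) ->
    \forall k \near \oo, \forall N \near \oo, nbhs (omega t) (A U k N)) ->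
  (forall U, open U -> forall k e, 0 < e -> \forall N \near \oo, \forall M \near \oo,
    exists G : set (T M), [/\ measurable G, 1 - e <= pr (P M) G
      & forall t, G t -> A U k N (@omegaM M t) -> U (X M t)]) ->
  cvg_in_distribution P X P' Y.
Proof.
move=> mY hA hX; apply: (portmanteau_cvg mOm Om1 mY) => U oU e e0.
have e4 : 0 < e / 4 by lra.
pose V k N := interior (A U k N).
have oV k N : open (V k N) by exact: open_interior.
have hV k N := portmanteau_open hM hY hi mOm sOm (oV k N).
pose B k N := Om `&` omega @^-1` (V k N).
have mB k N : measurable (B k N) by case: (hV k N).
pose C k n := \bigcap_(N in [set N | (n <= N)%N]) B k N.
have mC k n : measurable (C k n) by exact: bigcap_measurableType.
pose L k := \bigcup_n C k n.
have mL k : measurable (L k) by exact: bigcupT_measurable.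
pose D j := \bigcap_(k in [set k | (j <= k)%N]) L k.
have mD j : measurable (D j) by exact: bigcap_measurableType.
have ndC k : nondecreasing_seq (C k).
  move=> n n' nn'; apply/subsetPset => t h N /= nN; apply: h => /=.
  exact: leq_trans nN.
have ndD : nondecreasing_seq D.
  move=> n n' nn'; apply/subsetPset => t h N /= nN; apply: h => /=.
  exact: leq_trans nN.
have UD : Om `&` Y @^-1` U `<=` \bigcup_j D j.
  move=> t [Ot Ut]; have [j _ hj] := hA U oU t Ot Ut.
  exists j => // k /= jk; have [n _ hn] := hj k jk.
  by exists n => // N /= nN; split => //; exact: hn.
have [j _ /(_ j)/= hj] := pr_bigcup P' mD ndD e4.
have {}hj := hj (leqnn j).
have [n _ hn] := pr_bigcup P' (mC j) (ndC j) e4.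
have [n' _ hn'] := hX U oU j _ e4.
pose N := maxn n n'.
have {}hn : pr P' (L j) <= pr P' (C j N) + e / 4 by exact: (hn N (leq_maxl _ _)).
have {}hn' := hn' N (leq_maxr _ _).
have hCB : pr P' (C j N) <= pr P' (B j N).
  by apply: pr_le => //; move=> t; apply => /=.
have hDL : pr P' (D j) <= pr P' (L j).
  by apply: pr_le => //; move=> t; apply => /=.
have hUD : pr P' (Om `&` Y @^-1` U) <= pr P' (\bigcup_j D j).
  apply: pr_le => //; [exact: mY|exact: bigcupT_measurable].
have [_ /(_ _ e4) hB] := hV j N.
near=> M.
have [G1 [mG1 G1V hG1]] : exists G : set (T M), [/\ measurable G,
    G `<=` @omegaM M @^-1` V j N & pr P' (B j N) <= pr (P M) G + e / 4] by near: M.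
have [G2 [mG2 hG2 G2X]] : exists G : set (T M), [/\ measurable G, 1 - e / 4 <= pr (P M) G
      & forall t, G t -> A U j N (@omegaM M t) -> U (X M t)] by near: M.
exists (G1 `&` G2); split; first exact: measurableI.
  move=> t [g1 g2]; apply: G2X => //; exact: (interior_subset (G1V _ g1)).
have h : pr (P M) G1 <= pr (P M) (G1 `&` G2) + pr (P M) (~` G2).
  apply: le_trans (prU _ _ _); last 2 first.
  - exact: measurableI.
  - exact: measurableC.
  apply: pr_le => //.
    by apply: measurableU; [exact: measurableI|exact: measurableC].
  by move=> t g1; have [g2|ng2] := pselect (G2 t); [left|right].
rewrite prC// in h; lra.
Unshelve. all: by end_near. Qed.

End continuous_mapping.

(** * Zeros of perturbed resolvent sums *)

Section resolvent_sums.
Context {R : realType}.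
Implicit Types (m : conf R) (h f : R -> R).

Definition psum m (N : nat) (u : R) : R := partial_sum m (fun v => (v - u)^-1) N.

Lemma partial_sum_atoms m g n :
  partial_sum m g n = \sum_(v <- atoms m n%:R) (m v)%:R * g v.
Proof.
rewrite /partial_sum (@conf_int_atoms _ _ n%:R).
  by rewrite big_seq [RHS]big_seq; apply: eq_bigr => v /mem_atoms[-> _].
by move=> v; rewrite ltNge => /negbTE ->.
Qed.

Lemma resolventB (v x y : R) : v != x -> v != y ->
  (v - y)^-1 - (v - x)^-1 = (y - x) / ((v - x) * (v - y)).
Proof.
rewrite -subr_eq0 -[v == y]subr_eq0 => vx vy.
by field; rewrite vx vy.
Qed.

Lemma resolvent_lt (v x y : R) : x < y -> ~~ (x <= v <= y) ->
  (v - x)^-1 < (v - y)^-1.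
Proof.
move=> xy vxy; have [vx|xv] := ltP v x.
  rewrite -subr_gt0 resolventB ?lt_eqF//; last exact: lt_trans xy.
  by apply: divr_gt0; [lra|rewrite nmulr_rgt0; lra].
have yv : y < v by rewrite ltNge; move: vxy; rewrite xv.
rewrite -subr_gt0 resolventB ?gt_eqF//; last exact: lt_trans yv.
by apply: divr_gt0; [lra|apply: mulr_gt0; lra].
Qed.

Lemma psum_le m N x y (Q : pred R) : x < y ->
  (forall v, m v <> 0%N -> Q v -> ~~ (x <= v <= y)) ->
  \sum_(v <- atoms m N%:R | Q v) (m v)%:R * (v - x)^-1 <=
  \sum_(v <- atoms m N%:R | Q v) (m v)%:R * (v - y)^-1.
Proof.
move=> xy hQ; rewrite big_seq_cond [leRHS]big_seq_cond; apply: ler_sum => v.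
move=> /andP[/mem_atoms[_ mv] Qv].
by rewrite ler_wpM2l//; apply/ltW/resolvent_lt => //; exact: hQ.
Qed.

Lemma psum_lt m N x y : x < y -> (forall v, m v <> 0%N -> ~~ (x <= v <= y)) ->
  (exists p, m p <> 0%N /\ `|p| <= N%:R) -> psum m N x < psum m N y.
Proof.
move=> xy hQ [p [mp pN]]; rewrite /psum !partial_sum_atoms.
have pa : p \in atoms m N%:R by apply/mem_atoms.
rewrite !(bigD1_seq p)//= ?atoms_uniq//.
apply: ltr_leD; last by apply: psum_le => // v mv _; exact: hQ.
rewrite ltr_pM2l; first by apply: resolvent_lt => //; exact: hQ.
by rewrite ltr0n lt0n; exact/eqP.
Qed.

(** Between v and y the other atoms contribute at most their sum S at y, while at distance t the
    pole contributes at most -1/t; t is chosen so that 1/t >= |S - C| + 1. *)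
Lemma psum_pole_right m N v y C : v < y -> m v <> 0%N -> `|v| <= N%:R ->
  (forall w, m w <> 0%N -> ~~ (v < w <= y)) ->
  exists2 x, v < x < y & psum m N x < C.
Proof.
move=> vy mv vN hw; rewrite /psum.
set S := \sum_(w <- atoms m N%:R | w != v) (m w)%:R * (w - y)^-1.
pose t := Num.min ((y - v) / 2) (`|S - C| + 1)^-1.
have t0 : 0 < t.
  by rewrite lt_min divr_gt0 ?subr_gt0//= invr_gt0 ltr_wpDl.
have t1 : t <= (y - v) / 2 by rewrite ge_min lexx.
have t2 : t <= (`|S - C| + 1)^-1 by rewrite ge_min lexx orbT.
exists (v + t); first by apply/andP; split; lra.
rewrite partial_sum_atoms (bigD1_seq v)/= ?atoms_uniq//; last exact/mem_atoms.
have h1 : \sum_(w <- atoms m N%:R | w != v) (m w)%:R * (w - (v + t))^-1 <= S.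
  apply: psum_le => [|w mw wv]; first lra.
  have := hw w mw; rewrite !negb_and -!ltNge -leNgt; case/orP => [h|->]; last first.
    by rewrite orbT.
  by apply/orP; left; lra.
have h2 : (m v)%:R * (v - (v + t))^-1 <= - t^-1.
  rewrite opprD addrA subrr add0r invrN mulrN lerN2 ler_peMl// ?invr_ge0 ?(ltW t0)//.
  by rewrite ler1n lt0n; exact/eqP.
have h3 : `|S - C| + 1 <= t^-1.
  by rewrite -[leLHS]invrK lef_pV2// posrE invr_gt0 ltr_wpDl.
have := ler_norm (S - C); lra.
Qed.

Lemma psum_pole_left m N v y C : y < v -> m v <> 0%N -> `|v| <= N%:R ->
  (forall w, m w <> 0%N -> ~~ (y <= w < v)) ->
  exists2 x, y < x < v & C < psum m N x.
Proof.
move=> vy mv vN hw; rewrite /psum.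
set S := \sum_(w <- atoms m N%:R | w != v) (m w)%:R * (w - y)^-1.
pose t := Num.min ((v - y) / 2) (`|C - S| + 1)^-1.
have t0 : 0 < t.
  by rewrite lt_min divr_gt0 ?subr_gt0//= invr_gt0 ltr_wpDl.
have t1 : t <= (v - y) / 2 by rewrite ge_min lexx.
have t2 : t <= (`|C - S| + 1)^-1 by rewrite ge_min lexx orbT.
exists (v - t); first by apply/andP; split; lra.
rewrite partial_sum_atoms (bigD1_seq v)/= ?atoms_uniq//; last exact/mem_atoms.
have h1 : S <= \sum_(w <- atoms m N%:R | w != v) (m w)%:R * (w - (v - t))^-1.
  apply: psum_le => [|w mw wv]; first lra.
  have := hw w mw; rewrite !negb_and -!ltNge -leNgt; case/orP => [->//|h].
  by apply/orP; right; lra.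
have h2 : t^-1 <= (m v)%:R * (v - (v - t))^-1.
  rewrite opprB addrC subrK ler_peMl// ?invr_ge0 ?(ltW t0)//.
  by rewrite ler1n lt0n; exact/eqP.
have h3 : `|C - S| + 1 <= t^-1.
  by rewrite -[leLHS]invrK lef_pV2// posrE invr_gt0 ltr_wpDl.
have := ler_norm (C - S); lra.
Qed.

Lemma psum_continuous m N u : m u = 0%N -> {for u, continuous (psum m N)}.
Proof.
move=> mu.
have -> : psum m N = fun u =>
    \sum_(v <- atoms m N%:R | v \in atoms m N%:R) (m v)%:R * (v - u)^-1.
  by apply/funext => x; rewrite /psum partial_sum_atoms big_seq.
apply: cvg_big => [|v /mem_atoms[_ mv]]; first exact: add_continuous.
apply: cvgM; first exact: cvg_cst.
apply: cvgV; last by apply: cvgB; [exact: cvg_cst|exact: cvg_id].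
by rewrite subr_eq0; apply: contra_notN mv => /eqP ->.
Qed.

(** Weak monotonicity is enough, strictness being supplied by the truncated sum. Typical members are
    the tail of the sum plus a constant or plus the boundary values of K_M. *)
Definition adm (k : R) h := {within `[- k, k], continuous h} /\
  {in `[- k, k] &, {homo h : u v / u <= v}}.

(* psum m N has a pole at each atom of m, and increases from -oo to +oo between
   consecutive ones, a behaviour which is not affected by adding h. *)
Section perturbed.
Variables (m : conf R) (N : nat) (k : R) (h : R -> R).
Hypotheses (hk : adm k h) (kN : k <= N%:R).
Hypothesis hp : exists p, m p <> 0%N /\ `|p| <= N%:R.

Let f u := psum m N u + h u.

(** Strictness comes from the atom in [-N, N]: otherwise the truncated sum is zero, and h may be
    constant. *)
Lemma perturbed_lt x y : - k <= x -> x < y -> y <= k ->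
  (forall v, m v <> 0%N -> ~~ (x <= v <= y)) -> f x < f y.
Proof.
move=> kx xy yk hv; apply: ltr_leD; first exact: psum_lt.
case: hk => _ hh; apply: hh (ltW xy).
  by rewrite in_itv/=; apply/andP; split; lra.
by rewrite in_itv/=; apply/andP; split; lra.
Qed.

Lemma perturbed_zero x y : - k <= x -> x < y -> y <= k ->
  (forall v, m v <> 0%N -> ~~ (x <= v <= y)) -> f x < 0 -> 0 < f y ->
  exists2 z, x < z < y & f z = 0.
Proof.
move=> kx xy yk hv fx fy.
have cf : {within `[x, y], continuous f}.
  case: hk => ch _.
  have /subspace_continuousP hc : {within `[x, y], continuous h}.
    apply: continuous_subspaceW ch => u /=; rewrite !in_itv/= => /andP[h1 h2].
    by rewrite (le_trans kx h1) (le_trans h2 yk).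
  apply/subspace_continuousP => u uxy; apply: cvgD; last exact: hc.
  apply: cvg_within_filter; apply: psum_continuous.
  apply: contrapT => mu; have := hv u mu.
  by move: uxy; rewrite /= in_itv/= => ->.
have := @IVT R f x y 0 (ltW xy) cf.
have fxy : f x < f y by exact: lt_trans fy.
rewrite min_l ?(ltW fxy)// max_r ?(ltW fxy)// (ltW fx) (ltW fy) => /(_ isT)[z].
rewrite in_itv/= => /andP[xz zy] fz; exists z => //.
rewrite !lt_neqAle xz zy !andbT; apply/andP; split; apply/eqP => e.
  by rewrite e fz ltxx in fx.
by rewrite -e fz ltxx in fy.
Qed.

Lemma perturbed_le x y : - k <= x -> x <= y -> y <= k ->
  (forall v, m v <> 0%N -> ~~ (x <= v <= y)) -> f x <= f y.
Proof.
by move=> kx; rewrite le_eqVlt => /orP[/eqP ->//|xy] yk hv; apply/ltW/perturbed_lt.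
Qed.

Lemma perturbed_inj x y : - k <= x <= k -> - k <= y <= k -> f x = f y ->
  (forall v, m v <> 0%N -> ~~ (x <= v <= y) && ~~ (y <= v <= x)) -> x = y.
Proof.
move=> /andP[kx xk] /andP[ky yk] fxy hv; have [xy|yx|//] := ltgtP x y.
  have : f x < f y by apply: perturbed_lt => // v /hv /andP[].
  by rewrite fxy ltxx.
have : f y < f x by apply: perturbed_lt => // v /hv /andP[].
by rewrite fxy ltxx.
Qed.

Section single_pole.
Variables a v b : R.
Hypotheses (ka : - k <= a) (av : a < v) (vb : v < b) (bk : b <= k) (mv : m v <> 0%N).
Hypothesis hv : forall w, m w <> 0%N -> a <= w <= b -> w = v.

Let vN : `|v| <= N%:R.
Proof.
by apply: le_trans kN; rewrite ler_norml (le_trans ka (ltW av)) (le_trans (ltW vb) bk).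
Qed.

Let freel w : m w <> 0%N -> ~~ (a <= w < v).
Proof.
move=> mw; apply/negP => /andP[h1 h2]; have := hv mw.
by rewrite h1 (le_trans (ltW h2) (ltW vb)) => /(_ isT) e; rewrite e ltxx in h2.
Qed.

Let freer w : m w <> 0%N -> ~~ (v < w <= b).
Proof.
move=> mw; apply/negP => /andP[h1 h2]; have := hv mw.
by rewrite h2 (le_trans (ltW av) (ltW h1)) => /(_ isT) e; rewrite e ltxx in h1.
Qed.

Lemma before_pole x y : a <= x -> x <= y -> y < v -> f x <= f y.
Proof.
move=> ax xy yv; apply: perturbed_le => //.
- exact: le_trans ax.
- exact: le_trans (ltW (lt_trans yv vb)) bk.
- move=> w mw; apply: contra (freel mw) => /andP[/(le_trans ax) -> /le_lt_trans ->//].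
Qed.

Lemma after_pole x y : v < x -> x <= y -> y <= b -> f x <= f y.
Proof.
move=> vx xy yb; apply: perturbed_le => //.
- exact: le_trans (ltW (lt_trans av vx)).
- exact: le_trans yb _.
- move=> w mw; apply: contra (freer mw) => /andP[/(lt_le_trans vx) -> /le_trans ->//].
Qed.

Lemma pole_left : exists2 x, a < x < v & 0 < f x.
Proof.
move: (ka) (av) (vb) (bk) => ka' av' vb' bk'.
have [x /andP[ax xv] psx] := psum_pole_left (- h a) av mv vN freel.
exists x; first by rewrite ax.
have : h a <= h x.
  by case: hk => _; apply; rewrite ?in_itv/=; do ?[apply/andP; split]; lra.
by rewrite /f; lra.
Qed.

Lemma pole_right : exists2 x, v < x < b & f x < 0.
Proof.
move: (ka) (av) (vb) (bk) => ka' av' vb' bk'.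
have [x /andP[vx xb] psx] := psum_pole_right (- h b) vb mv vN freer.
exists x; first by rewrite vx.
have : h x <= h b.
  by case: hk => _; apply; rewrite ?in_itv/=; do ?[apply/andP; split]; lra.
by rewrite /f; lra.
Qed.

(** On the left of v the function starts positive and increases, so it has no zero; on the right it
    climbs from -oo to a positive value, so it has exactly one. *)
Lemma pole_zero_right : 0 < f a -> 0 < f b -> exists z, [/\ v < z < b, f z = 0 &
  forall u, a <= u <= b -> u <> v -> f u = 0 -> u = z].
Proof.
move: (ka) (av) (vb) (bk) => ka' av' vb' bk' fa fb.
have [x /andP[vx xb] fx] := pole_right.
have [z /andP[xz zb] fz] : exists2 z, x < z < b & f z = 0.
  apply: perturbed_zero => //; first lra.
  by move=> w mw; apply: contra (freer mw) => /andP[/(lt_le_trans vx) -> ->].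
exists z; split => //; first by apply/andP; split; lra.
move=> u /andP[au ub] uv fu.
have [uv'|vu|//] := ltgtP u v; first by have := before_pole (lexx a) au uv'; rewrite fu leNgt fa.
apply: perturbed_inj; [by apply/andP; split; lra..|by rewrite fu fz|].
move=> w mw; rewrite -negb_or; apply: contra (freer mw) => /orP[] /andP[h1 h2];
  by apply/andP; split; lra.
Qed.

Lemma pole_zero_left : f a < 0 -> f b < 0 -> exists z, [/\ a < z < v, f z = 0 &
  forall u, a <= u <= b -> u <> v -> f u = 0 -> u = z].
Proof.
move: (ka) (av) (vb) (bk) => ka' av' vb' bk' fa fb.
have [x /andP[ax xv] fx] := pole_left.
have [z /andP[az zx] fz] : exists2 z, a < z < x & f z = 0.
  apply: perturbed_zero => //; first lra.
  by move=> w mw; apply: contra (freel mw) => /andP[-> /le_lt_trans ->].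
exists z; split => //; first by apply/andP; split; lra.
move=> u /andP[au ub] uv fu.
have [uv'|vu|//] := ltgtP u v; last by have := after_pole vu ub (lexx b); rewrite fu leNgt fb.
apply: perturbed_inj; [by apply/andP; split; lra..|by rewrite fu fz|].
move=> w mw; rewrite -negb_or; apply: contra (freel mw) => /orP[] /andP[h1 h2];
  by apply/andP; split; lra.
Qed.

(** The left branch increases from a positive value, and the right one increases to a negative
    value. *)
Lemma pole_no_zero : 0 < f a -> f b < 0 ->
  forall u, a <= u <= b -> u <> v -> f u <> 0.
Proof.
move=> fa fb u /andP[au ub] uv fu; have [uv'|vu|//] := ltgtP u v.
  by have := before_pole (lexx a) au uv'; rewrite fu leNgt fa.
by have := after_pole vu ub (lexx b); rewrite fu leNgt fb.
Qed.

End single_pole.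

Lemma free_zero a b : - k <= a -> a < b -> b <= k ->
  (forall w, m w <> 0%N -> ~~ (a <= w <= b)) ->
  f a < 0 -> 0 < f b ->
  exists z, [/\ a < z < b, f z = 0 &
    forall u, a <= u <= b -> f u = 0 -> u = z].
Proof.
move=> ka ab bk free fa fb.
have [z /andP[az zb] fz] := perturbed_zero ka ab bk free fa fb.
exists z; split => //; first by apply/andP; split; lra.
move=> u /andP[au ub] fu; apply: perturbed_inj; [by apply/andP; split; lra..|by rewrite fu fz|].
move=> w mw; rewrite -negb_or; apply: contra (free w mw) => /orP[] /andP[h1 h2];
  by apply/andP; split; lra.
Qed.

End perturbed.
End resolvent_sums.

(** * Tails of the principal value sums *)

Section tails.
Context {R : realType}.
Implicit Types (m : conf R) (g : R -> R).

Definition tsum m (N n : nat) (u : R) : R :=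
  partial_sum m (fun v => if N%:R < `|v| then (v - u)^-1 else 0) n.

Definition tsum2 m (N n : nat) : R :=
  partial_sum m (fun v => if N%:R < `|v| then v ^- 2 else 0) n.

Definition tail m N (u : R) : R := limn (fun n => tsum m N n u).

Lemma partial_sum_vanish n g : vanish n%:R (fun v : R => if `|v| <= n%:R then g v else 0).
Proof. by move=> v; rewrite ltNge => /negbTE ->. Qed.

Lemma partial_sum_nondecreasing m g : (forall v, m v <> 0%N -> 0 <= g v) ->
  nondecreasing_seq (partial_sum m g).
Proof.
move=> g0 n n' nn'; apply: (@ler_conf_int _ _ n'%:R).
- by apply: vanish_le (@partial_sum_vanish _ _); rewrite ler_nat.
- exact: partial_sum_vanish.
- move=> v mv; case: ifPn => h; last by case: ifP => // _; exact: g0.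
  by rewrite (le_trans h)// ler_nat.
Qed.

Lemma partial_sumB m g g' n :
  partial_sum m (fun v => g v - g' v) n = partial_sum m g n - partial_sum m g' n.
Proof. by rewrite !partial_sum_atoms -sumrB; apply: eq_bigr => v _; rewrite mulrBr. Qed.

Lemma partial_sumZ m c g n :
  partial_sum m (fun v => c * g v) n = c * partial_sum m g n.
Proof. by rewrite !partial_sum_atoms mulr_sumr; apply: eq_bigr => v _; rewrite mulrCA. Qed.

Lemma ler_partial_sum m g g' n : (forall v, m v <> 0%N -> g v <= g' v) ->
  partial_sum m g n <= partial_sum m g' n.
Proof.
move=> gg'; rewrite !partial_sum_atoms big_seq [leRHS]big_seq.
by apply: ler_sum => v /mem_atoms[_ mv]; rewrite ler_wpM2l// gg'.
Qed.

Lemma partial_sum_split m g N n : (N <= n)%N -> partial_sum m g n =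
  partial_sum m g N + partial_sum m (fun v => if N%:R < `|v| then g v else 0) n.
Proof.
move=> Nn; rewrite /partial_sum -(@conf_intD _ _ n%:R); last 2 first.
- by apply: vanish_le (@partial_sum_vanish _ _); rewrite ler_nat.
- exact: partial_sum_vanish.
apply: eq_conf_int => v _; have [vN|Nv] := leP `|v| N%:R; last by rewrite add0r.
by rewrite (le_trans vN) ?ler_nat// addr0.
Qed.

Lemma psum_tsum m N n u : (N <= n)%N -> psum m n u = psum m N u + tsum m N n u.
Proof. exact: partial_sum_split. Qed.

(** As |x| and |y| are at most N/2 < |v|/2, both |v - x| and |v - y| are at least |v|/2; their
    product gives the factor 4. *)
Lemma resolvent_diff_bound (N : nat) (v x y : R) : N%:R < `|v| ->
  - N%:R <= 2 * x -> x <= y -> 2 * y <= N%:R ->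
  0 <= (v - y)^-1 - (v - x)^-1 <= 4 * (y - x) * v ^- 2.
Proof.
move=> Nv Nx xy yN.
have N0 : 0 <= N%:R :> R by [].
have [v0|v0] := leP 0 v.
  rewrite ger0_norm// in Nv.
  have vx : v / 2 <= v - x by lra.
  have vy : v / 2 <= v - y by lra.
  have vp : 0 < v / 2 by lra.
  rewrite resolventB ?gt_eqF//; [|lra|lra].
  apply/andP; split; first by apply: divr_ge0; [lra|apply: mulr_ge0; lra].
  rewrite -mulrA mulrCA ler_wpM2l//; first lra.
  have -> : 4 * v ^- 2 = (v / 2 * (v / 2))^-1 by field; lra.
  rewrite lef_pV2 ?posrE; [by apply: ler_pM; lra|by apply: mulr_gt0; lra|by apply: mulr_gt0; lra].
rewrite ltr0_norm// in Nv.
have vx : - v / 2 <= x - v by lra.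
have vy : - v / 2 <= y - v by lra.
have vp : 0 < - v / 2 by lra.
rewrite resolventB ?lt_eqF//; [|lra|lra].
have -> : (v - x) * (v - y) = (x - v) * (y - v) by ring.
apply/andP; split; first by apply: divr_ge0; [lra|apply: mulr_ge0; lra].
rewrite -mulrA mulrCA ler_wpM2l//; first lra.
have -> : 4 * v ^- 2 = (- v / 2 * (- v / 2))^-1 by field; lra.
rewrite lef_pV2 ?posrE; [by apply: ler_pM; lra|by apply: mulr_gt0; lra|by apply: mulr_gt0; lra].
Qed.

Section tail.
Variables (m : conf R) (N : nat) (tau : R).
Hypothesis cv0 : cvgn (fun n => tsum m N n 0).
Hypothesis bd : forall n, tsum2 m N n <= tau.

Lemma tau_ge0 : 0 <= tau.
Proof.
apply: le_trans (bd 0%N); apply: conf_int_ge0 => v _.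
by case: ifP => // _; case: ifP => // _; rewrite invr_ge0 sqr_ge0.
Qed.

Lemma tsumB n x y : - N%:R <= 2 * x -> x <= y -> 2 * y <= N%:R ->
  0 <= tsum m N n y - tsum m N n x <= 4 * (y - x) * tau.
Proof.
move=> Nx xy yN; rewrite /tsum -partial_sumB; apply/andP; split.
  apply: conf_int_ge0 => v _; case: ifP => // _; case: ifPn => Nv; last by rewrite subrr.
  by have /andP[] := resolvent_diff_bound Nv Nx xy yN.
apply: (@le_trans _ _ (4 * (y - x) * tsum2 m N n)); last first.
  by rewrite ler_wpM2l//; lra.
rewrite /tsum2 -partial_sumZ; apply: ler_partial_sum => v _.
case: ifPn => Nv; last by rewrite subrr mulr0.
by have /andP[] := resolvent_diff_bound Nv Nx xy yN.
Qed.

(** All terms of the difference are nonnegative, so it is a bounded monotone sequence. The only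
    conditional convergence involved is thus the one at u = 0, which is assumed. *)
Lemma tsumB_cvg x y : - N%:R <= 2 * x -> x <= y -> 2 * y <= N%:R ->
  cvgn (fun n => tsum m N n y - tsum m N n x).
Proof.
move=> Nx xy yN; apply: nondecreasing_is_cvgn.
  move=> n n' nn'; rewrite /tsum -!partial_sumB; apply: partial_sum_nondecreasing => // v _.
  case: ifPn => Nv; last by rewrite subrr.
  by have /andP[] := resolvent_diff_bound Nv Nx xy yN.
exists (4 * (y - x) * tau) => _ [n _ <-].
by have /andP[] := tsumB n Nx xy yN.
Qed.

Lemma tsum_cvg u : 2 * `|u| <= N%:R -> cvgn (fun n => tsum m N n u).
Proof.
move=> uN; have N0 : 0 <= N%:R :> R by [].
have [u0|u0] := leP 0 u.
  rewrite ger0_norm// in uN.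
  have -> : (fun n => tsum m N n u) =
      (fun n => (tsum m N n u - tsum m N n 0) + tsum m N n 0).
    by apply/funext => n; rewrite subrK.
  by apply: is_cvgD => //; apply: tsumB_cvg; lra.
rewrite ltr0_norm// in uN.
have -> : (fun n => tsum m N n u) =
    (fun n => tsum m N n 0 - (tsum m N n 0 - tsum m N n u)).
  by apply/funext => n; rewrite opprB addrCA subrr addr0.
by apply: is_cvgB => //; apply: tsumB_cvg; lra.
Qed.

Lemma tailB x y : - N%:R <= 2 * x -> x <= y -> 2 * y <= N%:R ->
  0 <= tail m N y - tail m N x <= 4 * (y - x) * tau.
Proof.
move=> Nx xy yN; have N0 : 0 <= N%:R :> R by [].
have cx : cvgn (fun n => tsum m N n x).
  by apply: tsum_cvg; rewrite -ler_pdivlMl// ler_norml; apply/andP; split; lra.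
have cy : cvgn (fun n => tsum m N n y).
  by apply: tsum_cvg; rewrite -ler_pdivlMl// ler_norml; apply/andP; split; lra.
rewrite /tail -limB//; apply/andP; split.
  apply: limr_ge; first exact: is_cvgB.
  by apply: nearW => n; have /andP[] := tsumB n Nx xy yN.
apply: limr_le; first exact: is_cvgB.
by apply: nearW => n; have /andP[] := tsumB n Nx xy yN.
Qed.

(** By [tailB] the tail is nondecreasing and Lipschitz with constant 4 tau on [-k, k]. *)
Lemma tail_adm k : 2 * k <= N%:R -> adm k (tail m N).
Proof.
move=> kN; split; last first.
  move=> x y; rewrite !in_itv/= => /andP[kx xk] /andP[ky yk] xy.
  by rewrite -subr_ge0; have /andP[] := @tailB x y ltac:(lra) xy ltac:(lra).
apply/subspace_continuousP => x; rewrite /= in_itv/= => /andP[kx xk].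
apply/cvgrPdist_lt => e e0; rewrite near_withinE.
have t0 := tau_ge0.
have h : 0 < e / (4 * tau + 1) by apply: divr_gt0; lra.
near=> y; rewrite /= in_itv/= => /andP[ky yk].
have xy : `|x - y| < e / (4 * tau + 1).
  by near: y; exists (e / (4 * tau + 1)).
have : `|tail m N x - tail m N y| <= 4 * tau * `|x - y|.
  have [h1|h1] := leP x y.
    have /andP[h2 h3] := @tailB x y ltac:(lra) h1 ltac:(lra).
    rewrite distrC ger0_norm// (le_trans h3)// distrC ger0_norm ?subr_ge0//.
    by rewrite mulrAC.
  have /andP[h2 h3] := @tailB y x ltac:(lra) (ltW h1) ltac:(lra).
  rewrite ger0_norm// (le_trans h3)// ger0_norm ?subr_ge0 ?(ltW h1)//.
  by rewrite mulrAC.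
move=> /le_lt_trans; apply.
rewrite ltr_pdivlMr in xy; last lra.
have : 0 <= `|x - y| by []; nra.
Unshelve. all: by end_near. Qed.

Lemma tail_bound u : 2 * `|u| <= N%:R -> `|tail m N u - tail m N 0| <= 4 * `|u| * tau.
Proof.
move=> uN; have N0 : 0 <= N%:R :> R by [].
have [u0|u0] := leP 0 u.
  rewrite (ger0_norm u0) in uN *.
  have /andP[h2 h3] := @tailB 0 u ltac:(lra) u0 ltac:(lra).
  by rewrite ger0_norm//; lra.
rewrite (ltr0_norm u0) in uN *.
have /andP[h2 h3] := @tailB u 0 ltac:(lra) (ltW u0) ltac:(lra).
by rewrite distrC ger0_norm//; lra.
Qed.

(** This value of tau solves tau + 4 rho tau = delta: the first term bounds the tail at 0, the
    second its variation on [-rho, rho]. *)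
Lemma tail_small rho delta u : tau = delta / (1 + 4 * rho) -> `|tail m N 0| <= tau ->
  2 * `|u| <= N%:R -> `|u| <= rho -> `|tail m N u| <= delta.
Proof.
move=> tE t0 uN ur; have r0 : 0 <= rho by apply: le_trans ur.
have <- : tau + 4 * rho * tau = delta.
  by rewrite tE -[X in X + _]mul1r -mulrDl mulrC mulfVK// gt_eqF//; lra.
have h1 := tail_bound uN.
have h2 : 4 * `|u| * tau <= 4 * rho * tau by rewrite ler_wpM2r ?tau_ge0//; lra.
have h3 := ler_normD (tail m N u - tail m N 0) (tail m N 0); rewrite subrK in h3.
by move: h1 h2 h3 t0; clear; lra.
Qed.

Lemma psum_cvg u : 2 * `|u| <= N%:R ->
  (fun n => psum m n u) @ \oo --> psum m N u + tail m N u.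
Proof.
move=> uN; have h : (fun n => psum m N u + tsum m N n u) @ \oo --> psum m N u + tail m N u.
  by apply: cvgD; [exact: cvg_cst|exact: tsum_cvg].
apply: cvg_trans h; apply: near_eq_cvg; near=> n.
by rewrite (@psum_tsum m N n)//; near: n; exact: nbhs_infty_ge.
Unshelve. all: by end_near. Qed.

Lemma stieltjes_tail u : 2 * `|u| <= N%:R -> stieltjes m u = psum m N u + tail m N u.
Proof. by move=> uN; apply: cvg_lim => //; exact: psum_cvg. Qed.

End tail.

Lemma tail1E m N : tail1 N%:R m = tail m N 0.
Proof.
rewrite /tail1 /conf_sum /tail /tsum; congr (lim (_ @ \oo)).
by apply/funext => n; congr partial_sum; apply/funext => v; rewrite subr0.
Qed.

End tails.

Section conf_of_set_theory.
Context {R : realType}.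

Lemma conf_of_setE (Z : set R) v : conf_of_set Z v =
  `[< Z v /\ finite_set (Z `&` `[- (`|v| + 1), `|v| + 1]) >] :> nat.
Proof. by []. Qed.

Lemma conf_of_set_neq0 (Z : set R) v : conf_of_set Z v <> 0%N -> Z v.
Proof. by rewrite conf_of_setE; case: asboolP => // -[]. Qed.

Lemma conf_of_set_simple (Z : set R) : simple (conf_of_set Z).
Proof. by move=> v; rewrite conf_of_setE; case: asbool. Qed.

(** [conf_of_set] tests finiteness one unit beyond v, whence the margin in the last hypothesis. *)
Lemma conf_of_set1 (Z : set R) W v : finite_set (Z `&` [set u | `|u| <= W]) ->
  Z v -> `|v| + 1 <= W -> conf_of_set Z v = 1%N.
Proof.
move=> fZ Zv vW; rewrite conf_of_setE; case: asboolP => // -[]; split => //.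
apply: sub_finite_set fZ => u [Zu]; rewrite /= in_itv/= -ler_norml => uv.
by split => //; exact: le_trans vW.
Qed.

End conf_of_set_theory.

(** * Stability of the zeros *)

Section stability.
Context {R : realType}.
Implicit Types (m : conf R) (h : R -> R).

(** The factor 2 lets another atom move by less than e and still stay out of the window of radius e
    around q. *)
Lemma isolated m (q : R) : \forall e \near (0:R)^'+, forall x, m x <> 0%N -> x != q ->
  2 * e < `|x - q|.
Proof.
have : \forall e \near (0:R)^'+, forall x, x \in atoms m (`|q| + 1) -> x != q -> 2 * e < `|x - q|.
  apply: near_seq => x _; have [->|xq] := eqVneq x q; first by apply: nearW => e /eqP.
  have h : 0 < `|x - q| / 2 by rewrite divr_gt0// normr_gt0 subr_eq0.
  near=> e => _; have : e < `|x - q| / 2 by near: e; exact: nbhs_right_lt.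
  lra.
move=> h; near=> e.
have he : forall x, x \in atoms m (`|q| + 1) -> x != q -> 2 * e < `|x - q| by near: e.
move=> x mx xq.
have e1 : e < 1 / 2 by near: e; apply: nbhs_right_lt; lra.
have [xW|Wx] := leP `|x| (`|q| + 1).
  by apply: he => //; apply/mem_atoms.
have := lerB_dist x q; lra.
Unshelve. all: by end_near. Qed.

(** A pole sends the function from +oo back to -oo. With a pole, equal signs at both ends force a
    crossing on exactly one branch, the right one if they are positive and the left one if they are
    negative; without a pole, the crossing is the sign change itself. *)
Lemma window_zero m (N : nat) (k : R) h a b v (sa sb : bool) :
  adm k h -> k <= N%:R -> (exists p, m p <> 0%N /\ `|p| <= N%:R) ->
  - k <= a -> a < b -> b <= k ->
  (if sa then 0 < psum m N a + h a else psum m N a + h a < 0) ->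
  (if sb then 0 < psum m N b + h b else psum m N b + h b < 0) ->
  (forall w, m w <> 0%N -> a <= w <= b -> w = v) ->
  [/\ m v <> 0%N, a < v < b & sa = sb] \/
    [/\ forall w, m w <> 0%N -> ~~ (a <= w <= b), ~~ sa & sb] ->
  exists z, [/\ a < z < b, m z = 0%N /\ psum m N z + h z = 0 &
    forall u, a <= u <= b -> m u = 0%N -> psum m N u + h u = 0 -> u = z].
Proof.
move=> ha kN hp ka ab bk fa fb hv [[mv /andP[av vb] sab]|[free nsa psb]]; last first.
  rewrite (negbTE nsa) in fa; rewrite psb in fb.
  have [z [/andP[z1 z2] fz uz]] := free_zero ha hp ka ab bk free fa fb.
  exists z; split; [by rewrite z1| |by move=> u hu _; exact: uz].
  by split => //; apply: contrapT => /free; rewrite (ltW z1) (ltW z2).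
have nv u : m u = 0%N -> u <> v by move=> mu uv; rewrite uv in mu.
have [ps|ns] := boolP sa.
  rewrite -sab ps in fb; rewrite ps in fa.
  have [z [/andP[z1 z2] fz uz]] := pole_zero_right ha kN hp ka av vb bk mv hv fa fb.
  have az := lt_trans av z1.
  exists z; split; [by rewrite az| |by move=> u hu /nv; exact: uz].
  split => //; apply: contrapT => mz.
  by have := hv z mz; rewrite (ltW az) (ltW z2) => /(_ isT) e; rewrite e ltxx in z1.
rewrite -sab (negbTE ns) in fb; rewrite (negbTE ns) in fa.
have [z [/andP[z1 z2] fz uz]] := pole_zero_left ha kN hp ka av vb bk mv hv fa fb.
have zb := lt_trans z2 vb.
exists z; split; [by rewrite z1| |by move=> u hu /nv; exact: uz].
split => //; apply: contrapT => mz.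
by have := hv z mz; rewrite (ltW z1) (ltW zb) => /(_ isT) e; rewrite e ltxx in z2.
Qed.

Lemma ball_itv (x y d : R) : `|x - y| < d -> y - d < x < y + d.
Proof. by rewrite ltr_distl. Qed.

Lemma itv_ball (x y d : R) : y - d < x < y + d -> `|x - y| < d.
Proof. by rewrite ltr_distl. Qed.

(** Z is prescribed on [-k, k] only, as nothing is known of the solutions beyond. The quantification
    over h, inside the neighbourhood, later dispenses with any control of the dependence between
    omega_M and K_M. *)
Definition zeros_in m (C : nat -> set (R -> R)) (U : set (conf R)) :=
  \forall k \near \oo, \forall N \near \oo,
    nbhs m [set m' : conf R | forall h, adm k%:R h -> C k h -> forall Z : set R,
      (forall u, `|u| <= k%:R -> (Z u <-> m' u = 0%N /\ psum m' N u + h u = 0)) ->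
      U (conf_of_set Z)].

Variables (m : conf R) (C : nat -> set (R -> R)).

Let index := (nat * nat * conf R * (R -> R))%type.
Let kx (x : index) := x.1.1.1.
Let Nx (x : index) := x.1.1.2.
Let mx (x : index) := x.1.2.
Let hx (x : index) := x.2.

(* The iterated limit in which first m' tends to m, then N to infinity, then k to
   infinity, uniformly in the admissible perturbations h. *)
Definition limF : set_system index := [set Q |
  \forall k \near \oo, \forall N \near \oo, \forall m' \near m,
    forall h, adm k%:R h -> C k h -> Q (k, N, m', h)].

Let nearm (Q : set (conf R)) : (forall m', Q m') -> nbhs m Q.
Proof. by move=> hQ; apply: (@filterS _ _ _ setT) => //; exact: filterT. Qed.

Instance limF_filter : Filter limF.
Proof.
split.
- by apply: nearW => k; apply: nearW => N; apply: nearm => m' h _ _; exact: I.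
- move=> A B; rewrite /limF /= => hA hB; apply: filterS2 hA hB => k hA hB.
  apply: filterS2 hA hB => N hA hB.
  apply: filterS2 hA hB => m' {}hA {}hB h hh Ch.
  by split; [exact: hA|exact: hB].
- move=> A B AB; rewrite /limF /= => hA; apply: filterS hA => k hA.
  apply: filterS hA => N hA.
  apply: filterS hA => m' {}hA h hh Ch.
  by apply: AB; exact: hA.
Qed.

Lemma limF_k (k0 : R) : \forall x \near limF, k0 <= (kx x)%:R.
Proof.
change (\forall k \near \oo, \forall N \near \oo, \forall m' \near m,
  forall h, adm k%:R h -> C k h -> k0 <= k%:R :> R).
have h := nbhs_infty_ger k0.
by apply: filterS h => k hk; apply: nearW => N; apply: nearm.
Qed.

Lemma limF_kN : \forall x \near limF, (kx x <= Nx x)%N.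
Proof.
change (\forall k \near \oo, \forall N \near \oo, \forall m' \near m,
  forall h, adm k%:R h -> C k h -> (k <= N)%N).
apply: nearW => k; apply: filterS (nbhs_infty_ge k) => N hN.
by apply: nearm.
Qed.

Lemma limF_m U : nbhs m U -> \forall x \near limF, U (mx x).
Proof.
move=> mU; change (\forall k \near \oo, \forall N \near \oo, \forall m' \near m,
  forall h, adm k%:R h -> C k h -> U m').
apply: nearW => k; apply: nearW => N.
by apply: filterS mU => m' Um' h _ _.
Qed.

Lemma limF_adm : \forall x \near limF, adm (kx x)%:R (hx x) /\ C (kx x) (hx x).
Proof.
change (\forall k \near \oo, \forall N \near \oo, \forall m' \near m,
  forall h, adm k%:R h -> C k h -> adm k%:R h /\ C k h).
by apply: nearW => k; apply: nearW => N; apply: nearm.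
Qed.

Definition pert (x : index) (u : R) := psum (mx x) (Nx x) u + hx x u.

(* z0 is the limiting configuration of zeros, and sgn the limiting sign (true for
   positive) of pert off the atoms of m and z0. The sign changes exactly at the
   points that are an atom of only one of m and z0. *)
Variables (z0 : conf R) (sgn : R -> bool).
Hypothesis sm : simple m.
Hypothesis mp : exists p, m p <> 0%N.
Hypothesis S0 : forall u, m u = 0%N -> z0 u = 0%N ->
  \forall x \near limF, if sgn u then 0 < pert x u else pert x u < 0.
Hypothesis S1 : forall u, m u = 0%N -> z0 u = 0%N ->
  \forall e \near (0:R)^'+, sgn (u - e) = sgn (u + e).
Hypothesis S2 : forall q, m q <> 0%N -> z0 q <> 0%N ->
  \forall e \near (0:R)^'+, sgn (q - e) = sgn (q + e).
Hypothesis S3 : forall q, m q <> 0%N -> z0 q = 0%N ->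
  \forall e \near (0:R)^'+, sgn (q - e) && ~~ sgn (q + e).
Hypothesis S4 : forall q, m q = 0%N -> z0 q <> 0%N ->
  \forall e \near (0:R)^'+, ~~ sgn (q - e) && sgn (q + e).

Let regular (K : R) (x : index) := [/\ K <= (kx x)%:R, adm (kx x)%:R (hx x),
  (kx x)%:R <= (Nx x)%:R :> R
  & exists p, mx x p <> 0%N /\ `|p| <= (Nx x)%:R].

Let limF_regular K : \forall x \near limF, regular K x.
Proof.
have [p mp0] := mp.
have hc : nbhs m (close `|p| 1 m) by exact: near_close.
near=> x; split.
- by near: x; exact: limF_k.
- by near: x; apply: filterS limF_adm => x [].
- by rewrite ler_nat; near: x; exact: limF_kN.
- have [phi [/(_ p mp0 (lexx _))[h1 h2] _ _]] : close `|p| 1 m (mx x) by near: x; exact: limF_m.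
  exists (phi p); split; first by rewrite h2.
  have kp : `|p| + 1 <= (kx x)%:R by near: x; exact: limF_k.
  have kN : (kx x)%:R <= (Nx x)%:R :> R by rewrite ler_nat; near: x; exact: limF_kN.
  have := lerB_dist (phi p) p; lra.
Unshelve. all: by end_near. Qed.

Let limF_free (y d : R) : 0 < d ->
  (forall w, m w <> 0%N -> 2 * d < `|w - y|) ->
  \forall x \near limF, forall w, mx x w <> 0%N -> ~~ (y - d <= w <= y + d).
Proof.
move=> d0 hd; have hc : nbhs m (close (`|y| + d + 1) d m) by exact: near_close.
near=> x; have : close (`|y| + d + 1) d m (mx x) by near: x; exact: limF_m.
move=> [phi [h1 h2 h3]] w mw; apply/negP => /andP[wy1 wy2].
have wy : `|w - y| <= d by rewrite ler_norml; apply/andP; split; lra.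
have [|p [mp0 pW pw]] := h3 w mw; first by have := lerB_dist w y; lra.
have [pw' _] := h1 p mp0 pW; rewrite pw in pw'.
have := hd p mp0; have := ler_distD w p y; rewrite (distrC p w); lra.
Unshelve. all: by end_near. Qed.

(** Near such a point y the limiting sign is the same at y - d and y + d, and there is no pole in
    between, so monotonicity gives one sign to the whole interval. This uniformity in the point is
    what a compactness argument needs. *)
Let local_sign y : m y = 0%N -> z0 y = 0%N ->
  \forall x' \near y & x \near limF, pert x x' <> 0.
Proof.
move=> my zy.
have hm0 := isolated m y; have hz0 := isolated z0 y; have hs := S1 my zy.
near (0:R)^'+ => d.
have d0 : 0 < d by [].
have hm' : forall x, m x <> 0%N -> x != y -> 2 * d < `|x - y| by near: d.
have hz' : forall x, z0 x <> 0%N -> x != y -> 2 * d < `|x - y| by near: d.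
have {hm'}hm w : m w <> 0%N -> 2 * d < `|w - y|.
  by move=> mw; apply: hm' => //; apply/eqP => e; apply: mw; rewrite e.
have {hz'}hz w : z0 w <> 0%N -> 2 * d < `|w - y|.
  by move=> mw; apply: hz' => //; apply/eqP => e; apply: mw; rewrite e.
have h1 : sgn (y - d) = sgn (y + d) by near: d.
have out (n : conf R) w : (forall w, n w <> 0%N -> 2 * d < `|w - y|) -> `|w - y| <= d -> n w = 0%N.
  by move=> hn wd; apply: contrapT => /hn; lra.
have ydl : `|y - d - y| <= d by rewrite addrAC subrr add0r normrN gtr0_norm.
have ydr : `|y + d - y| <= d by rewrite addrAC subrr add0r gtr0_norm.
have hl := S0 (out m _ hm ydl) (out z0 _ hz ydl).
have hr := S0 (out m _ hm ydr) (out z0 _ hz ydr).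
have hf := limF_free d0 hm.
have hreg := limF_regular (`|y| + d).
near=> x' x => /=.
have yx : `|y - x'| < d by near: x'; exists d.
have [kK ha kN hp] : regular (`|y| + d) x by near: x.
have free : forall w, mx x w <> 0%N -> ~~ (y - d <= w <= y + d) by near: x.
have fl : if sgn (y - d) then 0 < pert x (y - d) else pert x (y - d) < 0 by near: x.
have fr : if sgn (y + d) then 0 < pert x (y + d) else pert x (y + d) < 0 by near: x.
move/ltr_normlP : yx => [yx1 yx2].
have ny := ler_norm y; have ny' := ler_norm (- y); rewrite normrN in ny'.
have [ps|ns] := boolP (sgn (y - d)).
  rewrite ps in fl; apply/eqP; rewrite gt_eqF//; apply: lt_trans fl _.
  apply: (perturbed_lt ha hp); [lra|lra|lra|] => w mw.
  by apply: contra (free w mw) => /andP[h2 h3]; apply/andP; split; lra.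
rewrite -h1 (negbTE ns) in fr; apply/eqP; rewrite lt_eqF//; apply: lt_trans fr.
apply: (perturbed_lt ha hp); [lra|lra|lra|] => w mw.
by apply: contra (free w mw) => /andP[h2 h3]; apply/andP; split; lra.
Unshelve. all: by end_near. Qed.

Let nonpole_zero x u := mx x u = 0%N /\ pert x u = 0.

Ltac slra := clear - R m C index kx Nx mx hx nearm z0 sgn sm mp S0 S1 S2 S3 S4
  regular limF_regular limF_free local_sign nonpole_zero; lra.

(** The windows of radius d around the atoms of m and z0 hold one zero if the centre is an atom of
    z0, and none otherwise; what remains of [-W, W] is compact and free of zeros by [local_sign].
    The matching sends an atom of z0 to the zero in its window. *)
Lemma zeros_stable W e : 0 < e -> \forall x \near limF, exists phi : R -> R,
  [/\ forall q, z0 q <> 0%N -> `|q| <= W -> `|phi q - q| < e /\ nonpole_zero x (phi q),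
      forall q q', z0 q <> 0%N -> `|q| <= W -> z0 q' <> 0%N -> `|q'| <= W ->
        phi q = phi q' -> q = q'
    & forall u, nonpole_zero x u -> `|u| <= W - 1 ->
        exists q, [/\ z0 q <> 0%N, `|q| <= W & phi q = u]].
Proof.
move=> e0; pose K := W + 2.
pose s := atoms m K ++ atoms z0 K.
have sP q : (m q <> 0%N \/ z0 q <> 0%N) -> `|q| <= K -> q \in s.
  by move=> [mq|zq] qK; rewrite mem_cat; apply/orP; [left|right]; apply/mem_atoms.
have sK q : q \in s -> `|q| <= K.
  by rewrite mem_cat => /orP[] /mem_atoms[].
pose good (q d : R) := [/\ forall w, m w <> 0%N -> w != q -> 2 * d < `|w - q|,
  forall w, z0 w <> 0%N -> w != q -> 2 * d < `|w - q|,
  m q <> 0%N -> z0 q <> 0%N -> sgn (q - d) = sgn (q + d),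
  m q <> 0%N -> z0 q = 0%N -> sgn (q - d) && ~~ sgn (q + d)
  & m q = 0%N -> z0 q <> 0%N -> ~~ sgn (q - d) && sgn (q + d)].
have hgood0 : \forall d \near (0:R)^'+, forall q, q \in s -> good q d.
  apply: near_seq => q _.
  have [/eqP mq|/eqP mq] := boolP (m q == 0%N); have [/eqP zq|/eqP zq] := boolP (z0 q == 0%N).
  - near=> d; split => //; [|]; near: d; exact: isolated.
  - have h4 := S4 mq zq.
    near=> d; split => //; [| |move=> _ _]; near: d => //; exact: isolated.
  - have h4 := S3 mq zq.
    near=> d; split => //; [| |move=> _ _]; near: d => //; exact: isolated.
  - have h4 := S2 mq zq.
    near=> d; split => //; [| |move=> _ _]; near: d => //; exact: isolated.
near (0:R)^'+ => d.
have d0 : 0 < d by [].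
have de : d < e by near: d; exact: nbhs_right_lt.
have d1 : d < 1 / 2 by near: d; apply: nbhs_right_lt; lra.
have hgood : forall q, q \in s -> good q d by near: d.
have outm q (n : conf R) : (forall w, n w <> 0%N -> w != q -> 2 * d < `|w - q|) ->
    n (q - d) = 0%N /\ n (q + d) = 0%N.
  move=> hn; split; apply: contrapT => /hn.
    rewrite addrAC subrr add0r normrN gtr0_norm// => h; suff : 2 * d < d by lra.
    by apply: h; apply/eqP; lra.
  rewrite addrAC subrr add0r gtr0_norm// => h; suff : 2 * d < d by lra.
  by apply: h; apply/eqP; lra.
have hsign0 : \forall x \near limF, forall q, q \in s ->
   (if sgn (q - d) then 0 < pert x (q - d) else pert x (q - d) < 0) /\
   (if sgn (q + d) then 0 < pert x (q + d) else pert x (q + d) < 0).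
  apply: near_seq => q qs; have [g1 g2 _ _ _] := hgood q qs.
  have [ml mr] := outm q m g1; have [zl zr] := outm q z0 g2.
  have h1 := S0 ml zl; have h2 := S0 mr zr.
  by near=> x; split; near: x.
pose A := [set y : R | `|y| <= W /\ forall q, q \in s -> d <= `|y - q|].
have cA : compact A.
  have -> : A = `[- W, W]%classic `&` (\bigcap_(q in [set` s]) [set y | d <= `|y - q|]).
    apply/seteqP; split => y /=; rewrite in_itv/= -ler_norml.
      by move=> [h1 h2]; split => // q /= qs; exact: h2.
    by move=> [h1 h2]; split => // q qs; exact: (h2 q).
  apply: (@subclosed_compact _ _ `[- W, W]%classic); last by move=> y [].
    apply: closedI; first exact: interval_closed.
    apply: closed_bigI => q _.
    have -> : [set y : R | d <= `|y - q|] = (fun y => `|y - q|) @^-1` [set y | d <= y] by [].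
    apply: preimage_closed; last exact: closed_ge.
    by move=> y _; apply: cvg_norm; apply: cvgB; [exact: cvg_id|exact: cvg_cst].
  exact: segment_compact.
(* Compactness in its filter form makes the local statement hold for all points of A at once. *)
have hA0 : \forall x \near limF, A `<=` [set y | pert x y <> 0].
  apply: ((iffLR (compact_near_coveringP A)) cA _ limF (fun x y => pert x y <> 0)).
  move=> y [yW hy]; apply: local_sign.
    apply: contrapT => my; have := hy y (sP y (or_introl my) ltac:(rewrite /K; move: yW; slra)).
    by rewrite subrr normr0 leNgt d0.
  apply: contrapT => zy; have := hy y (sP y (or_intror zy) ltac:(rewrite /K; move: yW; slra)).
  by rewrite subrr normr0 leNgt d0.
have d20 : 0 < d / 2 by lra.
have hclose : nbhs m (close (K + 2) (d / 2) m) by exact: near_close.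
have hreg := limF_regular (K + 2).
near=> x.
have [kK ha kN hp] : regular (K + 2) x by near: x.
have hA : A `<=` [set y | pert x y <> 0] by near: x.
have hsign : forall q, q \in s ->
   (if sgn (q - d) then 0 < pert x (q - d) else pert x (q - d) < 0) /\
   (if sgn (q + d) then 0 < pert x (q + d) else pert x (q + d) < 0) by near: x.
have [phi [p1 p2 p3]] : close (K + 2) (d / 2) m (mx x) by near: x; exact: limF_m.
have pole q w : q \in s -> mx x w <> 0%N -> q - d <= w <= q + d ->
    m q <> 0%N /\ w = phi q.
  move=> qs mw wq; have qK := sK q qs.
  have {}wq : `|w - q| <= d by rewrite ler_distl.
  have wK : `|w| <= K + 2 - 1.
    by have := lerB_dist w q; move: wq qK d1; slra.
  have [p [mp0 pW pw]] := p3 w mw wK.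
  have [pw' _] := p1 p mp0 pW; rewrite pw in pw'.
  have [g1 _ _ _ _] := hgood q qs.
  have [<- //|pq] := eqVneq p q.
  have h1 := g1 p mp0 pq; have h2 := ler_distD w p q; rewrite (distrC p w) in h2.
  by exfalso; move: h1 h2 pw' wq d0; slra.
have bl q : q \in s -> - (kx x)%:R <= q - d.
  by move=> /sK qK; have h2 := ler_norm (- q); rewrite normrN in h2; move: qK h2 kK d1; slra.
have br q : q \in s -> q + d <= (kx x)%:R.
  by move=> /sK qK; have h1 := ler_norm q; move: qK h1 kK d1; slra.
have qd q : q - d < q + d by move: d0; slra.
have atpole q : q \in s -> m q <> 0%N -> mx x (phi q) <> 0%N /\ q - d < phi q < q + d.
  move=> qs mq; have qK : `|q| <= K + 2 by have h := sK q qs; move: h; slra.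
  have [h1 h2] := p1 q mq qK.
  split; first by rewrite h2.
  by apply: ball_itv; apply: lt_trans h1 _; move: d0; slra.
have hv q : q \in s -> forall w, mx x w <> 0%N -> q - d <= w <= q + d -> w = phi q.
  by move=> qs w mw /(pole q w qs mw)[].
have zero q : q \in s -> z0 q <> 0%N -> exists z : R, [/\ q - d < z < q + d, nonpole_zero x z
    & forall u, q - d <= u <= q + d -> nonpole_zero x u -> u = z].
  move=> qs zq; have [s1 s2] := hsign q qs; have [_ _ g3 _ g5] := hgood q qs.
  suff [z [h1 h2 h3]] : exists z : R, [/\ q - d < z < q + d, nonpole_zero x z &
      forall u, q - d <= u <= q + d -> mx x u = 0%N -> pert x u = 0 -> u = z].
    by exists z; split => // u hu [mu fu]; exact: h3.
  apply: (window_zero ha kN hp (bl q qs) (qd q) (br q qs) s1 s2 (hv q qs)).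
  have [mq|/eqP mq] := eqVneq (m q) 0%N; [right|left].
    have /andP[n1 n2] := g5 mq zq; split => // w mw.
    by apply/negP => /(pole q w qs mw)[].
  have [a1 a2] := atpole q qs mq.
  by split => //; exact: g3.
have nozero q : q \in s -> z0 q = 0%N -> forall u, q - d <= u <= q + d -> ~ nonpole_zero x u.
  move=> qs zq u hu [mu fu].
  have [s1 s2] := hsign q qs; have [_ _ _ g4 _] := hgood q qs.
  have mq : m q <> 0%N.
    by move: qs; rewrite mem_cat => /orP[] /mem_atoms[_ //]; rewrite zq.
  have [a1 /andP[a2 a3]] := atpole q qs mq.
  have /andP[n1 n2] := g4 mq zq; rewrite n1 in s1; rewrite (negbTE n2) in s2.
  apply: (pole_no_zero ha hp (bl q qs) a2 a3 (br q qs) (hv q qs) s1 s2 hu _ fu).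
  by move=> up; rewrite up in mu.
have [psi hpsi] : {psi : R -> R & forall q, q \in s -> z0 q <> 0%N ->
    [/\ q - d < psi q < q + d, nonpole_zero x (psi q)
    & forall u, q - d <= u <= q + d -> nonpole_zero x u -> u = psi q]}.
  apply: (@choice _ _ (fun q z => q \in s -> z0 q <> 0%N -> [/\ q - d < z < q + d, nonpole_zero x z
    & forall u, q - d <= u <= q + d -> nonpole_zero x u -> u = z])) => q.
  have [qs|] := boolP (q \in s); last by exists 0.
  have [zq|/eqP zq] := eqVneq (z0 q) 0%N; first by exists 0.
  by have [z hz] := zero q qs zq; exists z.
have WK : W <= K by rewrite /K; slra.
have ins q : z0 q <> 0%N -> `|q| <= W -> q \in s.
  by move=> zq qW; apply: sP; [right|exact: le_trans WK].
exists psi; split.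
- move=> q zq qW; have [h1 h3 _] := hpsi q (ins q zq qW) zq.
  by split => //; apply: lt_trans de; exact: itv_ball.
- move=> q q' zq qW zq' qW' pp; apply: contrapT => /eqP qq'.
  have [/itv_ball h1 _ _] := hpsi q (ins q zq qW) zq.
  have [/itv_ball h2 _ _] := hpsi q' (ins q' zq' qW') zq'.
  have [_ g2 _ _ _] := hgood q' (ins q' zq' qW').
  have h3 := g2 q zq qq'; rewrite -pp in h2; rewrite distrC in h1.
  have h4 := ler_distD (psi q) q q'.
  by move: h1 h2 h3 h4; slra.
(* A zero outside all windows would lie in A, and one in a window whose centre is not an atom of z0
   is excluded by [nozero]. *)
- move=> u zu uW.
  have [q qs uq] : exists2 q, q \in s & `|u - q| < d.
    apply: contrapT => h; case: (zu) => _; apply: hA; split.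
      by move: uW; slra.
    by move=> q qs; rewrite leNgt; apply/negP => h'; apply: h; exists q.
  have huq : q - d <= u <= q + d.
    by have /andP[/ltW -> /ltW ->] := ball_itv uq.
  have zq : z0 q <> 0%N by move=> zq; exact: (nozero q qs zq u huq).
  have [_ _ h3] := hpsi q qs zq.
  exists q; split => //; last by rewrite (h3 u).
  have h4 := lerB_dist q u; rewrite distrC in h4.
  by move: h4 uq uW d1; slra.
Unshelve. all: by end_near. Qed.

Lemma zeros_close : simple z0 -> forall U, nbhs z0 U -> zeros_in m C U.
Proof.
move=> sz U /(nbhs_close sz)[W hW0].
near (0:R)^'+ => e.
have e0 : 0 < e by [].
have e1 : e <= 1 by near: e; exact: nbhs_right_le.
have hW : forall m', close W e z0 m' -> U m' by near: e.
(* The three units are the one lost in the last clause of the matching, the displacement e <= 1 of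
   the zeros, and the one needed by [conf_of_set1]. *)
pose W' := Num.max W 0 + 3.
have WW' : W + 3 <= W' by rewrite /W' lerD2r le_max lexx.
have W'3 : 3 <= W' by rewrite /W' lerDr le_max lexx orbT.
suff h : limF (fun x : index => forall Z : set R,
    (forall u, `|u| <= x.1.1.1%:R -> (Z u <-> x.1.2 u = 0%N /\ pert x u = 0)) ->
    U (conf_of_set Z)) by exact: h.
apply: filterS2 (zeros_stable W' e0) (limF_k W') => x [phi [p1 p2 p3]] kW Z hZ.
apply: hW.
have fin : finite_set (Z `&` [set u | `|u| <= W' - 1]).
  have : finite_set (phi @` [set q | `|q| <= W' /\ z0 q <> 0%N]).
    exact/finite_image/conf_finite.
  apply: sub_finite_set => u [Zu /= uW].
  have [|q [zq qW <-]] := p3 u _ uW; last by exists q.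
  by apply/hZ => //; move: uW kW; slra.
exists phi; split.
- move=> q zq qW; have qW' : `|q| <= W' by move: qW WW'; slra.
  have [h1 h2] := p1 q zq qW'; split => //.
  have pW : `|phi q| <= W + 1 by have := lerB_dist (phi q) q; move: h1 qW e1; slra.
  apply: (conf_of_set1 fin); last by move: pW WW'; slra.
  by apply/hZ => //; move: pW WW' kW; slra.
- move=> q q' zq qW zq' qW'; apply: p2 => //; move: qW qW' WW'; slra.
- move=> u /conf_of_set_neq0 Zu uW.
  have uW' : `|u| <= W' - 1 by move: uW WW'; slra.
  have [|q [zq qW pq]] := p3 u _ uW'.
    by apply/hZ => //; move: uW' kW; slra.
  exists q; split => //.
  have [h1 _] := p1 q zq qW; rewrite pq distrC in h1.
  by have := lerB_dist q u; move: h1 uW e1; slra.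
Unshelve. all: by end_near. Qed.

End stability.

(** * Configurations with convergent principal value sums *)

Section good_configurations.
Context {R : realType}.
Implicit Types (m : conf R) (h : R -> R).

(** With no atom at an integer, the kernel cut at |v| = N is continuous at all atoms. Convergence at
    0 and a bounded sum of 1/v^2 give convergence at every u. *)
Record good m : Prop := Good {
  good_simple : simple m;
  good_nonempty : exists p, m p <> 0%N;
  good_nat : forall n : nat, m n%:R = 0%N /\ m (- n%:R) = 0%N;
  good_cvg : cvgn (fun n => psum m n 0);
  good_bound : exists c, forall n, partial_sum m (fun v => v ^- 2) n <= c }.

Lemma good_tails m e : good m -> 0 < e -> \forall N \near \oo,
  [/\ cvgn (fun n => tsum m N n 0), `|tail m N 0| <= e & forall n, tsum2 m N n <= e].
Proof.
move=> [_ _ _ cm [c hc]] e0.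
set l := limn (fun n => psum m n 0).
pose a n := partial_sum m (fun v => v ^- 2) n.
have a0 v : m v <> 0%N -> 0 <= v ^- 2 by move=> _; rewrite invr_ge0 sqr_ge0.
have na : nondecreasing_seq a by exact: partial_sum_nondecreasing.
have ca : cvgn a by apply: nondecreasing_is_cvgn => //; exists c => _ [n _ <-].
have tN N : (fun n => tsum m N n 0) @ \oo --> l - psum m N 0.
  have h : (fun n => psum m n 0 - psum m N 0) @ \oo --> l - psum m N 0.
    by apply: cvgB => //; exact: cvg_cst.
  apply: cvg_trans h; apply: near_eq_cvg; near=> n.
  have Nn : (N <= n)%N by near: n; exact: nbhs_infty_ge.
  by rewrite (psum_tsum _ _ Nn) [psum m N 0 + _]addrC addrK.
have h1 : \forall N \near \oo, `|l - psum m N 0| <= e by have /cvgrPdist_le := cm; exact.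
have h2 : \forall N \near \oo, `|limn a - a N| <= e by have /cvgrPdist_le := ca; exact.
near=> N; split.
- by apply/cvg_ex; exists (l - psum m N 0).
- by rewrite /tail (cvg_lim _ (tN N))//; near: N.
- have aN : `|limn a - a N| <= e by near: N.
  move=> n; have [nN|Nn] := leqP n N.
    suff -> : tsum2 m N n = 0 by exact: ltW.
    rewrite /tsum2 partial_sum_atoms big_seq big1// => v /mem_atoms[vn _].
    by rewrite ltNge (le_trans vn) ?ler_nat// mulr0.
  have := partial_sum_split m (fun v => v ^- 2) (ltnW Nn); rewrite -/(a n) -/(a N) -/(tsum2 _ _ _).
  have := nondecreasing_cvgn_le na ca n.
  by have := ler_norm (limn a - a N); move: aN; clear; lra.
Unshelve. all: by end_near. Qed.

Lemma good_psum_cvg m u : good m -> (fun n => psum m n u) @ \oo --> stieltjes m u.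
Proof.
move=> gm.
have [N [h1 [h2 h3 h4]]] : exists N, 2 * `|u| <= N%:R /\ [/\ cvgn (fun n => tsum m N n 0),
    `|tail m N 0| <= 1 & forall n, tsum2 m N n <= 1].
  have h := good_tails gm ltr01.
  near \oo => N; exists N; split; last by near: N.
  by near: N; exact: nbhs_infty_ger.
by rewrite (stieltjes_tail h2 h4 h1); exact: psum_cvg h4 _ h1.
Unshelve. all: by end_near. Qed.

Lemma psum_near m N u : simple m -> m N%:R = 0%N -> m (- N%:R) = 0%N -> m u = 0%N ->
  forall e, 0 < e -> nbhs m [set m' : conf R | `|psum m' N u - psum m N u| < e].
Proof.
move=> sm mN mN' mu e e0.
pose g v := if `|v| <= N%:R then (v - u)^-1 else 0.
have vg : vanish (N%:R + 1 - 1) g by rewrite addrK; move=> v; rewrite /g ltNge => /negbTE ->.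
have cg p : m p <> 0%N -> `|p| <= N%:R + 1 -> {for p, continuous g}.
  move=> mp _; have pu : p - u != 0.
    by rewrite subr_eq0; apply: contra_notN mp => /eqP ->.
  have [pN|Np|pN] := ltgtP `|p| N%:R.
  - have h : \forall v \near p, (v - u)^-1 = g v.
      have : \forall v \near p, `|v| < N%:R.
        by have := @norm_continuous _ _ p => /cvgr_lt; apply.
      by apply: filterS => v /ltW vN; rewrite /g vN.
    have gp : g p = (p - u)^-1 by rewrite /g (ltW pN).
    have h' : g v @[v --> p] --> (p - u)^-1.
      apply: cvg_trans (near_eq_cvg h) _.
      by apply: cvgV => //; apply: cvgB; [exact: cvg_id|exact: cvg_cst].
    by rewrite -gp in h'.
  - have h : \forall v \near p, 0 = g v.
      have : \forall v \near p, N%:R < `|v|.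
        by have := @norm_continuous _ _ p => /cvgr_gt; apply.
      by apply: filterS => v vN; rewrite /g leNgt vN.
    have gp : g p = 0 by rewrite /g leNgt Np.
    have h' : g v @[v --> p] --> (0 : R).
      by apply: cvg_trans (near_eq_cvg h) _; exact: cvg_cst.
    by rewrite -gp in h'.
  - exfalso; apply: mp; have [p0|p0] := leP 0 p.
      by rewrite -mN -pN ger0_norm.
    by rewrite -mN' -pN ltr0_norm// opprK.
have h := conf_int_close sm vg cg e0.
near (0:R)^'+ => d.
have hd : forall m', close (N%:R + 1) d m m' -> `|conf_int m' g - conf_int m g| < e by near: d.
have d0 : 0 < d by [].
exact: filterS hd (near_close _ sm d0).
Unshelve. all: by end_near. Qed.

(** For fixed N the truncated sum is vaguely continuous at m; only afterwards does N tend to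
    infinity. *)
Lemma limF_psum m C u e : good m -> m u = 0%N -> 0 < e ->
  \forall x \near limF m C, `|psum x.1.2 x.1.1.2 u - stieltjes m u| < e.
Proof.
move=> gm mu e0; have e2 : 0 < e / 2 by lra.
change (\forall k \near \oo, \forall N \near \oo, nbhs m [set m' : conf R |
  forall h, adm k%:R h -> C k h -> `|psum m' N u - stieltjes m u| < e]).
apply: nearW => k.
have h1 : \forall N \near \oo, `|stieltjes m u - psum m N u| < e / 2.
  by have /cvgrPdist_lt := good_psum_cvg (u := u) gm; exact.
apply: filterS h1 => N hN.
have [n1 n2] := good_nat gm N.
have h2 := psum_near (good_simple gm) n1 n2 mu e2.
apply: filterS h2 => m' hm' h _ _.
have := ler_distD (psum m N u) (psum m' N u) (stieltjes m u).
by rewrite distrC in hN; move: hN hm' => /=; clear; lra.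
Qed.

End good_configurations.

(** * Limiting zeros in the three regimes *)

Section limits.
Context {R : realType}.
Implicit Types (m : conf R) (h : R -> R).

(** Each point has a punctured ball without points of Z; a finite cover of [-W, W] by such balls
    confines Z to their centres. *)
Lemma locally_finite (Z : set R) :
  (forall q, \forall e \near (0:R)^'+, ~ Z (q - e) /\ ~ Z (q + e)) ->
  forall W, finite_set (Z `&` [set u | `|u| <= W]).
Proof.
move=> hZ W.
have [d hd] : {d : R -> R & forall q, 0 < d q /\ forall u, 0 < `|u - q| < d q -> ~ Z u}.
  apply: (@choice _ _ (fun q d => 0 < d /\ forall u, 0 < `|u - q| < d -> ~ Z u)) => q.
  have [d /= d0 hd] := hZ q; exists d; split => // u /andP[u0 ud].
  have [h1 h2] : ~ Z (q - `|u - q|) /\ ~ Z (q + `|u - q|).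
    by apply: hd => //=; rewrite sub0r normrN normr_id.
  have [qu|uq] := leP q u.
    by move: h2; rewrite ger0_norm ?subr_ge0// addrC subrK.
  by move: h1; rewrite ltr0_norm ?subr_lt0// opprK addrC subrK.
have := @segment_compact R (- W) W; rewrite compact_cover => hc.
have [||D _ hD] := hc R setT (fun q => ball q (d q)).
- by move=> q _; apply: ball_open; case: (hd q).
- move=> u _; exists u => //; apply: ballxx; case: (hd u) => //.
apply: sub_finite_set (finite_fset D) => u [Zu /= uW].
have [|q qD] := hD u; first by rewrite /= in_itv/= -ler_norml.
rewrite /ball/= => uq; have [d0 /(_ u) hu] := hd q.
have [-> //|nuq] := eqVneq u q.
exfalso; apply: hu => //; rewrite normr_gt0 subr_eq0 nuq/= distrC; exact: uq.
Qed.

(** On a bounded window the complete sum is itself a truncated sum with an admissible perturbation,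
    so the analysis between poles applies to the limit too. *)
Lemma good_perturbed m b K : good m -> exists N h,
  [/\ adm K h, K <= N%:R, exists p, m p <> 0%N /\ `|p| <= N%:R
    & forall u, `|u| <= K -> stieltjes m u + b = psum m N u + h u].
Proof.
move=> gm; have [p mp] := good_nonempty gm.
have ht := good_tails gm ltr01.
near \oo => N.
have [h2 h3 h4] : [/\ cvgn (fun n => tsum m N n 0), `|tail m N 0| <= 1 & forall n, tsum2 m N n <= 1].
  by near: N.
have NK : 2 * K <= N%:R by near: N; exact: nbhs_infty_ger.
have Np : `|p| <= N%:R by near: N; exact: nbhs_infty_ger.
have N0 : 0 <= N%:R :> R by [].
have [ca ma] := tail_adm h2 h4 NK.
exists N, (fun u => tail m N u + b); split.
- split; last by move=> x y xK yK xy; rewrite lerD2r; exact: ma.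
  by move=> x; apply: cvgD; [exact: ca|exact: cvg_cst].
- by move: NK N0; clear; lra.
- by exists p.
- move=> u uK; rewrite (stieltjes_tail h2 h4) ?addrA//.
  by move: uK NK; clear; lra.
Unshelve. all: by end_near. Qed.

Section level.
Variables (m : conf R) (b : R).
Hypothesis gm : good m.
Let f u := stieltjes m u + b.

Ltac qlra := clear - R m b gm f; lra.

Lemma level_continuous u : m u = 0%N -> {for u, continuous f}.
Proof.
move=> mu; have [N [h [[ca ma] KN hp fE]]] := good_perturbed b (`|u| + 1) gm.
have uK : - (`|u| + 1) < `|u| + 1.
  by have : 0 <= `|u| by []; qlra.
have [/(_ u) ch _ _] := (continuous_within_itvP _ uK).1 ca.
have uin : u \in `](- (`|u| + 1)), (`|u| + 1)[.
  by rewrite in_itv/= -ltr_norml ltrDl.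
have hn : \forall v \near u, psum m N v + h v = f v.
  have : \forall v \near u, `|v| < `|u| + 1.
    have := @norm_continuous _ _ u => /cvgr_lt; apply.
    by rewrite ltrDl.
  by apply: filterS => v /ltW /fE; rewrite /f => ->.
have h' : f v @[v --> u] --> psum m N u + h u.
  apply: cvg_trans (near_eq_cvg hn) _.
  by apply: cvgD; [exact: psum_continuous|exact: ch].
by rewrite -fE ?lerDl// in h'.
Qed.

Lemma near_sides (Q : set R) u : (\forall v \near u, Q v) ->
  \forall e \near (0:R)^'+, Q (u - e) /\ Q (u + e).
Proof.
move=> [d /= d0 hd]; near=> e.
have ed : `|e| < d by rewrite gtr0_norm//; near: e; exact: nbhs_right_lt.
split; apply: hd => /=; first by rewrite opprB addrC subrK.
by rewrite opprD addrA subrr sub0r normrN.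
Unshelve. all: by end_near. Qed.

Lemma level_pos u : m u = 0%N -> 0 < f u ->
  \forall e \near (0:R)^'+, 0 < f (u - e) /\ 0 < f (u + e).
Proof.
move=> mu fu; apply: (@near_sides [set v | 0 < f v]).
by have := level_continuous mu => /cvgr_gt; apply.
Qed.

Lemma level_neg u : m u = 0%N -> f u < 0 ->
  \forall e \near (0:R)^'+, f (u - e) < 0 /\ f (u + e) < 0.
Proof.
move=> mu fu; apply: (@near_sides [set v | f v < 0]).
by have := level_continuous mu => /cvgr_lt; apply.
Qed.

Lemma level_zero q : m q = 0%N -> f q = 0 ->
  \forall e \near (0:R)^'+, f (q - e) < 0 /\ 0 < f (q + e).
Proof.
move=> mq fq; have [N [h [ha KN hp fE]]] := good_perturbed b (`|q| + 1) gm.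
have hi0 := isolated m q.
near=> e.
have e0 : 0 < e by [].
have e1 : e <= 1 by near: e; exact: nbhs_right_le.
have hi : forall x, m x <> 0%N -> x != q -> 2 * e < `|x - q| by near: e.
have free w : m w <> 0%N -> ~~ (q - e <= w <= q + e).
  move=> mw; apply/negP; rewrite -ler_distl => wq.
  have wnq : w != q by apply/eqP => ew; rewrite ew in mw.
  by have := hi w mw wnq; move: wq e0; qlra.
have q1 := ler_norm q; have q2 := ler_norm (- q); rewrite normrN in q2.
have bl : - (`|q| + 1) <= q - e by move: q2 e1; qlra.
have br : q + e <= `|q| + 1 by move: q1 e1; qlra.
have il : q - e < q by move: e0; qlra.
have ir : q < q + e by move: e0; qlra.
have h1 : `|q - e| <= `|q| + 1.
  by rewrite ler_norml bl/= (le_trans (ltW il)) ?(le_trans (ltW ir)).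
have h2 : `|q + e| <= `|q| + 1.
  by rewrite ler_norml br andbT (le_trans bl)// ltW// (lt_trans il).
have h3 : `|q| <= `|q| + 1 by rewrite lerDl.
rewrite -fq /f !fE//; split.
  apply: (perturbed_lt ha hp) => //; first by rewrite (le_trans (ltW ir)).
  move=> w mw; apply: contra (free w mw) => /andP[-> h4] /=.
  by rewrite (le_trans h4)// ltW.
apply: (perturbed_lt ha hp) => //; first by rewrite (le_trans bl)// ltW.
move=> w mw; apply: contra (free w mw) => /andP[h4 ->]; rewrite andbT.
by rewrite (le_trans _ h4)// ltW.
Unshelve. all: by end_near. Qed.

Lemma level_pole q : m q <> 0%N ->
  \forall e \near (0:R)^'+, 0 < f (q - e) /\ f (q + e) < 0.
Proof.
move=> mq; have [N [h [ha KN hp fE]]] := good_perturbed b (`|q| + 1) gm.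
have hi0 := isolated m q.
near (0:R)^'+ => d.
have d0 : 0 < d by [].
have d1 : d <= 1 by near: d; exact: nbhs_right_le.
have hi : forall x, m x <> 0%N -> x != q -> 2 * d < `|x - q| by near: d.
have only w : m w <> 0%N -> q - d <= w <= q + d -> w = q.
  move=> mw; rewrite -ler_distl => wq; apply: contrapT => /eqP wnq.
  by have := hi w mw wnq; move: wq d0; qlra.
have q1 := ler_norm q; have q2 := ler_norm (- q); rewrite normrN in q2.
have il : q - d < q by move: d0; qlra.
have ir : q < q + d by move: d0; qlra.
have bl : - (`|q| + 1) <= q - d by move: q2 d1; qlra.
have br : q + d <= `|q| + 1 by move: q1 d1; qlra.
have inK x : q - d <= x <= q + d -> `|x| <= `|q| + 1.
  by move=> /andP[h1 h2]; rewrite ler_norml (le_trans bl)//= (le_trans h2).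
have [x /andP[x1 x2] fx] := pole_left ha KN bl il ir br mq only.
have [y /andP[y1 y2] fy] := pole_right ha KN bl il ir br mq only.
near=> e.
have e0 : 0 < e by [].
have ex : e < q - x by near: e; apply: nbhs_right_lt; rewrite subr_gt0.
have ey : e < y - q by near: e; apply: nbhs_right_lt; rewrite subr_gt0.
have xe : x < q - e by move: ex; qlra.
have ye : q + e < y by move: ey; qlra.
have eq1 : q - e < q by move: e0; qlra.
have eq2 : q < q + e by move: e0; qlra.
have eK : `|q - e| <= `|q| + 1.
  by apply: inK; rewrite (ltW (lt_trans x1 xe)) (ltW (lt_trans eq1 ir)).
have eK' : `|q + e| <= `|q| + 1.
  by apply: inK; rewrite (ltW (lt_trans ye y2)) (ltW (lt_trans il eq2)).
rewrite /f !fE//; split.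
  apply: lt_le_trans fx _.
  exact: (before_pole ha hp bl ir br only (ltW x1) (ltW xe) eq1).
apply: le_lt_trans fy.
exact: (after_pole ha hp bl il br only eq2 (ltW ye) (ltW y2)).
Unshelve. all: by end_near. Qed.

Definition level_set : set R := [set u | ~ supp m u /\ stieltjes m u = - b].

Lemma supp0 u : ~ supp m u -> m u = 0%N.
Proof. by move=> h; apply: contrapT. Qed.

(** [conf_of_set] drops no point of the level set: at a pole, a zero or any other point, f has a
    strict sign on each side close by, which prevents accumulation. *)
Lemma level_conf u : conf_of_set level_set u <> 0%N <-> m u = 0%N /\ f u = 0.
Proof.
split.
  move=> /conf_of_set_neq0 [/supp0 mu su]; split => //.
  by rewrite /f su addrC subrr.
move=> [mu fu]; have lu : level_set u.
  split; first by rewrite /supp/= => h; exact: h mu.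
  by move: fu; rewrite /f => /eqP; rewrite addr_eq0 => /eqP.
rewrite (@conf_of_set1 _ _ (`|u| + 1))//.
apply: locally_finite => q.
have lf v : level_set v -> f v = 0 by move=> [_ sv]; rewrite /f sv addrC subrr.
suff : \forall e \near (0:R)^'+, f (q - e) != 0 /\ f (q + e) != 0.
  by apply: filterS => e [/eqP h1 /eqP h2]; split => /lf.
have [mq|/eqP mq] := eqVneq (m q) 0%N; last first.
  by have := level_pole mq; apply: filterS => e [h1 h2]; rewrite gt_eqF// lt_eqF.
have [fq|fq|fq] := ltgtP (f q) 0.
- by have := level_neg mq fq; apply: filterS => e [h1 h2]; rewrite !lt_eqF.
- by have := level_pos mq fq; apply: filterS => e [h1 h2]; rewrite !gt_eqF.
- by have := level_zero mq fq; apply: filterS => e [h1 h2]; rewrite lt_eqF// gt_eqF.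
Qed.

Definition near_cst (k : nat) h := forall u, `|u| <= k%:R -> `|h u - b| <= k.+1%:R^-1.

Lemma level_zeros_close U : nbhs (conf_of_set level_set) U -> zeros_in m near_cst U.
Proof.
apply: (@zeros_close _ m near_cst _ (fun u => 0 < f u)).
- exact: good_simple gm.
- exact: good_nonempty gm.
- move=> u mu zu; have fu : f u != 0.
    by apply/eqP => fu; apply: (iffRL (level_conf u)) zu.
  have e0 : 0 < `|f u| / 2 by rewrite divr_gt0// normr_gt0.
  have h1 := limF_psum near_cst gm mu e0.
  (* Such a k brings u into the window and the accuracy 1/(k+1) below |f u|/2; together with the
     error of [h1] it cannot reverse the sign of f u. *)
  have h2 := limF_k m near_cst (`|u| + (`|f u| / 2)^-1).
  have FF := limF_filter m near_cst.
  apply: filterS3 h1 h2 (limF_adm m near_cst) => x x1 x2 [_ /(_ u) x3].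
  have i0 : 0 < (`|f u| / 2)^-1 by rewrite invr_gt0.
  have {}x3 : `|x.2 u - b| <= x.1.1.1.+1%:R^-1.
    by apply: x3; move: x2 i0; qlra.
  have x4 : x.1.1.1.+1%:R^-1 <= `|f u| / 2.
    rewrite -[leRHS]invrK lef_pV2 ?posrE//.
    apply: (@le_trans _ _ x.1.1.1%:R); last by rewrite ler_nat.
    by apply: le_trans x2; rewrite lerDr.
  rewrite /pert; move/ltr_normlP : x1 => [y1 y2].
  move: (le_trans x3 x4) => /ler_normlP[y3 y4].
  case: ltP => fu0.
    by move: y1 y2 y3 y4; rewrite (gtr0_norm fu0) /f; qlra.
  have fu1 : f u < 0 by rewrite lt_neqAle fu fu0.
  by move: y1 y2 y3 y4; rewrite (ltr0_norm fu1) /f; qlra.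
- move=> u mu zu; have fu : f u != 0.
    by apply/eqP => fu; apply: (iffRL (level_conf u)) zu.
  have [fu0|fu0|fu0] := ltgtP (f u) 0; last by rewrite fu0 eqxx in fu.
    have := level_neg mu fu0; apply: filterS => e [h1 h2].
    by rewrite !ltNge (ltW h1) (ltW h2).
  by have := level_pos mu fu0; apply: filterS => e [-> ->].
- by move=> q mq /level_conf[].
- move=> q mq _; have := level_pole mq; apply: filterS => e [-> h2].
  by rewrite ltNge (ltW h2).
- move=> q mq /level_conf[_ fq]; have := level_zero mq fq.
  by apply: filterS => e [h1 ->]; rewrite ltNge (ltW h1).
- exact: conf_of_set_simple.
Qed.

Definition near_infty (s : R) (k : nat) h := forall u, `|u| <= k%:R -> k%:R < s * h u.

(** The limiting sign is constant: a large perturbation can only be balanced next to a pole, so each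
    zero is driven to an atom, from the right if s = 1 and from the left if s = -1. *)
Lemma infty_zeros_close (s : R) U : s = 1 \/ s = - 1 -> nbhs m U -> zeros_in m (near_infty s) U.
Proof.
move=> s1; apply: (@zeros_close _ m (near_infty s) _ (fun u => 0 < s)).
- exact: good_simple gm.
- exact: good_nonempty gm.
- move=> u mu _.
  have h1 := limF_psum (near_infty s) gm mu ltr01.
  have h2 := limF_k m (near_infty s) (`|u| + `|stieltjes m u| + 1).
  have FF := limF_filter m (near_infty s).
  apply: filterS3 h1 h2 (limF_adm m (near_infty s)) => x x1 x2 [_ /(_ u) x3].
  have S0 : 0 <= `|stieltjes m u| by [].
  have u0 : 0 <= `|u| by [].
  have {}x3 : x.1.1.1%:R < s * x.2 u.
    by apply: x3; move: x2 S0; qlra.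
  have y5 := ler_norm (stieltjes m u); have y6 := ler_norm (- stieltjes m u).
  rewrite normrN in y6.
  rewrite /pert; move/ltr_normlP : x1 => [y1 y2].
  case: s1 x3 => ->; rewrite ?mulN1r ?mul1r => x3.
    by rewrite ltr01; move: x2 x3 y1 y2 y5 y6 u0; qlra.
  by rewrite ltr0N1; move: x2 x3 y1 y2 y5 y6 u0; qlra.
- by move=> *; apply: nearW.
- by move=> *; apply: nearW.
- by move=> q mq /mq.
- by move=> q mq /(_ mq).
- exact: good_simple gm.
Qed.

(** Distance and height of the transition are both tied to k; the monotonicity of h spreads the two
    values to the points beyond them. *)
Definition near_trans (tau : R) (k : nat) h :=
  k%:R < h (tau + k.+1%:R^-1) /\ h (tau - k.+1%:R^-1) < - k%:R.

Lemma trans_conf (tau : R) u :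
  conf_of_set (supp m `|` [set tau]) u <> 0%N <-> m u <> 0%N \/ u = tau.
Proof.
split; first by move=> /conf_of_set_neq0.
move=> hu; rewrite (@conf_of_set1 _ _ (`|u| + 1))//.
rewrite setIUl finite_setU; split.
  by apply: sub_finite_set (conf_finite m (`|u| + 1)) => v [].
by apply: sub_finite_set (finite_set1 tau) => v [].
Qed.

(** The limiting sign is that of u - tau. It changes at [tau], which becomes a zero without pole,
    and is locally constant at the atoms, none of which is [tau]. *)
Lemma trans_zeros_close (tau : R) U : m tau = 0%N ->
  nbhs (conf_of_set (supp m `|` [set tau])) U -> zeros_in m (near_trans tau) U.
Proof.
have side (u : R) : u != tau -> \forall e \near (0:R)^'+, (tau < u - e) = (tau < u + e).
  rewrite neq_lt => /orP[ut|ut].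
    have := @near_sides [set v | v < tau] u (lt_nbhsl ut).
    by apply: filterS => e [/= h1 h2]; rewrite !ltNge !ltW.
  have := @near_sides [set v | tau < v] u (lt_nbhsr ut).
  by apply: filterS => e [/= -> ->].
move=> mt; apply: (@zeros_close _ m (near_trans tau) _ (fun u => tau < u)).
- exact: good_simple gm.
- exact: good_nonempty gm.
- move=> u mu zu; have ut : u != tau.
    by apply/eqP => ut; apply: (iffRL (trans_conf tau u)) zu; right.
  have d0 : 0 < `|u - tau| by rewrite normr_gt0 subr_eq0.
  have h1 := limF_psum (near_trans tau) gm mu ltr01.
  have h2 := limF_k m (near_trans tau) (`|u| + `|tau| + `|stieltjes m u| + 1 + (`|u - tau|)^-1).
  have FF := limF_filter m (near_trans tau).
  apply: filterS3 h1 h2 (limF_adm m (near_trans tau)) => x x1 x2 [[_ hm] [x3 x4]].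
  have S0 : 0 <= `|stieltjes m u| by [].
  have u0 : 0 <= `|u| by [].
  have t0 : 0 <= `|tau| by [].
  have i0 : 0 < (`|u - tau|)^-1 by rewrite invr_gt0.
  have y5 := ler_norm (stieltjes m u); have y6 := ler_norm (- stieltjes m u).
  rewrite normrN in y6.
  set k : R := x.1.1.1%:R in x2 x3 x4 hm.
  have k1 : x.1.1.1.+1%:R^-1 <= 1 :> R by rewrite invf_le1// ler1n.
  have k0 : 0 <= x.1.1.1.+1%:R^-1 :> R by rewrite invr_ge0.
  have kd : x.1.1.1.+1%:R^-1 <= `|u - tau|.
    rewrite -[leRHS]invrK lef_pV2 ?posrE//.
    apply: (@le_trans _ _ k); last by rewrite /k ler_nat.
    by move: x2 u0 S0 t0; qlra.
  set r : R := x.1.1.1.+1%:R^-1 in x3 x4 k1 k0 kd.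
  have inK v : `|v| <= `|u| + `|tau| + 1 -> v \in `[- k, k].
    by move=> hv; rewrite in_itv/= -ler_norml; move: hv x2 S0 i0; qlra.
  have inu : u \in `[- k, k] by apply: inK; move: t0; qlra.
  have inr : tau + r \in `[- k, k].
    by apply: inK; have := ler_normD tau r; rewrite (ger0_norm k0); move: u0 k1; qlra.
  have inl : tau - r \in `[- k, k].
    by apply: inK; have := ler_normB tau r; rewrite (ger0_norm k0); move: u0 k1; qlra.
  rewrite /pert; move/ltr_normlP : x1 => [y1 y2].
  case: ltP => tu.
    rewrite gtr0_norm ?subr_gt0// in kd.
    have tr : tau + r <= u by move: kd; qlra.
    have := hm _ _ inr inu tr.
    by move: x2 x3 y1 y2 y5 y6 u0 t0 i0; qlra.
  rewrite ler0_norm ?subr_le0// in kd.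
  have tr : u <= tau - r by move: kd; qlra.
  have := hm _ _ inu inl tr.
  by move: x2 x4 y1 y2 y5 y6 u0 t0 i0; qlra.
- move=> u mu zu; apply: side.
  by apply/eqP => ut; apply: (iffRL (trans_conf tau u)) zu; right.
- by move=> q mq _; apply: side; apply/eqP => qt; rewrite qt in mq.
- by move=> q mq zq; exfalso; apply: (iffRL (trans_conf tau q)) zq; left.
- move=> q mq /trans_conf[//|->]; near=> e.
  have e0 : 0 < e by [].
  by rewrite -leNgt; apply/andP; split; move: e0; qlra.
- exact: conf_of_set_simple.
Unshelve. all: by end_near. Qed.

End level.
End limits.

(** * Poisson configurations *)

Section full_events.
Context {R : realType} {d : measure_display} {T : measurableType d}.
Variable P : probability T R.

Definition full (A : set T) := exists G, [/\ measurable G, pr P G = 1 & G `<=` A].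

Lemma full_sub A B : A `<=` B -> full A -> full B.
Proof. by move=> AB [G [mG G1 GA]]; exists G; split => // t /GA /AB. Qed.

(** This is how a Borel-Cantelli argument ends: with exceptional events of arbitrarily small
    probability. *)
Lemma full_small (A : set T) : (forall e, 0 < e -> exists E : set T,
    [/\ measurable E, pr P E <= e & ~` E `<=` A]) -> full A.
Proof.
move=> h.
have [E hE] := choice (fun k : nat => h k.+1%:R^-1 ltac:(by rewrite invr_gt0)).
have mE k : measurable (~` E k) by apply: measurableC; case: (hE k).
have mU : measurable (\bigcup_k ~` E k) by exact: bigcupT_measurable.
exists (\bigcup_k ~` E k); split => //; last by move=> t [k _]; case: (hE k) => _ _; apply.
apply/eqP; rewrite eq_le pr_le1//=.
apply/ler_addgt0Pr => e e0.
have [k _ /(_ k (leqnn _)) hk] := near_infty_natSinv_lt (PosNum e0).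
have [m1 m2 _] := hE k.
have : pr P (~` E k) <= pr P (\bigcup_k ~` E k).
  by apply: pr_le => // t ht; exists k.
have hk' : k.+1%:R^-1 < e := hk.
have h3 := le_lt_trans m2 hk'.
by rewrite prC//; move: h3; clear; lra.
Qed.

Lemma fullP A : full A <-> P.-negligible (~` A).
Proof.
split.
  move=> [G [mG G1 GA]]; exists (~` G); split; [exact: measurableC| |exact: subsetC].
  by rewrite prE ?prC ?G1 ?subrr//; exact: measurableC.
move=> [B [mB B0 AB]]; exists (~` B); split; first exact: measurableC.
  by rewrite prC// /pr B0 subr0.
by move=> t nB; apply: contrapT => nA; apply: nB; exact: AB.
Qed.

Lemma full_bigcap (A : (set T)^nat) : (forall n, full (A n)) -> full (\bigcap_n A n).
Proof.
move=> hA; apply/fullP; rewrite setC_bigcap; apply: negligible_bigcup => n.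
exact/fullP.
Qed.

Lemma fullI A B : full A -> full B -> full (A `&` B).
Proof.
move=> fA fB; apply: full_sub (full_bigcap (A := fun n => if n is 0%N then A else B) _).
  by move=> t h; split; [exact: (h 0%N)|exact: (h 1%N)].
by case.
Qed.

Lemma prU_ord n (F : nat -> set T) (b : nat -> R) : (forall i, measurable (F i)) ->
  (forall i, pr P (F i) <= b i) -> pr P (\bigcup_(i < n) F i) <= \sum_(i < n) b i.
Proof.
move=> mF hb; elim: n => [|n ih].
  by rewrite bigcup_mkord !big_ord0 /pr measure0.
have -> : \bigcup_(i < n.+1) F i = (\bigcup_(i < n) F i) `|` F n.
  by rewrite !bigcup_mkord big_ord_recr.
rewrite big_ord_recr/=; have mU : measurable (\bigcup_(i < n) F i).
  by apply: bigcup_measurable => k _.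
by apply: le_trans (prU P mU (mF n)) _; exact: lerD.
Qed.

Lemma prU_bound (F : nat -> set T) (b : nat -> R) c : (forall i, measurable (F i)) ->
  (forall i, pr P (F i) <= b i) -> (forall n, \sum_(i < n) b i <= c) ->
  pr P (\bigcup_i F i) <= c.
Proof.
move=> mF hb hc; pose G n := \bigcup_(i < n) F i.
have mG n : measurable (G n) by apply: bigcup_measurable => k _.
have -> : \bigcup_i F i = \bigcup_n G n.
  apply/seteqP; split => t; first by move=> [n _ Ft]; exists n.+1 => //; exists n => /=.
  by move=> [n _ [i _ Ft]]; exists i.
apply/ler_addgt0Pr => e e0.
have nG : nondecreasing_seq G.
  move=> n n' nn'; apply/subsetPset; apply: bigcup_subset => i /= h.
  exact: leq_trans nn'.
have [n _ /(_ n (leqnn _)) /= h] := pr_bigcup P mG nG e0.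
by apply: le_trans h _; rewrite lerD2r (le_trans (prU_ord n mF hb)).
Qed.

End full_events.

Section poisson.
Context {R : realType} {d : measure_display} {T : measurableType d}.
Variables (P : probability T R) (X : T -> conf R).
Hypothesis hX : standard_poisson P X.

Let N B t := Defs.count (X t) B.
Let len (B : set R) : R := fine (lebesgue_measure B).

Lemma measurable_count_eq B k : bounded_borel B -> measurable [set t | N B t = k%:R].
Proof.
move=> bB; have [hp _ _] := hX.
have -> : [set t | N B t = k%:R] = setT `&` N B @^-1` [set k%:R].
  by apply/seteqP; split => t //= [].
exact: hp.
Qed.

Lemma count_nat (m : conf R) (B : set R) (W : R) : (forall v, B v -> `|v| <= W) ->
  exists k : nat, Defs.count m B = k%:R.
Proof.
move=> BW; exists (\sum_(v <- atoms m W) m v * (v \in B))%N.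
rewrite /Defs.count (@conf_int_atoms _ _ W).
  by rewrite natr_sum; apply: eq_bigr => v _; rewrite natrM indicE.
by move=> v Wv; rewrite indicE memNset// => /BW; rewrite leNgt Wv.
Qed.

Lemma exp_partial_le n (x : R) : 0 <= x -> \sum_(i < n) x ^+ i / i`!%:R <= expR x.
Proof.
move=> x0; have h : nondecreasing_seq (series (exp_coeff x)).
  apply/nondecreasing_seqP => k; rewrite seriesSr lerDl.
  by rewrite /exp_coeff /= divr_ge0// exprn_ge0.
have := nondecreasing_cvgn_le h (@is_cvg_series_exp_coeff _ x) n.
by rewrite /series /= big_mkord.
Qed.

(** Markov's inequality for c x^n, with n the number of points in B: under the Poisson law its mean
    is c exp(len B (x - 1)). It is obtained by summing the probabilities of the single values. *)
Lemma poisson_tail B (J : set nat) c x : bounded_borel B -> 0 <= c -> 0 <= x ->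
  (forall j, J j -> 1 <= c * x ^+ j) ->
  let E := [set t | exists2 j, J j & N B t = j%:R] in
  measurable E /\ pr P E <= c * expR (len B * (x - 1)).
Proof.
move=> bB c0 x0 hJ E; have [_ hp _] := hX.
pose F j := [set t | J j /\ N B t = j%:R].
have mF j : measurable (F j).
  have [Jj|nJ] := pselect (J j).
    have -> : F j = [set t | N B t = j%:R] by apply/seteqP; split => t // [].
    exact: measurable_count_eq.
  by have -> : F j = set0 by rewrite -subset0 => t [].
have EF : E = \bigcup_j F j.
  apply/seteqP; split => t; first by move=> [j Jj h]; exists j.
  by move=> [j _ [Jj h]]; exists j.
have r0 : 0 <= len B by rewrite /len fine_ge0.
pose b j := c * expR (- len B) * ((len B * x) ^+ j / j`!%:R).
have hb j : pr P (F j) <= b j.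
  have [Jj|nJ] := pselect (J j); last first.
    have -> : F j = set0 by rewrite -subset0 => t [].
    rewrite /pr measure0 /b; apply: mulr_ge0; first by rewrite mulr_ge0 ?expR_ge0.
    by apply: divr_ge0 => //; apply: exprn_ge0; exact: mulr_ge0.
  have -> : F j = [set t | N B t = j%:R] by apply/seteqP; split => t // [].
  rewrite /pr hp//= -/(len B) /b exprMn.
  have -> : c * expR (- len B) * (len B ^+ j * x ^+ j / j`!%:R) =
    (c * x ^+ j) * (expR (- len B) * len B ^+ j / j`!%:R) by ring.
  rewrite ler_peMl ?hJ// divr_ge0// mulr_ge0 ?expR_ge0// exprn_ge0//.
split; first by rewrite EF; exact: bigcupT_measurable.
rewrite EF; apply: (prU_bound mF hb) => n.
rewrite -mulr_sumr mulrBr mulr1 addrC expRD mulrA ler_wpM2l ?mulr_ge0 ?expR_ge0//.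
by apply: exp_partial_le; rewrite mulr_ge0.
Qed.

(** The constant c is x^-j0, with x > 1 for upper and x < 1 for lower deviations; s stands for an
    upper bound of -ln x. *)
Lemma poisson_chernoff B (J : set nat) j0 x s : bounded_borel B -> 0 < x ->
  x^-1 <= expR s -> (forall j, J j -> 1 <= x^-1 ^+ j0 * x ^+ j) ->
  let E := [set t | exists2 j, J j & N B t = j%:R] in
  measurable E /\ pr P E <= expR (s * j0%:R + len B * (x - 1)).
Proof.
move=> bB x0 xs hJ E; have xV : 0 <= x^-1 by rewrite invr_ge0 ltW.
have [mE pE] := poisson_tail bB (exprn_ge0 j0 xV) (ltW x0) hJ.
split => //; apply: le_trans pE _; rewrite expRD ler_wpM2r ?expR_ge0// expRM_natr.
by apply: lerXn2r xs; rewrite nnegrE ?expR_ge0.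
Qed.

Lemma bounded_borel_itv (a b : R) (x y : bool) :
  bounded_borel [set` Interval (BSide x a) (BSide y b)].
Proof.
split; first exact: measurable_itv.
exists (`|a| + `|b|) => v /= /itv_dec h.
have [h1 h2] : a <= v /\ v <= b.
  by move: h; case: x; case: y => /= -[? ?]; split => //; exact: ltW.
rewrite in_itv/=; have := ler_norm (- a); have := ler_norm b; rewrite normrN.
have : 0 <= `|a| by []. have : 0 <= `|b| by [].
move=> ? ? ? ?; apply/andP; split; lra.
Qed.

Lemma poisson_no_atom x : full P [set t | X t x = 0%N].
Proof.
have [_ hp _] := hX.
have bB : bounded_borel [set x] by rewrite -set_itv1; exact: bounded_borel_itv.
exists [set t | N [set x] t = 0%:R]; split.
- exact: measurable_count_eq.
- by rewrite /pr hp//= lebesgue_measure_set1/= oppr0 expR0 expr0 mulr1 divr1.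
- move=> t /=; rewrite /N /Defs.count (@conf_int_seq _ _ _ [:: x])//.
    rewrite big_seq1 indicE mem_set//= mulr1 => /eqP; rewrite pnatr_eq0 => /eqP //.
  by move=> v _; rewrite indicE inE; case: (boolP (v \in _)) => [/set_mem -> //|]; rewrite eqxx.
Qed.

Lemma count_atom (m : conf R) (B : set R) (W : R) v : (forall v, B v -> `|v| <= W) -> B v ->
  (m v)%:R <= Defs.count m B.
Proof.
move=> BW Bv; have [->|/eqP mv] := eqVneq (m v) 0%N.
  by apply: conf_int_ge0 => w _; rewrite indicE.
have := @conf_int_ge1 R m W (\1_B) v _ _ mv; rewrite indicE mem_set// mulr1; apply.
  by move=> w Ww; rewrite indicE memNset// => /BW; rewrite leNgt Ww.
by move=> w _; rewrite indicE.
Qed.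

(** A multiple point with |v| < n puts two points in one of 2n(j+1) cells of length r = 1/(j+1).
    Taking x = 1/r and c = r^2 in [poisson_tail], this has probability at most r^2 exp(1) for each
    cell, hence 2n r exp(1) in all. *)
Lemma poisson_simple : full P [set t | simple (X t)].
Proof.
suff h (n : nat) : full P [set t | forall v, `|v| < n%:R -> (X t v <= 1)%N].
  apply: full_sub (full_bigcap h) => t ht v.
  have [n nv] := filter_ex (nbhs_infty_gtr `|v|).
  exact: (ht n).
apply: full_small => e e0.
pose K := (2 * n)%N.
have [j hj] : exists j : nat, K%:R * expR 1 * j.+1%:R^-1 <= e.
  have c0 : 0 < K%:R * expR 1 + 1 :> R by rewrite ltr_wpDl// mulr_ge0 ?expR_ge0.
  have ec : 0 < e / (K%:R * expR 1 + 1) by rewrite divr_gt0.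
  have [j _ /(_ j (leqnn _)) /= hj] := near_infty_natSinv_lt (PosNum ec).
  exists j; move: hj; rewrite ltr_pdivlMr// => hj.
  apply: le_trans (ltW hj); rewrite mulrC ler_wpM2l ?invr_ge0// lerDl//.
pose r : R := j.+1%:R^-1.
have r0 : 0 < r by rewrite invr_gt0.
have r1 : r <= 1 by rewrite invf_le1// ler1n.
pose I (i : nat) : set R := `[- n%:R + i%:R * r, - n%:R + i.+1%:R * r[%classic.
have bI i : bounded_borel (I i) by exact: bounded_borel_itv.
have lI i : len (I i) = r.
  rewrite /len lebesgue_measure_itv/= lte_fin ltrD2l ltr_pM2r// ltr_nat ltnSn/=.
  by rewrite -natr1; ring.
pose J : set nat := [set k | (2 <= k)%N].
have hJ k : J k -> 1 <= r ^+ 2 * r^-1 ^+ k.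
  move=> k2; rewrite -(subnK k2) exprD mulrCA -exprMn mulfV ?gt_eqF// expr1n mulr1.
  by rewrite exprn_ege1// invf_ge1.
pose E i := [set t | exists2 k, J k & N (I i) t = k%:R].
have r20 : 0 <= r ^+ 2 by exact: sqr_ge0.
have ri0 : 0 <= r^-1 by rewrite invr_ge0 ltW.
have hE i : measurable (E i) /\ pr P (E i) <= r ^+ 2 * expR 1.
  have [h1 h2] := poisson_tail (bI i) r20 ri0 hJ.
  split => //; apply: le_trans h2 _; rewrite ler_wpM2l// ler_expR lI.
  by rewrite mulrBr mulfV ?gt_eqF// mulr1 gerBl ltW.
exists (\bigcup_(i < K * j.+1) E i); split.
- by apply: bigcup_measurable => i _; case: (hE i).
- apply: le_trans (prU_ord _ (fun i => (hE i).1) (fun i => (hE i).2)) _.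
  rewrite sumr_const card_ord -[_ *+ _]mulr_natr.
  apply: le_trans hj; rewrite natrM.
  have jr : j.+1%:R * r = 1 by rewrite mulfV.
  have -> : r ^+ 2 * expR 1 * (K%:R * j.+1%:R) = K%:R * expR 1 * r * (j.+1%:R * r) by ring.
  by rewrite jr mulr1.
- move=> t nE v vn; rewrite leqNgt; apply/negP => v2; apply: nE.
  have /ltr_normlP[vn1 vn2] := vn.
  pose i := `|Num.floor ((v + n%:R) * j.+1%:R)|%N.
  have f0 : 0 <= (v + n%:R) * j.+1%:R by apply: mulr_ge0 => //; lra.
  have iE : i%:R = (Num.floor ((v + n%:R) * j.+1%:R))%:~R :> R.
    by rewrite /i natr_absz ger0_norm// floor_ge0.
  have h1 : i%:R <= (v + n%:R) * j.+1%:R by rewrite iE; exact: floor_le.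
  have h2 : (v + n%:R) * j.+1%:R < i.+1%:R by rewrite -[i.+1%:R]natr1 iE -intrD1; exact: floorD1_gt.
  have jr : (j.+1%:R : R) = r^-1 by rewrite invrK.
  rewrite jr in h1 h2.
  have Iv : I i v.
    rewrite /I/= in_itv/= -lerBrDl opprK -ltrBlDl opprK.
    by rewrite -ler_pdivlMr// h1 -ltr_pdivrMr// h2.
  have [_ [W IW]] := bI i.
  have BW w : I i w -> `|w| <= W by move=> /IW; rewrite /= in_itv/= -ler_norml.
  exists i.
    rewrite /= -(ltr_nat R) natrM; apply: le_lt_trans h1 _.
    by rewrite jr ltr_pM2r ?invr_gt0// /K natrM; lra.
  have [k hk] := count_nat (X t) BW.
  exists k => //; rewrite /J/= -(ler_nat R) -hk.
  by apply: le_trans (count_atom (X t) BW Iv); rewrite ler_nat.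
Qed.

(* A shell has about 5 k^4 points, up to fluctuations of order k^2. As they stay
   below k^3, the contributions to the sum of 1/v of two opposite shells cancel
   up to O(k^3 / k^5), which is summable. *)
Definition shell_len (k : nat) : nat := (k.+1 ^ 5 - k ^ 5)%N.

(** Chernoff bounds with x = 1 + th and x = 1 - th, where th = 1/(124 k). As l <= 31 k^4, the terms
    th^2 l and 2 th^2 l are at most a quarter and a half of th k^3 = k^2/124. Both exponents are
    then at most -k^2/248, and exp(-y) <= 1/y gives a summable bound. *)
Lemma poisson_deviation B (l k : nat) : bounded_borel B -> len B = l%:R ->
  (0 < k)%N -> (l <= 31 * k ^ 4)%N ->
  exists E, [/\ measurable E, pr P E <= 2 * (248 / k%:R ^+ 2) &
    forall t, ~ E t -> `|N B t - l%:R| <= k%:R ^+ 3].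
Proof.
move=> bB lB k0 lk.
have k1 : 1 <= k%:R :> R by rewrite ler1n.
pose th : R := (124 * k%:R)^-1.
have th0 : 0 < th by rewrite invr_gt0; lra.
have thk : th * k%:R = 124^-1 by rewrite /th; field; lra.
have th1 : th <= 124^-1 by rewrite -thk ler_peMr// ltW.
have lk' : l%:R <= 31 * k%:R ^+ 4 :> R.
  by rewrite -natrX -natrM ler_nat.
have thl : th ^+ 2 * l%:R <= 31 * (124^-1) ^+ 2 * k%:R ^+ 2.
  apply: (@le_trans _ _ (th ^+ 2 * (31 * k%:R ^+ 4))).
    by rewrite ler_wpM2l// sqr_ge0.
  rewrite -thk le_eqVlt; apply/orP; left; apply/eqP; ring.
have thk3 : th * k%:R ^+ 3 = 124^-1 * k%:R ^+ 2 by rewrite -thk; ring.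
have k2 : 0 < k%:R ^+ 2 :> R by rewrite exprn_gt0//; lra.
have bound (y : R) : y <= - (248^-1 * k%:R ^+ 2) -> expR y <= 248 / k%:R ^+ 2.
  move=> hy; apply: (@le_trans _ _ (expR (- (248^-1 * k%:R ^+ 2)))); first by rewrite ler_expR.
  rewrite expRN -[leRHS]invrK lef_pV2 ?posrE ?expR_gt0 ?invr_gt0 ?divr_gt0//.
  rewrite invfM invrK; apply: le_trans (expR_ge1Dx _).
  by rewrite lerDr.
pose Ju : set nat := [set j | (l + k ^ 3 <= j)%N].
pose Jl : set nat := [set j | (j <= l - k ^ 3)%N /\ (k ^ 3 <= l)%N].
pose xu := 1 + th; pose xl := 1 - th.
have xu0 : 0 < xu by rewrite /xu; lra.
have xl0 : 0 < xl by rewrite /xl; lra.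
have hu j : Ju j -> 1 <= xu^-1 ^+ (l + k ^ 3) * xu ^+ j.
  move=> hj; rewrite -(subnK hj) [X in _ * X]exprD mulrCA -exprMn mulVf ?gt_eqF// expr1n mulr1.
  by rewrite exprn_ege1// /xu lerDl ltW.
have hl j : Jl j -> 1 <= xl^-1 ^+ (l - k ^ 3) * xl ^+ j.
  move=> [hj _]; rewrite -(subnK hj) exprD -mulrA -exprMn mulVf ?gt_eqF// expr1n mulr1.
  by rewrite exprn_ege1// invf_ge1// /xl gerBl ltW.
have su : xu^-1 <= expR (- th + th ^+ 2).
  apply: (@le_trans _ _ (1 + (- th + th ^+ 2))); last exact: expR_ge1Dx.
  rewrite -[leLHS]mul1r ler_pdivrMr// /xu.
  have -> : (1 + (- th + th ^+ 2)) * (1 + th) = 1 + th ^+ 3 by ring.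
  by rewrite lerDl exprn_ge0// ltW.
have sl : xl^-1 <= expR (th + 2 * th ^+ 2).
  apply: (@le_trans _ _ (1 + (th + 2 * th ^+ 2))); last exact: expR_ge1Dx.
  rewrite -[leLHS]mul1r ler_pdivrMr// /xl.
  have -> : (1 + (th + 2 * th ^+ 2)) * (1 - th) = 1 + th ^+ 2 * (1 - 2 * th) by ring.
  by rewrite lerDl mulr_ge0 ?sqr_ge0//; lra.
have [mu pu] := poisson_chernoff bB xu0 su hu.
have [ml pl] := poisson_chernoff bB xl0 sl hl.
set Eu := [set t | _] in mu pu; set El := [set t | _] in ml pl.
have {}pu : pr P Eu <= 248 / k%:R ^+ 2.
  apply: le_trans pu _; rewrite lB /xu addrAC subrr add0r; apply: bound.
  rewrite natrD natrX.
  have e1 : th ^+ 2 * k%:R ^+ 3 <= 124^-1 * (124^-1 * k%:R ^+ 2).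
    by rewrite -thk3 expr2 -mulrA ler_wpM2r// mulr_ge0 ?exprn_ge0// ltW.
  have -> : (- th + th ^+ 2) * (l%:R + k%:R ^+ 3) + l%:R * th =
    th ^+ 2 * l%:R - th * k%:R ^+ 3 + th ^+ 2 * k%:R ^+ 3 by ring.
  by rewrite thk3; move: e1 thl k2; clear - R d T P X hX N len; lra.
have {}pl : pr P El <= 248 / k%:R ^+ 2.
  have [kl|lk3] := leqP (k ^ 3) l; last first.
    have -> : El = set0.
      by rewrite -subset0 => t [j [_ h]]; rewrite leqNgt lk3 in h.
    by rewrite /pr measure0 divr_ge0// ltW.
  apply: le_trans pl _; rewrite lB /xl addrAC subrr add0r; apply: bound.
  rewrite natrB// natrX.
  have e1 : 0 <= th ^+ 2 * k%:R ^+ 3 by rewrite mulr_ge0 ?sqr_ge0// exprn_ge0.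
  have -> : (th + 2 * th ^+ 2) * (l%:R - k%:R ^+ 3) + l%:R * - th =
    2 * (th ^+ 2 * l%:R) - th * k%:R ^+ 3 - 2 * (th ^+ 2 * k%:R ^+ 3) by ring.
  by rewrite thk3; move: e1 thl k2; clear - R d T P X hX N len; lra.
exists (Eu `|` El); split; first exact: measurableU.
  by apply: le_trans (prU _ mu ml) _; lra.
move=> t /not_orP[nu nl].
have [_ [W BW]] := bB.
have [j hj] := count_nat (X t) (B := B) (W := W) ltac:(by move=> v /BW; rewrite /= in_itv/= -ler_norml).
rewrite /N hj -natrX.
have j1 : (j < l + k ^ 3)%N by rewrite ltnNge; apply/negP => h; apply: nu; exists j.
have j2 : (l < j + k ^ 3)%N.
  rewrite ltnNge; apply/negP => h; apply: nl; exists j => //.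
  split; last exact: leq_trans (leq_addl _ _) h.
  by rewrite leq_subRL ?(leq_trans (leq_addl _ _) h)// addnC.
move: j1 j2; rewrite -(ltr_nat R) -[(l < _)%N](ltr_nat R) !natrD => j1 j2.
by rewrite ler_norml; apply/andP; split; lra.
Qed.

End poisson.

(** * Principal value sums over balanced shells *)

Section shells.
Context {R : realType}.
Implicit Types (m : conf R).

Lemma inv_sqr_le (x : R) : 1 < x -> (x ^+ 2)^-1 <= (x - 1)^-1 - x^-1.
Proof.
move=> x1; have -> : (x - 1)^-1 - x^-1 = ((x - 1) * x)^-1 by field; lra.
have x0 : 0 < x by lra.
have x1' : 0 < x - 1 by lra.
by rewrite lef_pV2 ?posrE ?exprn_gt0 ?mulr_gt0// expr2 ler_wpM2r// ?(ltW x0)//; lra.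
Qed.

(** Along fifth powers the increments are summable, by comparison of 1/k^2 with a telescoping
    series. The bound C/k inside a shell is not summable, but it is used only once, in the last
    shell. *)
Lemma cvg_shells (x : nat -> R) C K : 0 <= C -> (2 <= K)%N ->
  (forall k n, (K <= k)%N -> (k ^ 5 <= n <= k.+1 ^ 5)%N ->
    `|x n - x (k ^ 5)%N| <= C / k%:R) ->
  (forall k, (K <= k)%N -> `|x (k.+1 ^ 5)%N - x (k ^ 5)%N| <= C / k%:R ^+ 2) ->
  cvgn x.
Proof.
move=> C0 K2 h1 h2.
have kgt1 k : (K <= k)%N -> 1 < k%:R :> R by move=> Kk; rewrite ltr1n (leq_trans K2).
have step k j : (K <= k)%N -> `|x ((k + j) ^ 5)%N - x (k ^ 5)%N| <=
    C * ((k%:R - 1)^-1 - ((k + j)%:R - 1)^-1).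
  move=> Kk; elim: j => [|j ih]; first by rewrite addn0 !subrr normr0 mulr0.
  rewrite addnS; set i := (k + j)%N in ih *.
  have Ki : (K <= i)%N by rewrite (leq_trans Kk)// leq_addr.
  have i1 := kgt1 _ Ki.
  have h3 := h2 _ Ki.
  have h4 := ler_distD (x (i ^ 5)%N) (x (i.+1 ^ 5)%N) (x (k ^ 5)%N).
  have h5 := ler_wpM2l C0 (inv_sqr_le i1).
  have -> : i.+1%:R - 1 = i%:R :> R by rewrite -natr1 addrK.
  rewrite mulrBr in h5; rewrite mulrBr in ih; rewrite mulrBr.
  by move: h3 h4 h5 ih; clear; lra.
have stepn k n : (K <= k)%N -> (k ^ 5 <= n)%N ->
    `|x n - x (k ^ 5)%N| <= C * (2 / (k%:R - 1)).
  move=> Kk kn.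
  have ex : exists i, (k <= i)%N && (i ^ 5 <= n)%N by exists k; rewrite leqnn.
  have bd i : (k <= i)%N && (i ^ 5 <= n)%N -> (i <= n)%N.
    by move=> /andP[_]; apply: leq_trans; case: i => // i; rewrite -{1}[i.+1]expn1 leq_pexp2l.
  have [i /andP[ki iN] imax] := ex_maxnP ex bd.
  have ni : (n <= i.+1 ^ 5)%N.
    rewrite leqNgt; apply/negP => h; have := imax i.+1.
    by rewrite (ltnW h) (leq_trans ki)// ltnn => /(_ isT).
  have Ki := leq_trans Kk ki.
  have h3 := h1 i n Ki; rewrite iN ni in h3; have {}h3 := h3 isT.
  have h4 := step k (i - k)%N Kk; rewrite subnKC// in h4.
  have h5 := ler_distD (x (i ^ 5)%N) (x n) (x (k ^ 5)%N).
  have k1 := kgt1 _ Kk; have i1 := kgt1 _ Ki.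
  have h6 : C / i%:R <= C * (k%:R - 1)^-1.
    rewrite ler_wpM2l// lef_pV2 ?posrE; [|lra|lra].
    by have : (k%:R : R) <= i%:R by [rewrite ler_nat]; lra.
  have h7 : 0 <= C * (i%:R - 1)^-1 by rewrite mulr_ge0// invr_ge0; lra.
  rewrite mulrBr in h4; rewrite mulrCA.
  by move: h3 h4 h5 h6 h7; clear; lra.
apply: cauchy_cvg; apply: cauchy_exP => e e0.
have [k [Kk hk]] : exists k, (K <= k)%N /\ C * (2 / (k%:R - 1)) < e.
  near \oo => k; exists k.
  have Kk : (K <= k)%N by near: k; exact: nbhs_infty_ge.
  split => //; have k1 := kgt1 _ Kk.
  have hk : C * 2 / e + 2 <= k%:R by near: k; exact: nbhs_infty_ger.
  rewrite mulrA ltr_pdivrMr; last lra.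
  rewrite [e * _]mulrC -ltr_pdivrMr//; move: hk; clear; lra.
exists (x (k ^ 5)%N); exists (k ^ 5)%N => // n /= kn.
by rewrite /ball/= distrC; apply: le_lt_trans hk; exact: stepn.
Unshelve. all: by end_near. Qed.

Definition shell_pos (k : nat) : set R := `](k ^ 5)%:R, (k.+1 ^ 5)%:R]%classic.
Definition shell_neg (k : nat) : set R := `[- (k.+1 ^ 5)%:R, - (k ^ 5)%:R[%classic.

Definition balanced m k :=
  `|Defs.count m (shell_pos k) - (shell_len k)%:R| <= k%:R ^+ 3 /\
  `|Defs.count m (shell_neg k) - (shell_len k)%:R| <= k%:R ^+ 3.

Lemma shell_lenE k : (k.+1 ^ 5 = k ^ 5 + (5 * k ^ 4 + 10 * k ^ 3 + 10 * k ^ 2 + 5 * k + 1))%N.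
Proof. by rewrite !expnS expn0; ring. Qed.

(** Lower powers of k are bounded by k^4, and 5 + 10 + 10 + 5 + 1 = 31. *)
Lemma shell_len_le k : (0 < k)%N -> (shell_len k <= 31 * k ^ 4)%N.
Proof.
move=> k0; rewrite /shell_len shell_lenE addKn.
have h3 : (k ^ 3 <= k ^ 4)%N by rewrite leq_pexp2l.
have h2 : (k ^ 2 <= k ^ 4)%N by rewrite leq_pexp2l.
have h1 : (k ^ 1 <= k ^ 4)%N by rewrite leq_pexp2l.
have h0 : (k ^ 0 <= k ^ 4)%N by rewrite leq_pexp2l.
rewrite expn1 in h1; rewrite expn0 in h0; lia.
Qed.

Lemma shell_len_gt k : (0 < k)%N -> (k ^ 3 < shell_len k)%N.
Proof.
move=> k0; rewrite /shell_len shell_lenE addKn.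
have h3 : (k ^ 3 <= k ^ 4)%N by rewrite leq_pexp2l.
lia.
Qed.

Lemma shellP (k : nat) (v : R) : (k ^ 5)%:R < `|v| -> `|v| <= (k.+1 ^ 5)%:R ->
  (shell_pos k v /\ 0 < v) \/ (shell_neg k v /\ v < 0).
Proof.
rewrite /shell_pos /shell_neg /= !in_itv/=.
have [v0|v0] := leP 0 v.
  rewrite ger0_norm// => h1 h2; left; rewrite h1 h2; split => //.
  exact: le_lt_trans h1.
by rewrite ltr0_norm// => h1 h2; right; rewrite lerNl h2 ltrNr h1.
Qed.

Lemma shell_pos_norm (k : nat) (v : R) : shell_pos k v ->
  [/\ 0 < v, (k ^ 5)%:R < v & v <= (k.+1 ^ 5)%:R].
Proof.
rewrite /shell_pos /= in_itv/= => /andP[h1 h2]; split => //.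
exact: le_lt_trans h1.
Qed.

Lemma shell_neg_norm (k : nat) (v : R) : shell_neg k v ->
  [/\ v < 0, (k ^ 5)%:R < - v & - v <= (k.+1 ^ 5)%:R].
Proof.
rewrite /shell_neg /= in_itv/= => /andP[h1 h2]; split.
- by apply: lt_le_trans h2 _; rewrite oppr_le0.
- by rewrite ltrNr.
- by rewrite lerNl.
Qed.

Lemma vanish_pos k : vanish (k.+1 ^ 5)%:R (\1_(shell_pos k) : R -> R).
Proof.
move=> v hv; rewrite indicE memNset// => /shell_pos_norm[v0 _ h].
by rewrite gtr0_norm// ltNge h in hv.
Qed.

Lemma vanish_neg k : vanish (k.+1 ^ 5)%:R (\1_(shell_neg k) : R -> R).
Proof.
move=> v hv; rewrite indicE memNset// => /shell_neg_norm[v0 _ h].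
by rewrite ltr0_norm// ltNge h in hv.
Qed.

Lemma shell_comb m k (a b : R) : conf_int m (fun v => a * \1_(shell_pos k) v + b * \1_(shell_neg k) v) =
  a * Defs.count m (shell_pos k) + b * Defs.count m (shell_neg k).
Proof.
rewrite (@conf_intD _ _ (k.+1 ^ 5)%:R); last 2 first.
- by move=> v /vanish_pos ->; rewrite mulr0.
- by move=> v /vanish_neg ->; rewrite mulr0.
by rewrite (conf_intZ _ _ (@vanish_pos k)) (conf_intZ _ _ (@vanish_neg k)).
Qed.

Lemma vanish_comb k (a b : R) :
  vanish (k.+1 ^ 5)%:R (fun v => a * \1_(shell_pos k) v + b * \1_(shell_neg k) v).
Proof. by move=> v hv; rewrite vanish_pos// vanish_neg// !mulr0 addr0. Qed.

Lemma ler_conf_shell m k (a b : R) (g : R -> R) : vanish (k.+1 ^ 5)%:R g ->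
  (forall v, shell_pos k v -> g v <= a) -> (forall v, shell_neg k v -> g v <= b) ->
  (forall v, ~ shell_pos k v -> ~ shell_neg k v -> g v <= 0) ->
  conf_int m g <= a * Defs.count m (shell_pos k) + b * Defs.count m (shell_neg k).
Proof.
move=> gv gp gn g0; rewrite -shell_comb.
apply: (ler_conf_int gv (vanish_comb _ _)) => v _; rewrite !indicE.
have [sp|np] := pselect (shell_pos k v).
  rewrite mem_set// memNset ?mulr1 ?mulr0 ?addr0; first exact: gp.
  move: sp => /shell_pos_norm[h _ _] /shell_neg_norm[h' _ _].
  by move: (lt_trans h h'); rewrite ltxx.
rewrite memNset//; have [sn|nn] := pselect (shell_neg k v).
  by rewrite mem_set// mulr0 mulr1 add0r; exact: gn.
by rewrite memNset// !mulr0 addr0; exact: g0.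
Qed.

Section balanced_conf.
Variables (m : conf R) (k : nat).
Hypotheses (k0 : (0 < k)%N) (hk : balanced m k).

Let Dp := Defs.count m (shell_pos k).
Let Dm := Defs.count m (shell_neg k).

Let k1 : 1 <= k%:R :> R.
Proof. by rewrite ler1n. Qed.

Let pw i j : (i <= j)%N -> k%:R ^+ i <= k%:R ^+ j :> R.
Proof. by move=> ij; exact: ler_weXn2l. Qed.

Let pos i : 0 < k%:R ^+ i :> R.
Proof. by rewrite exprn_gt0// ltr0n. Qed.

Ltac slra := clear - R m k k0 hk Dp Dm k1 pw pos; lra.

Lemma count_shell_le : Dp <= 32 * k%:R ^+ 4 /\ Dm <= 32 * k%:R ^+ 4.
Proof.
have hl : (shell_len k)%:R <= 31 * k%:R ^+ 4 :> R.
  by rewrite -natrX -natrM ler_nat shell_len_le.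
have h3 := @pw 3 4 isT.
case: hk => /ler_normlP[_ h1] /ler_normlP[_ h2]; rewrite -/Dp -/Dm in h1 h2.
by split; move: hl h1 h2 h3; slra.
Qed.

Lemma shell_inv (v : R) : (k ^ 5)%:R < `|v| -> `|v|^-1 <= (k%:R ^+ 5)^-1.
Proof.
move=> hv; rewrite lef_pV2 ?posrE//; first by rewrite -natrX ltW.
by apply: le_lt_trans hv.
Qed.

(** At most 64 k^4 atoms contribute at most k^-5 each, which gives 64/k; the constant 994 is that of
    [shell_psum_end]. *)
Lemma shell_psum n : (k ^ 5 <= n <= k.+1 ^ 5)%N ->
  `|psum m n 0 - psum m (k ^ 5)%N 0| <= 994 / k%:R.
Proof.
move=> /andP[kn nk]; rewrite (psum_tsum _ _ kn) addrAC subrr add0r /tsum /partial_sum.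
pose a : R := (k%:R ^+ 5)^-1.
have a0 : 0 <= a by rewrite invr_ge0 ltW.
set g := (X in conf_int m X).
have gv : vanish (k.+1 ^ 5)%:R g.
  move=> v hv; rewrite /g; case: ifP => // vn; exfalso.
  by move: hv; rewrite ltNge (le_trans vn)// ler_nat.
have ga v : `|g v| <= a.
  rewrite /g; case: ifPn => vn; last by rewrite normr0.
  case: ifPn => kv; last by rewrite normr0.
  by rewrite subr0 normfV; exact: shell_inv.
have gv' : vanish (k.+1 ^ 5)%:R (fun v => `|g v|) by move=> v /gv ->; rewrite normr0.
apply: le_trans (ler_norm_conf_int gv gv' (fun v _ => lexx _)) _.
apply: le_trans (ler_conf_shell (a := a) (b := a) m gv' _ _ _) _ => // [v np nn|].
  rewrite /g; case: ifPn => vn; last by rewrite normr0.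
  case: ifPn => kv; last by rewrite normr0.
  have vk : `|v| <= (k.+1 ^ 5)%:R by apply: le_trans vn _; rewrite ler_nat.
  by have [[]|[]] := shellP kv vk.
rewrite -/Dp -/Dm -mulrDr.
have [h1 h2] := count_shell_le.
apply: (@le_trans _ _ (a * (64 * k%:R ^+ 4))).
  by rewrite ler_wpM2l//; move: h1 h2; slra.
have -> : a * (64 * k%:R ^+ 4) = 64 / k%:R.
  by rewrite /a; field; rewrite pnatr_eq0 -lt0n.
apply: ler_wpM2r; first by rewrite invr_ge0.
by slra.
Qed.

(** With a = k^-5 and b = (k+1)^-5, the sum is at most a Dp - b Dm = a (Dp - Dm) + (a - b) Dm, and
    likewise for its opposite. The counts differ by at most 2 k^3, so the first term is at most
    2/k^2; in the second, a - b <= 31/k^6 and Dm <= 32 k^4. Hence 994 = 2 + 31 x 32. *)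
Lemma shell_psum_end : `|psum m (k.+1 ^ 5)%N 0 - psum m (k ^ 5)%N 0| <= 994 / k%:R ^+ 2.
Proof.
have kk : (k ^ 5 <= k.+1 ^ 5)%N by rewrite leq_exp2r.
rewrite (psum_tsum _ _ kk) addrAC subrr add0r /tsum /partial_sum.
pose a : R := (k%:R ^+ 5)^-1; pose b : R := ((k.+1 ^ 5)%:R)^-1.
have a0 : 0 <= a by rewrite invr_ge0 ltW.
have b0 : 0 <= b by rewrite invr_ge0.
pose g v : R := if `|v| <= (k.+1 ^ 5)%:R then if (k ^ 5)%:R < `|v| then (v - 0)^-1 else 0 else 0.
rewrite -/g.
have gv : vanish (k.+1 ^ 5)%:R g by move=> v; rewrite /g ltNge => /negbTE ->.
have A0 : 0 < (k ^ 5)%:R :> R by rewrite ltr0n expn_gt0 k0.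
have B0 : 0 < (k.+1 ^ 5)%:R :> R by rewrite ltr0n expn_gt0.
have aE : a = ((k ^ 5)%:R)^-1 by rewrite /a natrX.
have inv_ab u : (k ^ 5)%:R < u -> u <= (k.+1 ^ 5)%:R -> b <= u^-1 <= a.
  move=> h1 h2; have u0 := lt_trans A0 h1.
  by rewrite aE /b !lef_pV2 ?posrE// h2 ltW.
have gp v : shell_pos k v -> b <= g v <= a.
  move=> /shell_pos_norm[v0 h1 h2].
  by rewrite /g gtr0_norm// h1 h2 subr0 inv_ab.
have gn v : shell_neg k v -> - a <= g v <= - b.
  move=> /shell_neg_norm[v0 h1 h2].
  rewrite /g ltr0_norm// h1 h2 subr0 -[v in v^-1]opprK invrN !lerN2 andbC.
  exact: inv_ab.
have g0 v : ~ shell_pos k v -> ~ shell_neg k v -> g v = 0.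
  move=> np nn; rewrite /g; case: ifPn => // h1; case: ifPn => // h2.
  by have [[]|[]] := shellP h2 h1.
have hu : conf_int m g <= a * Dp + (- b) * Dm.
  apply: (ler_conf_shell m gv) => [v /gp/andP[]//|v /gn/andP[]//|v np nn].
  by rewrite g0.
have hl : - 1 * conf_int m g <= (- b) * Dp + a * Dm.
  rewrite -(conf_intZ _ _ gv); apply: ler_conf_shell => [v /gv ->|v|v|v np nn].
  - by rewrite mulr0.
  - by move=> /gp/andP[]; rewrite mulN1r lerN2.
  - by move=> /gn/andP[]; rewrite mulN1r lerNl.
  - by rewrite g0// mulr0.
have [c1 c2] := count_shell_le.
have Dp0 : 0 <= Dp by apply: conf_int_ge0 => v _; rewrite indicE.
have Dm0 : 0 <= Dm by apply: conf_int_ge0 => v _; rewrite indicE.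
have ab0 : 0 <= a - b.
  by rewrite subr_ge0 aE /b lef_pV2 ?posrE ?ler_nat.
have ab : a - b <= 31 / k%:R ^+ 6.
  have -> : a - b = (shell_len k)%:R * (a * b).
    rewrite /shell_len natrB// aE /b; move: A0 B0.
    move: (k ^ 5)%:R (k.+1 ^ 5)%:R => A B A0 B0; field.
    by rewrite (gt_eqF A0) (gt_eqF B0).
  apply: (@le_trans _ _ (31 * k%:R ^+ 4 * (a * a))).
    apply: ler_pM => //; first by rewrite mulr_ge0.
      by rewrite -natrX -natrM ler_nat shell_len_le.
    by rewrite ler_wpM2l//; move: ab0; slra.
  rewrite /a le_eqVlt; apply/orP; left; apply/eqP; field.
  by rewrite pnatr_eq0 -lt0n.
have dab D : 0 <= D -> D <= 32 * k%:R ^+ 4 -> D * (a - b) <= 992 / k%:R ^+ 2.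
  move=> D0 hD; apply: le_trans (ler_pM D0 ab0 hD ab) _.
  rewrite le_eqVlt; apply/orP; left; apply/eqP; field.
  by rewrite pnatr_eq0 -lt0n.
have d1 := dab _ Dp0 c1; have d2 := dab _ Dm0 c2.
have k3a : a * (2 * k%:R ^+ 3) = 2 / k%:R ^+ 2.
  by rewrite /a; field; rewrite pnatr_eq0 -lt0n.
have [e1 e2] : a * (Dp - Dm) <= 2 / k%:R ^+ 2 /\ a * (Dm - Dp) <= 2 / k%:R ^+ 2.
  case: hk => /ler_normlP[h1 h2] /ler_normlP[h3 h4]; rewrite -/Dp -/Dm in h1 h2 h3 h4.
  by rewrite -k3a; split; rewrite ler_wpM2l//; move: h1 h2 h3 h4; slra.
rewrite ler_norml; apply/andP; split.
  by move: hl d1 e2; slra.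
by move: hu d2 e1; slra.
Qed.

Lemma shell_sqr :
  partial_sum m (fun v => v ^- 2) (k.+1 ^ 5) - partial_sum m (fun v => v ^- 2) (k ^ 5)
    <= 64 / k%:R ^+ 2.
Proof.
have kk : (k ^ 5 <= k.+1 ^ 5)%N by rewrite leq_exp2r.
rewrite (partial_sum_split _ _ kk) addrAC subrr add0r /partial_sum.
pose a : R := (k%:R ^+ 5)^-1.
have a0 : 0 <= a by rewrite invr_ge0 ltW.
set g := (X in conf_int m X).
have gv : vanish (k.+1 ^ 5)%:R g by move=> v; rewrite /g ltNge => /negbTE ->.
have ga v : g v <= a ^+ 2.
  rewrite /g; case: ifPn => vn; last exact: sqr_ge0.
  case: ifPn => kv; last exact: sqr_ge0.
  rewrite -exprVn -[leLHS]real_normK ?num_real// normfV.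
  by apply: lerXn2r; rewrite ?nnegrE ?invr_ge0//; exact: shell_inv.
apply: le_trans (ler_conf_shell (a := a ^+ 2) (b := a ^+ 2) m gv _ _ _) _ => // [v np nn|].
  by rewrite /g; case: ifP => // vn; case: ifP => // kv; have [[]|[]] := shellP kv vn.
rewrite -/Dp -/Dm -mulrDr.
have [h1 h2] := count_shell_le.
apply: (@le_trans _ _ (a ^+ 2 * (64 * k%:R ^+ 4))).
  by rewrite ler_wpM2l ?sqr_ge0//; move: h1 h2; slra.
have -> : a ^+ 2 * (64 * k%:R ^+ 4) = 64 / k%:R ^+ 6.
  by rewrite /a; field; rewrite pnatr_eq0 -lt0n.
by rewrite ler_wpM2l// lef_pV2 ?posrE// pw.
Qed.

(** The length of a shell exceeds the allowed deviation k^3, so a balanced shell is not empty. *)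
Lemma shell_atom : exists p, m p <> 0%N.
Proof.
apply: contrapT => h.
have D0 : Dp = 0.
  rewrite /Dp /Defs.count (@conf_int_seq _ _ _ [::]) ?big_nil// => v mv _.
  by exfalso; apply: h; exists v.
case: hk => + _; rewrite -/Dp D0 sub0r normrN ger0_norm// -natrX ler_nat leqNgt.
by rewrite shell_len_gt.
Qed.

End balanced_conf.

Lemma balanced_good m K : (forall k, (K <= k)%N -> balanced m k) ->
  simple m -> (forall n : nat, m n%:R = 0%N /\ m (- n%:R) = 0%N) -> good m.
Proof.
move=> hK0 sm hn; pose K' := maxn K 2.
have hK k : (K' <= k)%N -> balanced m k.
  by rewrite geq_max => /andP[Kk _]; exact: hK0.
have K2 : (2 <= K')%N by rewrite leq_maxr.
have kgt0 k : (K' <= k)%N -> (0 < k)%N by move=> Kk; rewrite (leq_trans _ Kk)// (leq_trans _ K2).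
split => //.
- exact: (shell_atom (kgt0 _ (leqnn K')) (hK _ (leqnn K'))).
- apply: (cvg_shells (C := 994%:R) (K := K')) => [||k n Kk hkn|k Kk].
  + exact: ler0n.
  + exact: K2.
  + by apply: shell_psum hkn; [exact: kgt0|exact: hK].
  + by apply: shell_psum_end; [exact: kgt0|exact: hK].
- pose y := partial_sum m (fun v => v ^- 2).
  have yn : nondecreasing_seq y.
    by apply: partial_sum_nondecreasing => v _; rewrite invr_ge0 sqr_ge0.
  have step j : y ((K' + j) ^ 5)%N <= y (K' ^ 5)%N + 64 * (1 - ((K' + j)%:R - 1)^-1).
    elim: j => [|j ih].
      have K2' : (2%:R : R) <= K'%:R by rewrite ler_nat.
      rewrite addn0 lerDl mulr_ge0// subr_ge0 invf_le1; move: K2'; clear; lra.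
    rewrite addnS; set i := (K' + j)%N in ih *.
    have Ki : (K' <= i)%N by rewrite leq_addr.
    have i1 : 1 < i%:R :> R by rewrite ltr1n (leq_trans K2).
    have h3 := shell_sqr (kgt0 _ Ki) (hK _ Ki).
    have h5 := inv_sqr_le i1; rewrite -/(y _) -/(y _) in h3.
    have -> : i.+1%:R - 1 = i%:R :> R by rewrite -natr1 addrK.
    by move: h3 h5 ih; clear; lra.
  exists (y (K' ^ 5)%N + 64) => n.
  apply: (@le_trans _ _ (y ((K' + n) ^ 5)%N)).
    apply: yn; apply: (@leq_trans (K' + n)%N); first exact: leq_addl.
    have : (0 < K' + n)%N by rewrite addn_gt0 (leq_trans _ K2).
    by case: (K' + n)%N => // i _; rewrite -{1}[i.+1]expn1 leq_pexp2l.
  apply: le_trans (step n) _.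
  have : 0 <= ((K' + n)%:R - 1)^-1 :> R.
    rewrite invr_ge0 subr_ge0 ler1n addn_gt0 (leq_trans _ K2)//.
  lra.
Qed.

End shells.

Section poisson_good.
Context {R : realType} {d : measure_display} {T : measurableType d}.
Variables (P : probability T R) (X : T -> conf R).
Hypothesis hX : standard_poisson P X.

(** Two shells with two-sided deviations give 992 = 2 x 2 x 248. The sum of 992/k^2 over k > K is at
    most 992/K, a quantitative form of the first Borel-Cantelli lemma. *)
Lemma poisson_balanced : full P [set t | exists K, forall k, (K <= k)%N -> balanced (X t) k].
Proof.
have len_pos k : fine (lebesgue_measure (@shell_pos R k)) = (shell_len k)%:R.
  rewrite lebesgue_measure_itv/= lte_fin ltr_nat ltn_exp2r// ltnSn/=.
  by rewrite /shell_len natrB// leq_exp2r.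
have len_neg k : fine (lebesgue_measure (@shell_neg R k)) = (shell_len k)%:R.
  rewrite lebesgue_measure_itv/= lte_fin ltrN2 ltr_nat ltn_exp2r// ltnSn/=.
  by rewrite opprK addrC /shell_len natrB// leq_exp2r.
have [E hE] : {E : nat -> set T | forall k, (0 < k)%N -> [/\ measurable (E k),
    pr P (E k) <= 992 / k%:R ^+ 2 & forall t, ~ E k t -> balanced (X t) k]}.
  apply: cid; have /choice[E hE] : forall k, exists E : set T, (0 < k)%N -> [/\ measurable E,
    pr P E <= 992 / k%:R ^+ 2 & forall t, ~ E t -> balanced (X t) k].
    move=> k; have [->|k0] := posnP k; first by exists set0.
    have [E1 [m1 p1 h1]] := poisson_deviation hX (@bounded_borel_itv _ _ _ _ _)
      (len_pos k) k0 (shell_len_le k0).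
    have [E2 [m2 p2 h2]] := poisson_deviation hX (@bounded_borel_itv _ _ _ _ _)
      (len_neg k) k0 (shell_len_le k0).
    exists (E1 `|` E2) => _; split; first exact: measurableU.
      by apply: le_trans (prU P m1 m2) _; lra.
    by move=> t /not_orP[n1 n2]; split; [exact: h1|exact: h2].
  by exists E.
apply: full_small => e e0.
near \oo => K.
have hKe : 992 / e <= K%:R by near: K; exact: nbhs_infty_ger.
have K0 : (0 < K)%N by near: K; exact: nbhs_infty_gt.
have K1 : 0 < K%:R :> R by rewrite ltr0n.
pose F i := E (K.+1 + i)%N.
have hF i := hE (K.+1 + i)%N (ltn0Sn _).
pose b i : R := 992 / (K.+1 + i)%:R ^+ 2.
exists (\bigcup_i F i); split.
- by apply: bigcupT_measurable => i; case: (hF i).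
- apply: (@le_trans _ _ (992 / K%:R)); last first.
    by rewrite ler_pdivrMr// mulrC -ler_pdivrMr.
  apply: (@prU_bound _ _ _ _ _ b) => [i|i|n]; [by case: (hF i)|by case: (hF i)|].
  suff : \sum_(i < n) b i <= 992 * (K%:R^-1 - (K + n)%:R^-1).
    move=> h; apply: le_trans h _; apply: ler_wpM2l; first exact: ler0n.
    by rewrite gerBl invr_ge0 ler0n.
  elim: n => [|n ih]; first by rewrite big_ord0 addn0 subrr mulr0.
  rewrite big_ord_recr/= addnS.
  have h1 : 1 < (K + n).+1%:R :> R by rewrite ltr1n ltnS addn_gt0 K0.
  have h2 := inv_sqr_le h1.
  have e3 : (K + n).+1%:R - 1 = (K + n)%:R :> R by rewrite -natr1 addrK.
  rewrite e3 in h2; rewrite /b addSn.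
  have h4 := ler_wpM2l (ler0n R 992) h2.
  rewrite mulrBr in h4; rewrite mulrBr in ih; rewrite mulrBr.
  by apply: le_trans (lerD ih h4) _; rewrite addrA subrK.
- move=> t nF; exists K.+1 => k Kk.
  have [_ _] := hF (k - K.+1)%N; rewrite subnKC//; apply.
  by move=> h; apply: nF; exists (k - K.+1)%N => //; rewrite /F subnKC.
Unshelve. all: by end_near. Qed.

Lemma poisson_good : full P [set t | good (X t)].
Proof.
have h1 := poisson_balanced; have h2 := poisson_simple hX.
have h3 := full_bigcap (fun n : nat => poisson_no_atom hX n%:R).
have h4 := full_bigcap (fun n : nat => poisson_no_atom hX (- n%:R)).
apply: full_sub (fullI (fullI h1 h2) (fullI h3 h4)).
move=> t [[[K hK] sm] [hp hn]]; apply: balanced_good hK sm _ => n.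
by split; [exact: (hp n)|exact: (hn n)].
Qed.

End poisson_good.

(** * Control of the tails *)

Section tails_measurable.
Context {R : realType} {d : measure_display} {T : measurableType d}.

(** Where the sequence diverges, [limn] takes a default value. The set of convergence is measurable
    by the Cauchy criterion, and the two pieces are treated separately. *)
Lemma measurable_lim (f : nat -> T -> R) : (forall n, measurable_fun setT (f n)) ->
  measurable_fun setT (fun t => limn (fun n => f n t)).
Proof.
move=> mf; pose C := [set t | cvgn (fun n => f n t)].
pose D k i j := [set t | `|f i t - f j t| <= k.+1%:R^-1].
have mD k i j : measurable (D k i j).
  rewrite /D -[X in measurable X]setTI -preimage_itvNyc.
  by apply: (measurableT_comp (@normr_measurable R setT)) => //; exact: measurable_funB.
have CE : C = \bigcap_k \bigcup_n \bigcap_(i in [set i | (n <= i)%N]) D k n i.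
  apply/seteqP; split => t.
    move=> /cvg_ex[l hl] k _.
    have k0 : 0 < k.+1%:R^-1 / 2 :> R by rewrite divr_gt0// invr_gt0.
    have /cvgrPdist_le/(_ _ k0)[n _ hn] := hl.
    exists n => // i /= ni; rewrite /D/=.
    have h1 := hn n (leqnn n); have h2 := hn i ni.
    have h3 := ler_distD l (f n t) (f i t); rewrite (distrC _ l) in h3.
    apply: le_trans h3 _; rewrite [leRHS](splitr); exact: lerD.
  move=> h; apply: cauchy_cvg; apply: cauchy_exP => e e0.
  have [k _ /(_ k (leqnn _)) hk] := near_infty_natSinv_lt (PosNum e0).
  have [n _ hn] := h k I.
  exists (f n t); exists n => // i /= ni; rewrite /ball/=.
  by apply: le_lt_trans (hn i ni) _.
have mC : measurable C.
  rewrite CE; apply: bigcapT_measurable => k; apply: bigcupT_measurable => n.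
  by apply: bigcap_measurableType => i _.
rewrite -(setUv C); apply/measurable_funU => //; first exact: measurableC.
split.
  apply: (@measurable_fun_cvg _ _ _ _ f) => [n|t Ct]; last exact: Ct.
  exact: measurable_funS (mf n).
apply: (@eq_measurable_fun _ _ _ _ _ (cst point)); last exact: measurable_cst.
by move=> t /set_mem nC /=; rewrite dvgP.
Qed.

Variable X : T -> conf R.
Hypothesis hX : point_process X.

Lemma measurable_partial_sum (g : R -> R) C n : measurable_fun setT g ->
  (forall v, `|v| <= n%:R -> `|g v| <= C) -> 0 <= C ->
  measurable_fun setT (fun t => partial_sum (X t) g n).
Proof.
move=> mg gC C0; apply: (measurable_conf_int hX (W := n%:R) (C := C)).
- apply: measurable_fun_ifT => //.
  by apply: measurable_fun_ler => //; exact: normr_measurable.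
- by move=> v; case: ifPn => [/gC //|_]; rewrite normr0.
- exact: partial_sum_vanish.
Qed.

Lemma measurable_cut (N : nat) (g : R -> R) : measurable_fun setT g ->
  measurable_fun setT (fun v : R => if N%:R < `|v| then g v else 0).
Proof.
move=> mg; apply: measurable_fun_ifT => //.
by apply: measurable_fun_ltr => //; exact: normr_measurable.
Qed.

Lemma inv_cut_bound (N : nat) (v : R) : (0 < N)%N ->
  `|if N%:R < `|v| then v^-1 else 0| <= 1.
Proof.
move=> N0; case: ifPn => h; last by rewrite normr0.
rewrite normfV invf_le1; last by apply: le_lt_trans h.
by apply: le_trans (ltW h); rewrite ler1n.
Qed.

Lemma measurable_inv : measurable_fun setT (fun v : R => v^-1).
Proof.
rewrite -(setUv [set (0:R)]); apply/measurable_funU => //.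
  exact: measurableC.
split.
  apply: (eq_measurable_fun (fun=> 0 : R)); last exact: measurable_cst.
  by move=> v /set_mem -> /=; rewrite invr0.
apply: open_continuous_measurable_fun.
  by apply: closed_openC; exact: closed_eq.
by move=> v /set_mem /= v0; apply: inv_continuous; apply/eqP.
Qed.

Lemma measurable_tail1 (N : nat) : (0 < N)%N ->
  measurable_fun setT (fun t => tail1 N%:R (X t)).
Proof.
move=> N0; apply: measurable_lim => n.
apply: (measurable_partial_sum (C := 1)) => // [|v _]; last exact: inv_cut_bound.
by apply: measurable_cut; exact: measurable_inv.
Qed.

(** Every finite set of points lies in some [-n, n], so the sum over an uncountable index set is the
    supremum of the truncated sums, hence a countable operation. *)
Lemma tail2E (N : nat) (m : conf R) : tail2 N%:R m =
  ereal_sup (range (fun n => (tsum2 m N n)%:E)).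
Proof.
apply/eqP; rewrite eq_le; apply/andP; split.
  apply: ge_ereal_sup => _ [A [fA AS] <-].
  have [n hn] : exists n : nat, forall v, A v -> `|v| <= n%:R.
    have : bounded_set A by apply: compact_bounded; exact: finite_compact.
    move=> [M [Mr hM]].
    have hM1 := hM (M + 1) ltac:(by rewrite ltrDl).
    have [n nM] := filter_ex (nbhs_infty_ger (M + 1)).
    by exists n => v Av; exact: le_trans (hM1 v Av) nM.
  apply: (@le_trans _ _ (tsum2 m N n)%:E); last by apply: ereal_sup_ubound; exists n.
  rewrite fsbig_finite//= sumEFin lee_fin /tsum2 /partial_sum.
  set g := (X in conf_int m X).
  have -> : \sum_(v <- finmap.enum_fset (fset_set A)) (m v)%:R / v ^+ 2 =
      conf_int m (fun v => if v \in A then g v else 0).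
    rewrite (@conf_int_seq _ _ _ (finmap.enum_fset (fset_set A))).
    - rewrite big_seq [RHS]big_seq; apply: eq_bigr => v; rewrite in_fset_set//.
      by move=> /[dup] /set_mem Av ->; rewrite /g (hn v Av) (AS v Av).
    - exact: finmap.fset_uniq.
    - by move=> v mv; rewrite in_fset_set//; case: ifP => // _; rewrite eqxx.
  have gv : vanish n%:R g by exact: partial_sum_vanish.
  apply: (@ler_conf_int _ _ n%:R) => // [v /gv|v _]; [by case: ifP|case: ifP => // _].
  by rewrite /g; case: ifP => // _; case: ifP => // _; rewrite invr_ge0 sqr_ge0.
apply: ge_ereal_sup => _ [n _ <-].
apply: ereal_sup_ubound; exists [set v | N%:R < `|v| /\ (`|v| <= n%:R /\ m v <> 0%N)].
  split; last by move=> v [].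
  by apply: sub_finite_set (conf_finite m n%:R) => v [].
have fA : finite_set [set v | N%:R < `|v| /\ (`|v| <= n%:R /\ m v <> 0%N)].
  by apply: sub_finite_set (conf_finite m n%:R) => v [].
rewrite fsbig_finite//= sumEFin /tsum2 /partial_sum; congr EFin.
rewrite (@conf_int_seq _ _ _ (finmap.enum_fset (fset_set
  [set v | N%:R < `|v| /\ (`|v| <= n%:R /\ m v <> 0%N)]))).
- rewrite big_seq [RHS]big_seq; apply: eq_bigr => v; rewrite in_fset_set// => /set_mem [h1 [h2 h3]].
  by rewrite h2 h1.
- exact: finmap.fset_uniq.
- move=> v mv; case: ifPn => h1; last by rewrite eqxx.
  case: ifPn => h2; last by rewrite eqxx.
  by move=> _; rewrite in_fset_set//; apply/mem_set.
Qed.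

Lemma measurable_tail2 (N : nat) : (0 < N)%N ->
  measurable_fun setT (fun t => tail2 N%:R (X t)).
Proof.
move=> N0; have g0 (m : conf R) v : m v <> 0%N -> 0 <= (if N%:R < `|v| then v ^- 2 else 0) :> R.
  by move=> _; case: ifP => // _; rewrite invr_ge0 sqr_ge0.
apply: (@emeasurable_fun_cvg _ _ _ _ (fun n t => (tsum2 (X t) N n)%:E)).
  move=> n; apply/measurable_EFinP; apply: (measurable_partial_sum (C := 1)) => // [|v _].
    apply: measurable_cut.
    have -> : (fun v : R => v ^- 2) = (fun v => v^-1 * v^-1).
      by apply/funext => v; rewrite expr2 invfM.
    by apply: measurable_funM; exact: measurable_inv.
  have := inv_cut_bound v N0; case: ifPn => h h1; last by rewrite normr0.
  by rewrite -exprVn normrX exprn_ile1.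
move=> t _; rewrite tail2E; apply: ereal_nondecreasing_cvgn.
by move=> n n' nn'; rewrite lee_fin; apply: partial_sum_nondecreasing nn'; exact: g0.
Qed.

Lemma tsum2_le_tail2 (N n : nat) (m : conf R) e : (tail2 N%:R m < e%:E)%E -> tsum2 m N n <= e.
Proof.
rewrite tail2E => h; rewrite -lee_fin; apply: le_trans (ltW h).
by apply: ereal_sup_ubound; exists n.
Qed.

End tails_measurable.

Section events.
Context {R : realType} {d : measure_display} {T : nat -> measurableType d}.
Variable P : forall M, probability (T M) R.

Definition likely (e : R) (A : forall M, set (T M)) :=
  \forall M \near \oo, exists G : set (T M),
    [/\ measurable G, 1 - e <= pr (P M) G & G `<=` A M].

Lemma likely_sub e (A B : forall M, set (T M)) : (forall M, A M `<=` B M) ->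
  likely e A -> likely e B.
Proof.
move=> AB; apply: filterS => M [G [mG G1 GA]]; exists G; split => // t /GA; exact: AB.
Qed.

Lemma likelyI e e' (A B : forall M, set (T M)) : likely e A -> likely e' B ->
  likely (e + e') (fun M => A M `&` B M).
Proof.
move=> hA hB; apply: filterS2 hA hB => M [G [mG G1 GA]] [H [mH H1 HB]].
exists (G `&` H); split; first exact: measurableI.
  have : pr (P M) (~` (G `&` H)) <= pr (P M) (~` G) + pr (P M) (~` H).
    by rewrite setCI; apply: prU; exact: measurableC.
  by rewrite !prC//; [lra|exact: measurableI].
by move=> t [/GA ? /HB ?].
Qed.

Lemma whp_likely (A : forall M, set (T M)) e : whp P A -> 0 < e -> likely e A.
Proof.
move=> [G [mG GA G1]] e0.
have /fine_cvgP[_ /cvgrPdist_le/(_ _ e0)] := G1.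
apply: filterS => M /= h; exists (G M); split => //.
by move/ler_normlP : h => [h1 h2]; move: h2; rewrite -/(pr _ _); lra.
Qed.

Lemma ae_likely (A : forall M, set (T M)) e : 0 < e ->
  (forall M, {ae P M, forall t, A M t}) -> likely e A.
Proof.
move=> e0 hA; apply: nearW => M.
have [B [mB B0 AB]] := hA M.
exists (~` B); split; first exact: measurableC.
  by rewrite prC// (_ : pr (P M) B = 0); [lra|rewrite /pr B0].
by move=> t nB; apply: contrapT => nA; apply: nB; exact: AB.
Qed.

Variable X : forall M, T M -> conf R.
Hypothesis hX : forall M, point_process (@X M).
Hypothesis hsums : forall M, {ae P M, forall t, sums_defined (@X M t)}.
Hypothesis hii : tails_vanish P X.

Lemma esup_near (u : nat -> \bar R) e : (limn_esup u < e%:E)%E ->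
  \forall M \near \oo, (u M < e%:E)%E.
Proof.
rewrite /limn_esup /limf_esup => /ereal_inf_lt[_ [A hA <-]] h.
apply: filterS hA => M AM; apply: le_lt_trans h.
by apply: ereal_sup_ubound; exists M.
Qed.

(** The limits (ii) are read at integers W = N, where the tails are measurable and complements can
    be taken. One third of eta goes to the sum of 1/v, one to the sum of 1/v^2, one to almost sure
    convergence. *)
Lemma tails_likely (e eta : R) : 0 < e -> 0 < eta ->
  \forall N \near \oo, likely eta (fun M => [set t |
    [/\ cvgn (fun n => tsum (@X M t) N n 0), `|tail (@X M t) N 0| <= e
      & forall n, tsum2 (@X M t) N n <= e]]).
Proof.
move=> e0 eta0; have [h1 h2] := hii e0.
have eta3 : 0 < eta / 3 by lra.
have lt0 : nbhs (0 : \bar R)%E [set x | (x < (eta / 3)%:E)%E].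
  by apply: open_nbhs_nbhs; split; [exact: open_ereal_lt_ereal|rewrite /= lte_fin].
have {}h1 := h1 _ lt0; have {}h2 := h2 _ lt0.
have toN (Q : R -> Prop) : (\forall W \near +oo%R, Q W) -> \forall N \near \oo, Q N%:R.
  move=> [A [_ hA]]; apply: filterS (nbhs_infty_gtr A) => N; exact: hA.
have {}h1 := toN _ h1; have {}h2 := toN _ h2.
near=> N.
have N0 : (0 < N)%N by near: N; exact: nbhs_infty_gt.
have k1 : (limn_esup (fun M => P M [set t | e <= `|tail1 N%:R (@X M t)|%R]%R) < (eta / 3)%:E)%E.
  by near: N.
have k2 : (limn_esup (fun M => P M [set t | (e%:E <= tail2 N%:R (@X M t))%E]) < (eta / 3)%:E)%E.
  by near: N.
pose A1 M := [set t | `|tail1 N%:R (@X M t)| < e].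
pose A2 M := [set t | (tail2 N%:R (@X M t) < e%:E)%E].
have l1 : likely (eta / 3) A1.
  apply: filterS (esup_near k1) => M hM.
  have mE : measurable [set t | e <= `|tail1 N%:R (@X M t)|].
    rewrite -[X in measurable X]setTI -preimage_itvcy.
    apply: (measurableT_comp (@normr_measurable R setT)) => //.
    exact: measurable_tail1.
  exists (~` [set t | e <= `|tail1 N%:R (@X M t)|]); split; first exact: measurableC.
    by rewrite prC//; move: hM; rewrite prE// lte_fin; lra.
  by move=> t /= /negP; rewrite -ltNge.
have l2 : likely (eta / 3) A2.
  apply: filterS (esup_near k2) => M hM.
  have mE : measurable [set t | (e%:E <= tail2 N%:R (@X M t))%E].
    rewrite -[X in measurable X]setTI; apply: emeasurable_fun_c_infty => //.
    exact: measurable_tail2.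
  exists (~` [set t | (e%:E <= tail2 N%:R (@X M t))%E]); split; first exact: measurableC.
    by rewrite prC//; move: hM; rewrite prE// lte_fin; lra.
  by move=> t /= /negP; rewrite -ltNge.
have l3 := @ae_likely (fun M t => sums_defined (@X M t)) (eta / 3) eta3 hsums.
have -> : eta = eta / 3 + eta / 3 + eta / 3 by lra.
apply: likely_sub (likelyI (likelyI l1 l2) l3) => M t [[t1 t2] [t3 _]].
split.
- have -> : (fun n => tsum (@X M t) N n 0) =
    partial_sum (@X M t) (fun v => if N%:R < `|v| then v^-1 else 0).
    by apply/funext => n; rewrite /tsum; congr partial_sum; apply/funext => v; rewrite subr0.
  by apply: t3; rewrite ltr0n.
- by rewrite -tail1E; exact: ltW.
- by move=> n; exact: tsum2_le_tail2 t2.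
Unshelve. all: by end_near. Qed.

End events.

(** * Convergence of the solution sets *)

Section add_points.
Context {R : realType}.
Implicit Types (m : conf R).

Lemma conf_ext m m' : (forall v, m v = m' v) -> m = m'.
Proof.
case: m => f hf; case: m' => f' hf' /= h.
have e : f = f' by apply/funext.
by subst f'; congr Conf; exact: Prop_irrelevance.
Qed.

Lemma conf_of_set_locally_finite (A : set R) v :
  (forall W, finite_set (A `&` [set u | `|u| <= W])) -> A v -> conf_of_set A v = 1%N.
Proof. by move=> hA Av; apply: (conf_of_set1 (hA (`|v| + 1))). Qed.

Lemma supp_union_finite m (s : seq R) W :
  finite_set ((supp m `|` [set` s]) `&` [set u | `|u| <= W]).
Proof.
rewrite setIUl finite_setU; split.
  by apply: sub_finite_set (conf_finite m W) => v [].
by apply: sub_finite_set (finite_seq s) => v [].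
Qed.

Lemma conf_of_supp m : simple m -> conf_of_set (supp m) = m.
Proof.
move=> sm; apply: conf_ext => v; have [mv|/eqP mv] := eqVneq (m v) 0%N.
  rewrite mv conf_of_setE; case: asboolP => // -[] /=.
  by rewrite /supp/= mv.
rewrite (simple1 sm mv); apply: conf_of_set_locally_finite => // W.
by apply: sub_finite_set (conf_finite m W) => u [].
Qed.

(** The matching is extended by the identity on s, which the moved atoms cannot reach. The empty
    list gives the continuity of the support map at a simple configuration, a singleton deals with
    the transition point. *)
Lemma add_points_continuous m (s : seq R) U : simple m -> (forall a, a \in s -> m a = 0%N) ->
  nbhs (conf_of_set (supp m `|` [set` s])) U ->
  nbhs m [set m' : conf R | U (conf_of_set (supp m' `|` [set` s]))].
Proof.
move=> sm ms /(nbhs_close (@conf_of_set_simple _ _))[W hW].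
have in1 m' q : (supp m' `|` [set` s]) q -> conf_of_set (supp m' `|` [set` s]) q = 1%N.
  by apply: conf_of_set_locally_finite; exact: supp_union_finite.
have hs : \forall d \near (0:R)^'+, forall a, a \in s -> forall p, m p <> 0%N -> p != a ->
    2 * d < `|p - a|.
  by apply: near_seq => a _; exact: isolated.
near (0:R)^'+ => d.
have d0 : 0 < d by [].
have d1 : d <= 1 by near: d; exact: nbhs_right_le.
have hWd : forall z', close W d (conf_of_set (supp m `|` [set` s])) z' -> U z' by near: d.
have hsd : forall a, a \in s -> forall p, m p <> 0%N -> p != a -> 2 * d < `|p - a|.
  by near: d.
apply: filterS (near_close W sm d0) => m' [phi [p1 p2 p3]].
apply: hWd.
pose psi q := if m q != 0%N then phi q else q.
have psi_out q : m q = 0%N -> psi q = q by move=> mq; rewrite /psi mq.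
have psi_in q : m q <> 0%N -> psi q = phi q by move=> /eqP mq; rewrite /psi mq.
have far p a : m p <> 0%N -> `|p| <= W -> a \in s -> phi p <> a.
  move=> mp pW sa pa; have [h1 _] := p1 p mp pW; rewrite pa distrC in h1.
  have pna : p != a by apply/eqP => e; apply: mp; rewrite e; exact: ms.
  by have := hsd a sa p mp pna; move: h1 d0; clear; lra.
exists psi; split.
- move=> q zq qW; have [mq|/eqP mq] := eqVneq (m q) 0%N.
    rewrite psi_out// subrr normr0; split => //; apply: in1.
    by have [/=|sq] := conf_of_set_neq0 zq; [rewrite /supp/= mq|right].
  rewrite psi_in//; have [h1 h2] := p1 q mq qW; split => //; apply: in1; left.
  by rewrite /supp/= h2.
- move=> q q' zq qW zq' qW'.
  have ins r : conf_of_set (supp m `|` [set` s]) r <> 0%N -> m r = 0%N -> r \in s.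
    by move=> /conf_of_set_neq0[/= |//]; rewrite /supp/= => h1 h2; rewrite h2 in h1.
  have [mq|/eqP mq] := eqVneq (m q) 0%N; have [mq'|/eqP mq'] := eqVneq (m q') 0%N.
  + by rewrite !psi_out.
  + by rewrite psi_out// psi_in// => e; have := far q' q mq' qW' (ins _ zq mq); rewrite e.
  + by rewrite psi_in// psi_out// => e; have := far q q' mq qW (ins _ zq' mq').
  + by rewrite !psi_in//; exact: p2.
- move=> v /conf_of_set_neq0 [mv|sv] vW.
    have [p [mp pW pv]] := p3 v mv vW.
    by exists p; split => //; [rewrite in1//; left|rewrite psi_in].
  exists v; split; [by rewrite in1//; right|lra|by rewrite psi_out// ms].
Unshelve. all: by end_near. Qed.

End add_points.

Section boundary.
Context {R : realType}.

Lemma has_boundary_valueP (F : R[i] -> R[i]) (u x : R) :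
  has_boundary_value F u (boundary_re F u)%:C%C ->
  has_boundary_value F u x%:C%C <-> boundary_re F u = x.
Proof.
move=> h; split; last by move=> <-.
move=> h'; have e : (boundary_re F u)%:C%C = x%:C%C :> R[i]^o.
  exact: (cvg_unique (@norm_hausdorff _ (R[i]^o)) h h').
by case: e.
Qed.

End boundary.

(** * Solutions as zeros of a perturbed truncated sum *)

Section assembly.
Context {R : realType} {d : measure_display} {T : nat -> measurableType d}.
Variable P : forall M, probability (T M) R.
Variables (omegaM : forall M, T M -> conf R) (K : forall M, T M -> R[i] -> R[i]).
Hypothesis hM : forall M, point_process (@omegaM M).
Hypothesis hsums : forall M, {ae P M, forall t, sums_defined (@omegaM M t)}.
Hypothesis hii : tails_vanish P omegaM.
Hypothesis hK : random_herglotz P K.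

Variables (p : conf R -> conf R) (C : nat -> set (R -> R)).

(** The map p prepares the first component: it is the identity, or the passage to the simple
    configuration with the same support. *)
Definition stable (U : set (conf R * conf R)) (k N : nat) : set (conf R) :=
  [set m' : conf R | forall h, adm k%:R h -> C k h -> forall Z : set R,
    (forall u, `|u| <= k%:R -> (Z u <-> m' u = 0%N /\ psum m' N u + h u = 0)) ->
    U (p m', conf_of_set Z)].

Lemma stable_near (m p0 z0 : conf R) U :
  (forall V, nbhs p0 V -> nbhs m [set m' : conf R | V (p m')]) ->
  (forall V, nbhs z0 V -> zeros_in m C V) ->
  nbhs (p0, z0) U ->
  \forall k \near \oo, \forall N \near \oo, nbhs m (stable U k N).
Proof.
move=> hp hz [[V1 V2] /= [n1 n2] sub].
have h1 := hp _ n1; have := hz _ n2; rewrite /zeros_in.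
apply: filterS => k; apply: filterS => N h2.
apply: filterS2 h1 h2 => m' /= a1 a2 h hh Ch Z hZ.
by apply: sub; split => //=; exact: a2 hZ.
Qed.

(** The class has to absorb the tail g of the sum, small on [-rho, rho]. This window may exceed
    [-k, k], because the transition regime evaluates h near [tau], wherever it is. *)
Hypothesis hC : forall k eta, 0 < eta -> exists rho delta : R,
  [/\ 0 < delta, k%:R <= rho & likely P eta (fun M => [set t | forall g : R -> R,
    (forall u, `|u| <= rho -> `|g u| <= delta) ->
    C k (fun u => g u + boundary_re (@K M t) u)])].

(** The perturbation is the tail of the sum plus the boundary values of K_M. Where these are real,
    the zeros off the atoms are the solutions, by [stieltjes_tail]. The three thirds of e pay for
    the class, the regularity of K_M and the tail bounds. *)
Lemma stable_likely U k e : 0 < e -> \forall N \near \oo, \forall M \near \oo,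
  exists G : set (T M), [/\ measurable G, 1 - e <= pr (P M) G & forall t, G t ->
    stable U k N (@omegaM M t) ->
    U (p (@omegaM M t), conf_of_set (solution_set (@omegaM M t) (@K M t)))].
Proof.
move=> e0; have e3 : 0 < e / 3 by lra.
have [rho [delta [dl0 kr hg]]] := hC k e3.
have k0 : 0 <= k%:R :> R by [].
have r0 : 0 <= rho by apply: le_trans kr.
have k1 : 0 < k%:R + 1 :> R by lra.
have [_ _ /(_ _ k1) hreg] := hK.
have {}hreg := whp_likely hreg e3.
have den : 0 < 1 + 4 * rho by lra.
have e'0 : 0 < delta / (1 + 4 * rho) by rewrite divr_gt0.
set e' := delta / (1 + 4 * rho) in e'0.
have ht := tails_likely hM hsums hii e'0 e3.
near=> N.
have Nr : 2 * rho <= N%:R by near: N; exact: nbhs_infty_ger.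
have hT : likely P (e / 3) (fun M => [set t |
    [/\ cvgn (fun n => tsum (@omegaM M t) N n 0), `|tail (@omegaM M t) N 0| <= e'
      & forall n, tsum2 (@omegaM M t) N n <= e']]) by near: N.
have := likelyI (likelyI hg hreg) hT.
apply: filterS => M [G [mG G1 GA]]; exists G; split => //; first by move: G1; lra.
move=> t /GA[[tg [rv rc rm]] [t1 t2 t3]] st.
set m := @omegaM M t in t1 t2 t3 st *; set F := @K M t in tg rv rc rm *.
have kN : 2 * k%:R <= N%:R :> R by lra.
have sub u : u \in `[- k%:R, k%:R] -> u \in `[- (k%:R + 1), k%:R + 1 : R].
  by rewrite !in_itv/= => /andP[? ?]; apply/andP; split; lra.
have [ca ma] := tail_adm t1 t3 kN.
apply: (st (fun u => tail m N u + boundary_re F u)).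
- split.
    have rc' : {within `[- k%:R, k%:R], continuous (boundary_re F)}.
      by apply: continuous_subspaceW rc => u; exact: sub.
    by move=> x; apply: cvgD; [exact: ca|exact: rc'].
  move=> x y xk yk xy; apply: lerD; first exact: ma.
  by apply: rm xy; exact: sub.
- apply: tg => u ur.
  have uN : 2 * `|u| <= N%:R by lra.
  exact: (tail_small t1 t3 erefl t2 uN ur).
- move=> u uk.
  have uin : u \in `[- (k%:R + 1), k%:R + 1 : R] by apply: sub; rewrite in_itv/= -ler_norml.
  have hb := has_boundary_valueP (- stieltjes m u) (rv u uin).
  have uN : 2 * `|u| <= N%:R by lra.
  have sE := stieltjes_tail t1 t3 uN.
  split.
    move=> [mu /hb hu]; split; first exact: supp0.
    by rewrite hu sE addrA subrr.
  move=> [mu fu]; split; first by rewrite /supp/= mu.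
  by apply/hb; move: fu; rewrite sE addrA => /eqP; rewrite addrC addr_eq0 => /eqP.
Unshelve. all: by end_near. Qed.

End assembly.

(** * Perturbation classes for the three regimes of K_M *)

Section classes.
Context {R : realType} {d : measure_display} {T : nat -> measurableType d}.
Variable P : forall M, probability (T M) R.
Variable K : forall M, T M -> R[i] -> R[i].

Lemma regular_class b : regular_linear_limit P K 0 b -> forall k eta, 0 < eta ->
  exists rho delta : R, [/\ 0 < delta, k%:R <= rho & likely P eta (fun M => [set t |
    forall g : R -> R, (forall u, `|u| <= rho -> `|g u| <= delta) ->
    near_cst b k (fun u => g u + boundary_re (@K M t) u)])].
Proof.
move=> h k eta eta0; exists (k%:R + 1), (k.+1%:R^-1 / 2).
have d0 : 0 < k.+1%:R^-1 / 2 :> R by rewrite divr_gt0// invr_gt0.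
have k1 : 0 < k%:R + 1 :> R by rewrite ltr_wpDl.
split => //; first by rewrite lerDl.
apply: likely_sub (whp_likely (h _ _ k1 d0) eta0) => M t /= ht g hg u uk.
have uk' : `|u| <= k%:R + 1 by apply: le_trans uk _; rewrite lerDl.
have h1 := hg u uk'.
have h2 := ht u ltac:(by rewrite in_itv/= -ler_norml); rewrite mul0r add0r in h2.
rewrite -addrA; apply: le_trans (ler_normD _ _) _.
by rewrite [leRHS]splitr; exact: lerD.
Qed.

Lemma singular_class s : s = 1 \/ s = - 1 -> singular_limit P K s -> forall k eta, 0 < eta ->
  exists rho delta : R, [/\ 0 < delta, k%:R <= rho & likely P eta (fun M => [set t |
    forall g : R -> R, (forall u, `|u| <= rho -> `|g u| <= delta) ->
    near_infty s k (fun u => g u + boundary_re (@K M t) u)])].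
Proof.
move=> s1 h k eta eta0; exists (k%:R + 1), 1.
have k1 : 0 < k%:R + 1 :> R by rewrite ltr_wpDl.
split => //; first by rewrite lerDl.
apply: likely_sub (whp_likely (h _ (k%:R + 1) k1) eta0) => M t /= ht g hg u uk.
have uk' : `|u| <= k%:R + 1 by apply: le_trans uk _; rewrite lerDl.
have h2 := ht u ltac:(by rewrite in_itv/= -ler_norml).
have /ler_normlP[h1 h3] := hg u uk'.
rewrite mulrDr; case: s1 h2 => ->; rewrite ?mulN1r ?mul1r; move: h1 h3; clear - R; lra.
Qed.

Lemma transition_class tau : singular_transition_limit P K tau -> forall k eta, 0 < eta ->
  exists rho delta : R, [/\ 0 < delta, k%:R <= rho & likely P eta (fun M => [set t |
    forall g : R -> R, (forall u, `|u| <= rho -> `|g u| <= delta) ->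
    near_trans tau k (fun u => g u + boundary_re (@K M t) u)])].
Proof.
move=> h k eta eta0; exists (k%:R + `|tau| + 1), 1.
have k0 : 0 <= k%:R :> R by [].
have t0 : 0 <= `|tau| by [].
split => //; first by lra.
have r0 : 0 < k.+1%:R^-1 :> R by rewrite invr_gt0.
have r1 : k.+1%:R^-1 <= 1 :> R by rewrite invf_le1// ler1n.
have e2 : 0 < eta / 2 by lra.
have [h1 h2] := h (k%:R + 1) _ r0.
have -> : eta = eta / 2 + eta / 2 by lra.
apply: likely_sub (likelyI (whp_likely h1 e2) (whp_likely h2 e2)) => M t /= [t1 t2] g hg.
have b1 : `|tau + k.+1%:R^-1| <= k%:R + `|tau| + 1.
  by apply: le_trans (ler_normD _ _) _; rewrite (gtr0_norm r0) lerD// lerDr.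
have b2 : `|tau - k.+1%:R^-1| <= k%:R + `|tau| + 1.
  by apply: le_trans (ler_normB _ _) _; rewrite (gtr0_norm r0) lerD// lerDr.
have /ler_normlP[a1 a2] := hg _ b1; have /ler_normlP[a3 a4] := hg _ b2.
rewrite /near_trans; move: a1 a2 a3 a4 t1 t2.
move: (g _) (boundary_re _ _) (g _) (boundary_re _ _) => g1 h3 g2 h4.
by clear; split; lra.
Qed.

End classes.

Theorem theorem4p4 (R : realType)
    (d : measure_display) (T : nat -> measurableType d)
    (P : forall M : nat, probability (T M) R)
    (omegaM : forall M : nat, T M -> conf R)
    (K : forall M : nat, T M -> R[i] -> R[i])
    (d' : measure_display) (T' : measurableType d') (P' : probability T' R)
    (omega : T' -> conf R)
    (hpp : forall M, point_process (omegaM M))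
    (hsums : forall M, {ae P M, forall t, sums_defined (omegaM M t)})
    (hpoisson : standard_poisson P' omega)
    (hi : cvg_in_distribution P omegaM P' omega)
    (hii : tails_vanish P omegaM)
    (hK : random_herglotz P K)
    (hlin : generalized_linear_limit P K) :
  let sol M t := conf_of_set (solution_set (omegaM M t) (K M t)) in
  [/\ forall b : R, regular_linear_limit P K 0 b ->
        cvg_in_distribution P
          (fun M t => (conf_of_set (supp (omegaM M t)), sol M t))
          P' (seba_process omega b),
      singular_limit P K 1 \/ singular_limit P K (-1) ->
        cvg_in_distribution P (fun M t => (omegaM M t, sol M t))
          P' (fun t => (omega t, omega t))
    & forall tau : R, singular_transition_limit P K tau ->
        cvg_in_distribution P (fun M t => (omegaM M t, sol M t))
          P' (fun t => (omega t, conf_of_set (supp (omega t) `|` [set tau])))].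
Proof.
move=> sol.
have hY : point_process omega by case: hpoisson.
split.
- move=> b hb.
  have [Om [mOm Om1 Omg]] := poisson_good hpoisson.
  have Oms t : Om t -> simple (omega t) by move=> /Omg[].
  have Z0 t (Ot : Om t) V := level_zeros_close (b := b) (Omg t Ot) (U := V).
  (* In this regime the first component is the support of omega_M, with multiplicities forgotten;
     this operation is continuous at simple configurations. *)
  have hp t : Om t -> forall V, nbhs (omega t) V ->
      nbhs (omega t) [set m' : conf R | V (conf_of_set (supp m'))].
    move=> Ot V nV; have := @add_points_continuous R (omega t) [::] V (Oms t Ot).
    have e m : supp m `|` [set` [::]] = supp m :> set R.
      by apply/seteqP; split => v; [case|left].
    rewrite e conf_of_supp; last exact: Oms.
    move=> /(_ _ nV); rewrite (_ : [set m' : conf R | V (conf_of_set (supp m' `|` [set` [::]]))] =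
      [set m' : conf R | V (conf_of_set (supp m'))]); first by apply.
    by apply/funext => m' /=; rewrite e.
  apply: (@continuous_mapping R d T P d' T' P' omegaM omega Om hpp hY hi mOm Om1 Oms _ _ _
    (stable (fun m => conf_of_set (supp m)) (near_cst b))).
  (* Stability also yields the measurability of the limit: on [Om], the process is in U exactly
     when, for some k, omega lies in [V k N] for all large N. For the converse inclusion, stability
     is applied to omega itself, with its own tail plus b as the perturbation. *)
  + move=> U oU.
    pose V k N := interior (stable id (near_cst b) U k N).
    have oV k N : open (V k N) by exact: open_interior.
    pose B k N := Om `&` omega @^-1` (V k N).
    have mB k N : measurable (B k N).
      by case: (portmanteau_open hpp hY hi mOm Oms (oV k N)).
    suff -> : Om `&` seba_process omega b @^-1` U =
        \bigcup_k \bigcup_n \bigcap_(N in [set N | (n <= N)%N]) B k N.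
      apply: bigcupT_measurable => k; apply: bigcupT_measurable => n.
      by apply: bigcap_measurableType => N _.
    apply/seteqP; split => t.
      move=> [Ot Ut].
      have [k _ /(_ k (leqnn k)) [n _ hn]] := stable_near (p := id) (fun V nV => nV) (Z0 t Ot)
        (open_nbhs_nbhs (conj oU Ut)).
      by exists k => //; exists n => // N /= nN; split => //; exact: hn.
    move=> [k _ [n _ hB]].
    have Ot : Om t by case: (hB n (leqnn n)).
    split => //; have gm := Omg t Ot.
    have k0 : 0 <= k%:R :> R by [].
    have r0 : 0 < k.+1%:R^-1 :> R by rewrite invr_gt0.
    have den : 0 < 1 + 4 * k%:R :> R by lra.
    have e0 : 0 < k.+1%:R^-1 / (1 + 4 * k%:R) :> R by rewrite divr_gt0.
    have ht := good_tails gm e0.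
    near \oo => N.
    have nN : (n <= N)%N by near: N; exact: nbhs_infty_ge.
    have kN : 2 * k%:R <= N%:R :> R by near: N; exact: nbhs_infty_ger.
    have [t1 t2 t3] : [/\ cvgn (fun i => tsum (omega t) N i 0),
      `|tail (omega t) N 0| <= k.+1%:R^-1 / (1 + 4 * k%:R) &
      forall i, tsum2 (omega t) N i <= k.+1%:R^-1 / (1 + 4 * k%:R)] by near: N.
    have [_ /interior_subset st] := hB N nN.
    have [ca ma] := tail_adm t1 t3 kN.
    apply: (st (fun u => tail (omega t) N u + b)).
    * split; first by move=> x; apply: cvgD; [exact: ca|exact: cvg_cst].
      by move=> x y xk yk xy; rewrite lerD2r; exact: ma.
    * move=> u uk; rewrite addrK.
      have uN : 2 * `|u| <= N%:R by lra.
      exact: (tail_small t1 t3 erefl t2 uN uk).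
    * move=> u uk; have uN : 2 * `|u| <= N%:R by lra.
      rewrite addrA -(stieltjes_tail t1 t3 uN); split.
        by move=> [mu su]; split; [exact: supp0|rewrite su addrC subrr].
      move=> [mu /eqP]; rewrite addr_eq0 => /eqP su; by split.
  + move=> U oU t Ot Ut; apply: stable_near (open_nbhs_nbhs (conj oU Ut)).
      exact: hp.
    exact: Z0.
  + move=> U oU k e e0.
    exact: (stable_likely hpp hsums hii hK _ (regular_class hb)).
- move=> hs.
  have [s s1 hs'] : exists2 s : R, s = 1 \/ s = - 1 & singular_limit P K s.
    by case: hs => h; [exists 1|exists (-1)] => //; [left|right].
  have [Om [mOm Om1 Omg]] := poisson_good hpoisson.
  have Oms t : Om t -> simple (omega t) by move=> /Omg[].
  apply: (@continuous_mapping R d T P d' T' P' omegaM omega Om hpp hY hi mOm Om1 Oms _ _ _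
    (stable id (near_infty s))).
  + move=> U oU.
    have oV : open [set m : conf R | U (m, m)].
      rewrite openE => m /= Um; have [[V1 V2] /= [n1 n2] sub] := open_nbhs_nbhs (conj oU Um).
      by apply: filterS2 n1 n2 => m' a1 a2; exact: sub.
    by case: (portmanteau_open hpp hY hi mOm Oms oV).
  + move=> U oU t Ot Ut; apply: stable_near (open_nbhs_nbhs (conj oU Ut)) => //.
    by move=> V; exact: infty_zeros_close (Omg t Ot) s V s1.
  + move=> U oU k e e0.
    exact: (stable_likely hpp hsums hii hK _ (singular_class s1 hs')).
- move=> tau htau.
  have [Om [mOm Om1 Omg']] := fullI (poisson_good hpoisson) (poisson_no_atom hpoisson tau).
  have Omg t : Om t -> good (omega t) by move=> /Omg'[].
  have Omt t : Om t -> omega t tau = 0%N by move=> /Omg'[].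
  have Oms t : Om t -> simple (omega t) by move=> /Omg[].
  have e m : supp m `|` [set` [:: tau]] = supp m `|` [set tau] :> set R.
    by congr (_ `|` _); apply/seteqP; split => v /=; rewrite inE => /eqP.
  apply: (@continuous_mapping R d T P d' T' P' omegaM omega Om hpp hY hi mOm Om1 Oms _ _ _
    (stable id (near_trans tau))).
  + move=> U oU.
    (* Adding [tau] is known to be continuous only at the configurations met on [Om], where the
       preimage of U and its interior therefore agree. *)
    pose V := interior [set m : conf R | U (m, conf_of_set (supp m `|` [set tau]))].
    have oV : open V by exact: open_interior.
    suff -> : Om `&` (fun t => (omega t, conf_of_set (supp (omega t) `|` [set tau]))) @^-1` U =
        Om `&` omega @^-1` V.
      by case: (portmanteau_open hpp hY hi mOm Oms oV).
    apply/seteqP; split => t [Ot Ut]; split => //; last exact: (interior_subset Ut).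
    have [[V1 V2] /= [n1 n2] sub] := open_nbhs_nbhs (conj oU Ut).
    have h2 := @add_points_continuous R (omega t) [:: tau] V2 (Oms t Ot).
    rewrite e in h2; have {}h2 := h2 _ n2.
    apply: filterS2 n1 (h2 _).
      by move=> m' /= a1 a2; apply: sub; split => //=; rewrite -e.
    by move=> a; rewrite inE => /eqP ->; exact: Omt.
  + move=> U oU t Ot Ut; apply: stable_near (open_nbhs_nbhs (conj oU Ut)) => //.
    by move=> V; exact: trans_zeros_close (Omg t Ot) tau V (Omt t Ot).
  + move=> U oU k e' e0.
    exact: (stable_likely hpp hsums hii hK _ (transition_class htau)).
Unshelve. all: by end_near. Qed.
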